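(* The monoid variety $$\mathbf G=\operatorname{var}\{xyxz\approx xyxzx,\ xx_1xx_0x_1\approx x^2x_1x_0x_1,\ \mathbf w_n[\pi,\pi']\approx\mathbf w_n'[\pi,\pi']\mid n\ge1,\ \pi,\pi'\in S_{2n}\}$$ is a non-finitely based, finitely generated almost Cross variety of monoids.
   Context: All varieties are varieties of monoids; $\operatorname{var}\Sigma$ is the monoid variety defined by the set $\Sigma$ of identities. A variety is finitely based if it can be defined by finitely many identities, finitely generated if it is generated by a single finite monoid, and small if its lattice of subvarieties is finite. A variety is Cross if it is finitely based, finitely generated and small; it is almost Cross if it is not Cross but every proper subvariety of it is Cross. $S_{2n}$ is the symmetric group on $\{1,\dots,2n\}$. For $n\ge1$ and $\pi,\pi'\in S_{2n}$, $$\mathbf w_n[\pi,\pi']=\Bigl(\prod_{i=1}^n x_it_i\Bigr)x\Bigl(\prod_{i=1}^{2n}z_i\Bigr)y\Bigl(\prod_{i=n+1}^{2n}t_ix_i\Bigr)txy\Bigl(\prod_{i=1}^{2n}x_{i\pi}z_{i\pi'}\Bigr),$$ $$\mathbf w_n'[\pi,\pi']=\Bigl(\prod_{i=1}^n x_it_i\Bigr)x\Bigl(\prod_{i=1}^{2n}z_i\Bigr)y\Bigl(\prod_{i=n+1}^{2n}t_ix_i\Bigr)tyx\Bigl(\prod_{i=1}^{2n}x_{i\pi}z_{i\pi'}\Bigr),$$ where all named letters are distinct and products are taken in increasing order of the index. *)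

(* Defs.v *)
From mathcomp Require Import all_boot perm.
From mathcomp Require Import boolp classical_sets cardinality.

Set Implicit Arguments.
Unset Strict Implicit.
Unset Printing Implicit Defensive.

Local Open Scope classical_set_scope.

(* Words are elements of the free monoid over the countably infinite alphabet
   nat; [::] is the empty word. *)
Definition word := seq nat.
Definition identity := (word * word)%type.

Definition eval (M : monoidType) (phi : nat -> M) (w : word) : M :=
  (\prod_(a <- w) phi a)%g.

Definition satisfies (M : monoidType) (e : identity) : Prop :=
  forall phi : nat -> M, eval phi e.1 = eval phi e.2.

(* Classes of monoids are compared extensionally: the universe of monoidType is
   above the one allowed for the type of elements of a [set]. *)
Definition monoid_class := monoidType -> Prop.

Definition subclass (V W : monoid_class) : Prop := forall M, V M -> W M.
Definition same_class (V W : monoid_class) : Prop := forall M, V M <-> W M.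
Definition proper_subclass (V W : monoid_class) : Prop :=
  subclass V W /\ ~ same_class V W.

Definition var (Sigma : set identity) : monoid_class :=
  fun M => forall e, Sigma e -> satisfies M e.

(* Varieties are equational classes. *)
Definition is_variety (V : monoid_class) : Prop :=
  exists Sigma, same_class V (var Sigma).

(* The least variety containing M. *)
Definition var_gen (M : monoidType) : monoid_class :=
  fun N => forall W, is_variety W -> W M -> W N.

Definition finitely_based (V : monoid_class) : Prop :=
  exists Sigma, finite_set Sigma /\ same_class V (var Sigma).

Definition finitely_generated (V : monoid_class) : Prop :=
  exists M : monoidType, finite_set [set: M] /\ same_class V (var_gen M).

(* The subvarieties of V are, up to extensional equality, among the members of
   a finite family. *)
Definition small (V : monoid_class) : Prop :=
  exists (k : nat) (F : 'I_k -> monoid_class),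
    forall W, is_variety W -> subclass W V -> exists i, same_class W (F i).

Definition Cross (V : monoid_class) : Prop :=
  [/\ finitely_based V, finitely_generated V & small V].

Definition almost_Cross (V : monoid_class) : Prop :=
  [/\ is_variety V, ~ Cross V &
      forall W, is_variety W -> proper_subclass W V -> Cross W].

(* The letters x, y, z, t, x_i, z_i, t_i, coded as pairwise distinct naturals. *)
Definition lx : nat := 0.
Definition ly : nat := 1.
Definition lz : nat := 2.
Definition lt : nat := 3.
Definition lxi (i : nat) : nat := 4 + 3 * i.
Definition lzi (i : nat) : nat := 5 + 3 * i.
Definition lti (i : nat) : nat := 6 + 3 * i.

(* A permutation in 'S_(2 * n) acts on {0, .., 2n-1}: the point i.+1 of
   {1, .., 2n} is represented by the ordinal i. *)
Definition w_word (n : nat) (p q : 'S_(2 * n)) : word :=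
  \big[cat/[::]]_(1 <= i < n.+1) [:: lxi i; lti i]
  ++ [:: lx]
  ++ \big[cat/[::]]_(1 <= i < (2 * n).+1) [:: lzi i]
  ++ [:: ly]
  ++ \big[cat/[::]]_(n.+1 <= i < (2 * n).+1) [:: lti i; lxi i]
  ++ [:: lt; lx; ly]
  ++ \big[cat/[::]]_(i < 2 * n) [:: lxi (p i).+1; lzi (q i).+1].

Definition w'_word (n : nat) (p q : 'S_(2 * n)) : word :=
  \big[cat/[::]]_(1 <= i < n.+1) [:: lxi i; lti i]
  ++ [:: lx]
  ++ \big[cat/[::]]_(1 <= i < (2 * n).+1) [:: lzi i]
  ++ [:: ly]
  ++ \big[cat/[::]]_(n.+1 <= i < (2 * n).+1) [:: lti i; lxi i]
  ++ [:: lt; ly; lx]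
  ++ \big[cat/[::]]_(i < 2 * n) [:: lxi (p i).+1; lzi (q i).+1].

Definition G_identities : set identity :=
  [set ([:: lx; ly; lx; lz], [:: lx; ly; lx; lz; lx]);
       ([:: lx; lxi 1; lx; lxi 0; lxi 1], [:: lx; lx; lxi 1; lxi 0; lxi 1])]
  `|` [set e | exists (n : nat) (p q : 'S_(2 * n)),
                 (1 <= n)%N /\ e = (w_word p q, w'_word p q)].

Definition G_variety : monoid_class := var G_identities.

(* Main.v *)
Require Import Defs.
From HB Require Import structures.
From mathcomp Require Import all_boot perm zify.
From mathcomp Require Import boolp classical_sets cardinality.

Set Implicit Arguments.
Unset Strict Implicit.
Unset Printing Implicit Defensive.

(* Equational theories are fully invariant congruences on words. By the first
   identity only the first two occurrences of a letter matter; letters occurring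
   once cut a word into blocks, and by the second identity the second occurrence
   of a letter may move freely inside the block of the first one ("square"
   letters). A word thus becomes a sequence of first and second occurrences, and
   two words are equal in a subvariety iff they differ by transpositions of
   adjacent occurrences that the subvariety allows. If an identity inverts a pair
   of occurrences, deleting all but a few letters leaves one of fourteen short
   identities ("flags"), and conversely the flags of a subvariety yield all the
   transpositions it allows; hence a theory containing that of G is determined by
   its flags. All flags imply the weakest one, [fsg], which fails in G and, with
   the first two identities, implies all w_n = w_n'. So the proper subvarieties of
   G are defined by these two identities and a set of flags: they are finitely
   based and finitely many. Flags involve six letters, and free objects of rank
   six are finite and generate. Finally G is not finitely based: adjacent second
   occurrences of x and y commute in w_n only if every letter z first occurring
   between x and y has its second occurrence in the same run of second
   occurrences; applying an identity with fewer than 2n letters maps one letter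
   onto a factor containing two of the z_i, whose second occurrences are
   separated by some x_j. *)

(** * Equational theories *)

(** Derivations are built in one theory [E'] from inversions observed in another theory [E], and
    exchanges of adjacent second occurrences enter through an abstract hypothesis, [run_swaps]. The
    completeness argument thus serves twice: with [E'] containing all w_n = w_n' it shows that flags
    determine a theory; with [E'] the theory of a language separating w_n from w_n' it shows that
    short identities do not suffice. Second occurrences of x and y are the delicate pair: whether
    they commute depends on a whole factor, namely on letters z starting between x and y and on what
    starts between the second occurrences of x, y and that of z. A letter starting there may be
    simple (occur once), repeated across a simple letter, or a square; [fg2], [fg3] and [fsg] record
    which of these are tolerated. Failure of an identity is shown by languages of words with
    prescribed truncation. Closure under the second identity forbids squares in the truncated word,
    and this is why a square letter of [fsg] has to be counted only once there. *)

Definition subst (f : nat -> word) (w : word) : word := flatten (map f w).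

Record congruence (E : word -> word -> Prop) : Prop := Congruence {
  congR : forall u, E u u;
  congS : forall u v, E u v -> E v u;
  congT : forall v u w, E u v -> E v w -> E u w;
  congC : forall a b c d, E a b -> E c d -> E (a ++ c) (b ++ d) }.

Record theory (E : word -> word -> Prop) : Prop := Theory {
  theory_cong :> congruence E;
  theoryF : forall f u v, E u v -> E (subst f u) (subst f v) }.

Lemma subst_cat f u v : subst f (u ++ v) = subst f u ++ subst f v.
Proof. by rewrite /subst map_cat flatten_cat. Qed.

Lemma subst_cons f a v : subst f (a :: v) = f a ++ subst f v.
Proof. by []. Qed.

Lemma subst_comp f g u : subst f (subst g u) = subst (fun a => subst f (g a)) u.
Proof. by elim: u => //= a u IH; rewrite !subst_cons subst_cat IH. Qed.

Lemma subst_id u : subst (fun a => [:: a]) u = u.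
Proof. by elim: u => //= a u IH; rewrite subst_cons IH. Qed.

Lemma eq_subst f g u : {in u, f =1 g} -> subst f u = subst g u.
Proof. by move=> fg; congr flatten; apply/eq_in_map. Qed.

Lemma eval_cat (M : monoidType) (phi : nat -> M) u v :
  eval phi (u ++ v) = (eval phi u * eval phi v)%g.
Proof. by rewrite /eval big_cat. Qed.

Lemma eval_subst (M : monoidType) (phi : nat -> M) f u :
  eval phi (subst f u) = eval (fun a => eval phi (f a)) u.
Proof.
elim: u => [|a u IH]; first by rewrite /eval !big_nil.
by rewrite subst_cons eval_cat IH /eval big_cons.
Qed.

Definition eqs (V : monoid_class) (u v : word) : Prop :=
  forall M, V M -> satisfies M (u, v).

Lemma eqs_theory V : theory (eqs V).
Proof.
split; first split.
- by move=> u M VM phi.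
- by move=> u v uv M VM phi; rewrite /= (uv M VM phi).
- by move=> v u w uv vw M VM phi; rewrite /= (uv M VM phi) (vw M VM phi).
- by move=> a b c d ab cd M VM phi; rewrite /= !eval_cat (ab M VM phi) (cd M VM phi).
- by move=> f u v uv M VM phi; rewrite /= !eval_subst (uv M VM _).
Qed.

(** * Quotients of the free monoid and completeness of equational deduction *)

Section Quotient.
Variables (E : word -> word -> Prop) (cE : congruence E).

(** A classical choice of representatives makes the quotient a subtype of words, so that equality of
    classes is equality. *)
Definition quo_repr (w : word) : word := xget [::] [set v | E w v]%classic.

Lemma quo_reprP w : E w (quo_repr w).
Proof. by apply: (@xgetPex _ [::] [set v | E w v]%classic); exists w; apply: congR. Qed.

Lemma quo_repr_eq u v : E u v -> quo_repr u = quo_repr v.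
Proof.
move=> uv; rewrite /quo_repr; congr xget; apply/predeqP => w /=.
by split=> H; [apply: (congT cE (congS cE uv)) H | apply: (congT cE uv) H].
Qed.

Lemma quo_repr_idem w : quo_repr (quo_repr w) == quo_repr w.
Proof. by apply/eqP/esym/quo_repr_eq/quo_reprP. Qed.

(** The proof of congruence is an argument of the type, so that the monoid structure depending on it
    can be attached as a canonical instance. *)
Definition quo of congruence E := {w : word | quo_repr w == w}.

HB.instance Definition _ := Choice.on (quo cE).

Definition quo_pi (w : word) : quo cE := exist _ (quo_repr w) (quo_repr_idem w).
Definition quo_mul (a b : quo cE) : quo cE := quo_pi (sval a ++ sval b).

Lemma quo_pi_eq u v : quo_pi u = quo_pi v <-> E u v.
Proof.
split=> [/(congr1 sval) /= uv|uv]; last by apply: val_inj; apply: quo_repr_eq.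
by apply: (congT cE (quo_reprP u)); rewrite uv; apply: congS (quo_reprP v).
Qed.

Lemma quo_piK (a : quo cE) : quo_pi (sval a) = a.
Proof. by apply: val_inj => /=; apply/eqP; case: a. Qed.

Lemma quo_pi_cat u v : quo_pi (u ++ v) = quo_mul (quo_pi u) (quo_pi v).
Proof. by apply/quo_pi_eq; apply: congC => //; apply: quo_reprP. Qed.

Lemma quo_mulA : associative quo_mul.
Proof.
move=> a b c; rewrite -(quo_piK a) -(quo_piK b) -(quo_piK c).
by rewrite -!quo_pi_cat catA.
Qed.

Lemma quo_mul1 : left_id (quo_pi [::]) quo_mul.
Proof. by move=> a; rewrite -(quo_piK a) -quo_pi_cat. Qed.

Lemma quo_mulr1 : right_id (quo_pi [::]) quo_mul.
Proof. by move=> a; rewrite -(quo_piK a) -quo_pi_cat cats0. Qed.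

HB.instance Definition _ := isMonoid.Build (quo cE) quo_mulA quo_mul1 quo_mulr1.

Lemma eval_quo f w : eval (fun a => quo_pi (f a) : quo cE) w = quo_pi (subst f w).
Proof.
elim: w => [|a w IH]; first by rewrite /eval big_nil.
by rewrite subst_cons quo_pi_cat -IH /eval big_cons.
Qed.

Lemma quo_satisfies u v :
  satisfies (quo cE) (u, v) <-> forall f, E (subst f u) (subst f v).
Proof.
split=> [H f|H phi] /=.
  by apply/quo_pi_eq; rewrite -!eval_quo; apply: H.
have -> : phi = fun a => quo_pi (sval (phi a)).
  by apply/funext => a; rewrite quo_piK.
by rewrite !eval_quo; apply/quo_pi_eq.
Qed.

End Quotient.

(** Birkhoff's completeness: closure under substitution puts the quotient by [E] into [var Sigma],
    and evaluation at the classes of the letters recovers [E u v]. *)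
Lemma eqs_var_min (Sigma : set identity) E :
  theory E -> (forall e, Sigma e -> E e.1 e.2) ->
  forall u v, eqs (var Sigma) u v -> E u v.
Proof.
move=> tE sE u v uv.
have := uv (quo tE) _; rewrite quo_satisfies => H.
rewrite -[u]subst_id -[v]subst_id; apply: H => e /sE Ee.
by rewrite [e]surjective_pairing; apply/quo_satisfies => f; apply: theoryF.
Qed.

Lemma eqs_var Sigma e : Sigma e -> eqs (var Sigma) e.1 e.2.
Proof. by move=> Se M VM; rewrite -surjective_pairing; apply: VM. Qed.

Lemma variety_eqsP V : is_variety V ->
  forall M, V M <-> (forall u v, eqs V u v -> satisfies M (u, v)).
Proof.
move=> [S VS] M; split=> [VM u v uv|H]; first exact: uv.
apply/VS => e Se; rewrite [e]surjective_pairing; apply: H => N /VS VN.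
by rewrite -surjective_pairing; apply: VN.
Qed.

(** * Truncation of multiplicities *)

(* [keep k w] deletes from [w] every occurrence of a letter [x] after its
   [k x] first ones. *)
Fixpoint keep (k : nat -> nat) (w : word) : word :=
  if w is a :: w' then
    let r := keep (fun x => k x - (x == a)) w' in if k a is 0 then r else a :: r
  else [::].

Definition red : word -> word := keep (fun=> 2).

Lemma eq_keep k k' w : k =1 k' -> keep k w = keep k' w.
Proof. by move=> /funext ->. Qed.

Lemma eq_in_keep k k' w : {in w, k =1 k'} -> keep k w = keep k' w.
Proof.
elim: w k k' => //= a w IH k k' H; rewrite (H a) ?mem_head //.
by rewrite (IH _ (fun x => k' x - (x == a))) // => x xw; rewrite H // inE xw orbT.
Qed.

Lemma keep_cat k u v :
  keep k (u ++ v) = keep k u ++ keep (fun x => k x - count_mem x u) v.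
Proof.
elim: u k => [|a u IH] k /=; first by apply: eq_keep => x; rewrite subn0.
rewrite IH.
have -> : keep (fun x => k x - (x == a) - count_mem x u) v =
          keep (fun x => k x - ((a == x) + count_mem x u)) v.
  by apply: eq_keep => x; rewrite subnDA eq_sym.
by case: (k a).
Qed.

Lemma count_keep k w x : count_mem x (keep k w) = minn (k x) (count_mem x w).
Proof.
elim: w k => [|a w IH] k /=; first by rewrite minn0.
by case ka: (k a) => [|m] /=; rewrite IH (eq_sym x);
   case: (eqVneq a x) => [ax|_] /=; rewrite -?ax ?ka; lia.
Qed.

Lemma keep0 k w : (forall x, x \in w -> k x = 0) -> keep k w = [::].
Proof.
elim: w k => //= a w IH k H; rewrite H ?mem_head // IH // => x xw.
by rewrite H ?inE ?xw ?orbT.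
Qed.

Lemma keep_id k w : (forall x, x \in w -> count_mem x w <= k x) -> keep k w = w.
Proof.
elim: w k => //= a w IH k H.
have := H a (mem_head _ _); rewrite /= eqxx; case ka: (k a) => // _.
rewrite IH // => x xw; have /= := H x; rewrite inE xw orbT => /(_ isT).
by rewrite (eq_sym x); lia.
Qed.

Lemma count_red w x : count_mem x (red w) = minn 2 (count_mem x w).
Proof. exact: count_keep. Qed.

Lemma count2_split (T : eqType) (x : T) (p : seq T) : 2 <= count_mem x p ->
  exists p1 p2 p3, p = p1 ++ x :: p2 ++ x :: p3.
Proof.
move=> c2; have xp : x \in p by rewrite -has_pred1 has_count (leq_trans _ c2).
case/splitPr: xp c2 => p1 q; rewrite count_cat /= eqxx => c2.
have [xq|xq] := boolP (x \in q).
  by case/splitPr: xq => q1 q2; exists p1, q1, q2.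
have xp1 : x \in p1.
  by rewrite -has_pred1 has_count; move: c2; rewrite (count_memPn xq) addn0 addn1.
by case/splitPr: xp1 => q1 q2; exists q1, q2, q; rewrite -catA.
Qed.

Ltac lcat := repeat (rewrite -?catA /= ?cats0); rewrite ?cats0.

Ltac cnt := repeat (rewrite ?count_cat /=).

Definition inst (l : seq word) (a : nat) : word := nth [::] l a.

(** * Deductions from the first two identities *)

Section Deduction.
Variables (E : word -> word -> Prop) (tE : theory E).

Lemma thCC p q a b : E a b -> E (p ++ a ++ q) (p ++ b ++ q).
Proof.
move=> ab; apply: (congC tE); first exact: (congR tE).
by apply: (congC tE) => //; apply: (congR tE).
Qed.

Lemma thCl p a b : E a b -> E (p ++ a) (p ++ b).
Proof. by move=> ab; apply: (congC tE) => //; apply: (congR tE). Qed.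

Lemma thCr q a b : E a b -> E (a ++ q) (b ++ q).
Proof. by move=> ab; apply: (congC tE) => //; apply: (congR tE). Qed.

Lemma thT2 a b a' b' : E a a' -> E b b' -> E a' b' -> E a b.
Proof. by move=> aa bb ab; apply: (congT tE aa); apply: (congT tE ab); apply: (congS tE). Qed.

Lemma thE a b a' b' : E a' b' -> a = a' -> b = b' -> E a b.
Proof. by move=> + -> ->. Qed.

Lemma th_inst l a b : E a b -> E (subst (inst l) a) (subst (inst l) b).
Proof. exact: theoryF. Qed.

Hypothesis E1 : E [:: lx; ly; lx; lz] [:: lx; ly; lx; lz; lx].

(** The first identity read from right to left, with the factors between and after two earlier
    occurrences of [x] substituted for y and z. *)
Lemma del3 p x r : 2 <= count_mem x p -> E (p ++ x :: r) (p ++ r).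
Proof.
move=> /count2_split [p1 [p2 [p3 ->]]].
have /(congS tE) := th_inst [:: [:: x]; p2; p3] E1.
rewrite /subst /inst /= => /(thCC p1 r) H.
by apply: (thE H); lcat.
Qed.

Lemma del3s p v r : (forall x, x \in v -> 2 <= count_mem x p) -> E (p ++ v ++ r) (p ++ r).
Proof.
elim: v => [|a v IH] H; first exact: (congR tE).
apply: (congT tE) (IH _) => [|x xv]; last by apply: H; rewrite inE xv orbT.
by rewrite cat_cons; apply: del3; apply: H; rewrite mem_head.
Qed.

Lemma E_red_cat p v : E (p ++ v) (p ++ keep (fun x => 2 - count_mem x p) v).
Proof.
elim: v p => [|a v IH] p; first exact: (congR tE).
have ext : keep (fun x => 2 - count_mem x (rcons p a)) v =
           keep (fun x => 2 - count_mem x p - (x == a)) v.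
  by apply: eq_keep => x; rewrite -cats1 count_cat /= addn0 (eq_sym a) subnDA.
rewrite /=; case ka: (2 - _) => [|m].
  have d3 : 2 <= count_mem a p by rewrite -subn_eq0 ka.
  apply: (congT tE (del3 _ d3)); apply: (congT tE (IH p)).
  rewrite (_ : keep _ v = keep (fun x => 2 - count_mem x p - (x == a)) v).
    exact: (congR tE).
  by apply: eq_keep => x; case: eqVneq => [->|_]; rewrite ?ka ?subn0.
by have := IH (rcons p a); rewrite ext !cat_rcons.
Qed.

Lemma E_red w : E w (red w).
Proof. exact: E_red_cat [::] w. Qed.

Lemma red_eq u v : red u = red v -> E u v.
Proof. by move=> uv; apply: (thT2 (E_red u) (E_red v)); rewrite uv; apply: (congR tE). Qed.

Hypothesis E2 : E [:: lx; lxi 1; lx; lxi 0; lxi 1] [:: lx; lx; lxi 1; lxi 0; lxi 1].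

(** A copy of [Y] may be appended because its letters already occur twice. The word then ends in an
    instance of the second identity, with [Y] for x_1 and [r] for x_0; the copy is deleted
    afterwards. *)
Lemma square_left p x Y r :
  (forall c, c \in Y -> 2 <= count_mem c (p ++ x :: Y ++ x :: r)) ->
  E (p ++ x :: Y ++ x :: r) (p ++ x :: x :: Y ++ r).
Proof.
move=> H.
(* [lxi 0] and [lxi 1] are the codes 4 and 7, hence the places of [r] and [Y] in the list. *)
have /(thCC p [::]) K := th_inst [:: [:: x]; [::]; [::]; [::]; r; [::]; [::]; Y] E2.
rewrite /subst /inst /= in K.
apply: (@thT2 _ _ ((p ++ x :: Y ++ x :: r) ++ Y) ((p ++ x :: x :: Y ++ r) ++ Y)).
- have /(congS tE) := @del3s (p ++ x :: Y ++ x :: r) Y [::] H.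
  by rewrite !cats0.
- apply: (congS tE); have := @del3s (p ++ x :: x :: Y ++ r) Y [::].
  rewrite !cats0; apply => c cY; have := H c cY.
  by cnt; lia.
by apply: (thE K); lcat.
Qed.

(** Both words collapse to the one with two adjacent occurrences of [c]; on the right the third
    occurrence is deleted first. *)
Lemma square_insert p1 c p2 r1 r2 :
  (forall d, d \in p2 ++ r1 -> 2 <= count_mem d (p1 ++ c :: p2 ++ r1 ++ c :: r2)) ->
  E (p1 ++ c :: p2 ++ r1 ++ c :: r2) (p1 ++ c :: p2 ++ c :: r1 ++ c :: r2).
Proof.
move=> H.
apply: (@congT _ tE (p1 ++ c :: c :: p2 ++ r1 ++ r2)).
  by have := @square_left p1 c (p2 ++ r1) r2; rewrite -!catA; apply.
apply: (congS tE).
apply: (@congT _ tE (p1 ++ c :: p2 ++ c :: r1 ++ r2)).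
  have -> : p1 ++ c :: p2 ++ c :: r1 ++ c :: r2 = (p1 ++ c :: p2 ++ c :: r1) ++ c :: r2.
    by lcat.
  have d3 : 2 <= count_mem c (p1 ++ c :: p2 ++ c :: r1).
    by cnt; rewrite eqxx; lia.
  by apply: (congT tE (del3 _ d3)); lcat; apply: (congR tE).
apply: square_left => d dp; have := H d; rewrite mem_cat dp => /(_ isT).
by cnt; lia.
Qed.

Lemma square_swap p1 x p2 d q :
  (forall c, c \in d :: p2 -> 2 <= count_mem c (p1 ++ x :: p2 ++ x :: d :: q)) ->
  E (p1 ++ x :: p2 ++ x :: d :: q) (p1 ++ x :: p2 ++ d :: x :: q).
Proof.
move=> H.
apply: (@thT2 _ _ (p1 ++ x :: x :: p2 ++ d :: q) (p1 ++ x :: x :: (p2 ++ [:: d]) ++ q)).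
- by apply: square_left => c cp; apply: H; rewrite inE cp orbT.
- have := @square_left p1 x (p2 ++ [:: d]) q; rewrite -!catA /=; apply=> c.
  rewrite mem_cat inE orbC -in_cons => /H.
  by cnt; lia.
by lcat; apply: (congR tE).
Qed.

End Deduction.

(** * Rearranging a word by adjacent transpositions *)

Definition bef (T : eqType) (s : seq T) (a b : T) : bool := index a s < index b s.

Section Trace.
Variables (T : eqType) (D : T -> T -> Prop) (Q : seq T -> seq T -> Prop).
Variable s0 : seq T.
Hypothesis s0_uniq : uniq s0.
Hypothesis Qrefl : forall s, Q s s.
Hypothesis Qtrans : forall s2 s1 s3, Q s1 s2 -> Q s2 s3 -> Q s1 s3.
Hypothesis Dsym : forall a b, D a b -> D b a.

(** The invariant of partially commutative (trace) monoids: dependent items keep their relative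
    order. *)
Definition same_order (s : seq T) : Prop :=
  perm_eq s s0 /\
  forall c d, c \in s0 -> d \in s0 -> D c d -> bef s c d = bef s0 c d.

Hypothesis Qswap : forall p a b q,
  same_order (p ++ a :: b :: q) -> ~ D a b -> Q (p ++ a :: b :: q) (p ++ b :: a :: q).

Lemma same_order_swap p a b q :
  same_order (p ++ a :: b :: q) -> ~ D a b -> same_order (p ++ b :: a :: q).
Proof.
move=> [pe od] nD; have U : uniq (p ++ a :: b :: q) by rewrite (perm_uniq pe).
have pe2 : perm_eq (p ++ b :: a :: q) (p ++ a :: b :: q).
  by rewrite perm_cat2l (perm_catCA [:: b] [:: a] q).
split=> [|c d cs ds Dcd]; first by rewrite (perm_trans pe2).
rewrite -od // /bef.
have nab : ~ (c = a /\ d = b) by case=> ca db; apply: nD; rewrite -ca -db.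
have nba : ~ (c = b /\ d = a) by case=> ca db; apply: nD; apply: Dsym; rewrite -ca -db.
move: U; rewrite cat_uniq /= !inE !negb_or.
move=> /and5P [_ /and3P [ap bp _] /andP [ab aq] bq _].
(* The transposition only touches the indices [size p] and its successor, so every comparison other
   than that of [a] with [b] becomes arithmetic. *)
have P e : [\/ [/\ e = a, index e (p ++ a :: b :: q) = size p &
                        index e (p ++ b :: a :: q) = (size p).+1],
                 [/\ e = b, index e (p ++ a :: b :: q) = (size p).+1 &
                        index e (p ++ b :: a :: q) = size p] |
                 index e (p ++ a :: b :: q) = index e (p ++ b :: a :: q) /\
                 (index e (p ++ b :: a :: q) < size p \/
                  (size p).+1 < index e (p ++ b :: a :: q))].
  rewrite !index_cat /=; have [->|ea] := eqVneq e a.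
    by apply: Or31; rewrite (negbTE ap) ?eqxx ?(eq_sym b) ?(negbTE ab) addn0 addn1.
  have [->|eb] := eqVneq e b.
    by apply: Or32; rewrite (negbTE bp) ?eqxx ?(negbTE ab) addn0 addn1.
  apply: Or33; rewrite ?(eq_sym a) ?(negbTE ea) ?(eq_sym b) ?(negbTE eb).
  by case: ifP => [ep|_]; split=> //; [left; rewrite index_mem | right; rewrite !addnS !ltnS leq_addr].
move: (size p) (index c _) (index c _) (index d _) (index d _) (P c) (P d) nab nba.
clear=> n i i' j j' Pc Pd nab nba.
case: Pc => [[ca -> ->]|[cb -> ->]|[-> ci]];
case: Pd => [[da -> ->]|[db -> ->]|[-> di]]; try lia.
  by case: nab.
by case: nba.
Qed.

Lemma trace_move p r b q :
  same_order (r ++ p ++ b :: q) -> (forall a, a \in p -> ~ D a b) ->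
  Q (r ++ p ++ b :: q) (r ++ b :: p ++ q) /\ same_order (r ++ b :: p ++ q).
Proof.
elim/last_ind: p q => [|p a IH] q so nD; first by split.
have nDab : ~ D a b by apply: nD; rewrite mem_rcons mem_head.
have so1 : same_order ((r ++ p) ++ a :: b :: q).
  by move: so; rewrite cat_rcons catA.
have so2 := same_order_swap so1 nDab.
have [Q2 so3] : Q (r ++ p ++ b :: a :: q) (r ++ b :: p ++ a :: q) /\
                same_order (r ++ b :: p ++ a :: q).
  by apply: IH; [rewrite catA | move=> c cp; apply: nD; rewrite mem_rcons inE cp orbT].
rewrite !cat_rcons; split=> //; apply: Qtrans Q2.
by rewrite !catA; apply: Qswap.
Qed.

(** The head [b] of the target is moved to the front of the source: an item before [b] in the source
    is after [b] in the target, so it cannot depend on [b]. The prefix [r] holds the items already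
    in place. *)
Lemma trace_sound r s1 s2 :
  same_order (r ++ s1) -> same_order (r ++ s2) -> Q (r ++ s1) (r ++ s2).
Proof.
elim: s2 r s1 => [|b s2 IH] r s1 so1 so2.
  have : perm_eq (r ++ s1) (r ++ [::]).
    by rewrite (perm_trans so1.1) // perm_sym so2.1.
  by rewrite perm_cat2l => /perm_nilP ->.
have : perm_eq (r ++ s1) (r ++ b :: s2).
  by rewrite (perm_trans so1.1) // perm_sym so2.1.
rewrite perm_cat2l => pe; have bs1 : b \in s1 by rewrite (perm_mem pe) mem_head.
case/splitPr: bs1 so1 pe => p q so1 pe.
have U1 : uniq (r ++ p ++ b :: q) by rewrite (perm_uniq so1.1).
have [a ap|Q1 so3] := trace_move so1 _; last first.
  apply: Qtrans Q1 _; rewrite -!cat_rcons; apply: IH; rewrite cat_rcons //.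
move=> Dab; have as0 : a \in s0 by rewrite -(perm_mem so1.1) !mem_cat ap orbT.
have bs0 : b \in s0 by rewrite -(perm_mem so1.1) !mem_cat mem_head !orbT.
have := so1.2 a b as0 bs0 Dab; rewrite -(so2.2 a b as0 bs0 Dab) /bef !index_cat /= eqxx.
move: U1; rewrite !cat_uniq /= !negb_or.
move=> /and3P [_ nr /and3P [_ /andP [bp _] _]].
have ar : a \notin r by apply/negP => ar; move/hasP: nr; apply; exists a; rewrite // mem_cat ap.
have br : b \notin r.
  by apply/negP => br; move/hasP: nr; apply; exists b; rewrite // mem_cat mem_head orbT.
rewrite (negbTE ar) (negbTE br) (negbTE bp) ap.
by move: ap; rewrite -index_mem; clear; move: (index a p) (size p) (size r) (index a _) => *; lia.
Qed.

Lemma trace s : same_order s -> Q s0 s.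
Proof. by move=> so; apply: (@trace_sound [::]). Qed.

End Trace.

(** * Words as sequences of first and second occurrences *)

(* The item [(x, false)] is the first occurrence of [x], and [(x, true)] any
   later one. *)
Definition item := (nat * bool)%type.

Fixpoint annc (seen : seq nat) (w : word) : seq item :=
  if w is a :: w' then (a, a \in seen) :: annc (a :: seen) w' else [::].

Definition ann : word -> seq item := annc [::].

(** An absent item gets the position [size (ann w)], behind all present ones. *)
Definition pos (w : word) (x : nat) (b : bool) : nat := index (x, b) (ann w).

Definition two (w : word) : Prop := forall x, count_mem x w <= 2.

Lemma two_red w : two (red w).
Proof. by move=> x; rewrite count_red geq_minl. Qed.

Lemma map_fst_annc S w : map fst (annc S w) = w.
Proof. by elim: w S => //= a w IH S; rewrite IH. Qed.

Lemma map_fst_ann w : map fst (ann w) = w.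
Proof. exact: map_fst_annc. Qed.

Lemma annc_cat S u v : annc S (u ++ v) = annc S u ++ annc (rev u ++ S) v.
Proof.
elim: u S => //= a u IH S; rewrite IH; congr (_ :: _ ++ _).
by rewrite rev_cons cat_rcons.
Qed.

Lemma mem_annc_false S w x : ((x, false) \in annc S w) = (x \in w) && (x \notin S).
Proof.
elim: w S => //= a w IH S; rewrite !inE IH xpair_eqE inE negb_or.
by case: (eqVneq x a) => [->|xa] /=; rewrite ?andbF ?orbF //; case: (a \in S).
Qed.

Lemma mem_annc_true S w x :
  ((x, true) \in annc S w) = (2 <= (x \in S) + count_mem x w) && (x \in w).
Proof.
elim: w S => [|a w IH] S /=; first by rewrite in_nil andbF.
rewrite !inE IH xpair_eqE inE (eq_sym x).
case: (eqVneq a x) => [->|xa] /=.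
  have := has_pred1 x w; rewrite has_count.
  by case: (x \in S); case: (x \in w) => /= H; lia.
by rewrite add0n.
Qed.

Lemma mem_ann_false w x : ((x, false) \in ann w) = (x \in w).
Proof. by rewrite mem_annc_false andbT. Qed.

Lemma mem_ann_true w x : ((x, true) \in ann w) = (2 <= count_mem x w).
Proof.
rewrite mem_annc_true /= add0n; have [c2|//] := leqP 2 (count_mem x w).
by rewrite -has_pred1 has_count (ltnW c2).
Qed.

Lemma uniq_annc S w : (forall x, (x \in S) + count_mem x w <= 2) -> uniq (annc S w).
Proof.
elim: w S => //= a w IH S H; rewrite IH ?andbT.
  case aS: (a \in S); last by rewrite mem_annc_false mem_head andbF.
  rewrite mem_annc_true; have := H a; rewrite aS eqxx => Ha.
  have -> : a \in w = false; last by rewrite andbF.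
  by apply/negbTE/count_memPn; move: Ha; case: (count_mem a w).
move=> x; have := H x; rewrite inE (eq_sym x).
by case: (eqVneq a x) => _; case: (x \in S) => /=; lia.
Qed.

Lemma uniq_ann w : two w -> uniq (ann w).
Proof. by move=> tw; apply: uniq_annc => x; rewrite tw. Qed.

Lemma pos_first_second w x : x \in w -> pos w x false < pos w x true.
Proof.
rewrite /pos /ann.
have : x \notin [::] by [].
elim: w [::] => //= a w IH S xS; rewrite inE !xpair_eqE.
have [<-|xa] := eqVneq x a; first by rewrite (negbTE xS) eqxx.
move=> /= xw; rewrite ltnS; apply: IH => //.
by rewrite inE negb_or xa.
Qed.

(** A rearranged sequence of items can be read back as a word as long as each second occurrence
    still follows its first one. *)
Lemma annK (s : seq item) : uniq s ->
  (forall x, (x, true) \in s -> (x, false) \in s /\ bef s (x, false) (x, true)) ->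
  ann (map fst s) = s.
Proof.
move=> U H; rewrite /ann.
have {H} : forall x, (x, true) \in s ->
    x \in [::] \/ (x, false) \in s /\ bef s (x, false) (x, true) by right; apply: H.
have : forall x, x \in [::] -> (x, false) \notin s by [].
elim: s [::] U => //= -[a b] s IH S /andP [ns U] H1 H2 /=.
have -> : a \in S = b.
  case: b ns H1 H2 => ns H1 H2.
    case: (H2 a (mem_head _ _)) => // -[].
    by rewrite /bef /= xpair_eqE andbF eqxx.
  by apply/negP => /H1; rewrite mem_head.
rewrite IH // => x; rewrite inE.
  case/orP=> [/eqP ->|/H1]; last by rewrite inE negb_or => /andP [].
  case: b ns H1 H2 => ns H1 H2 //.
  case: (H2 a (mem_head _ _)) => [/H1|[]]; first by rewrite inE negb_or => /andP [].
  by rewrite /bef /= xpair_eqE andbF eqxx.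
move=> xs; case: (eqVneq x a) => [|xa]; first by left.
case: (H2 x); first by rewrite inE xs orbT.
  by move=> ->; left.
rewrite /bef /= !inE !xpair_eqE (negbTE xa) (eq_sym a) (negbTE xa) /= => -[xf lt].
by right.
Qed.

Lemma sorted_bef (T : eqType) (s : seq T) : uniq s -> sorted (bef s) s.
Proof.
move=> U.
have m : map (index^~ s) s = iota 0 (size s).
  case: s U => // x0 s' U; apply: (@eq_from_nth _ 0); rewrite size_map ?size_iota // => i Hi.
  by rewrite (nth_map x0) // nth_iota // index_uniq.
have := iota_ltn_sorted 0 (size s); rewrite -m sorted_map.
by apply: sub_sorted.
Qed.

Lemma eq_sorted_bef (T : eqType) (s l : seq T) :
  uniq s -> s =i l -> sorted (bef s) l -> s = l.
Proof.
move=> U sl sol; apply: (@irr_sorted_eq _ (bef s)) => //.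
- by move=> y x z; apply: ltn_trans.
- by move=> x; rewrite /bef ltnn.
- exact: sorted_bef.
Qed.

Lemma bef_filter (T : eqType) (P : pred T) s a b :
  P a -> P b -> bef (filter P s) a b = bef s a b.
Proof.
move=> Pa Pb; rewrite /bef; elim: s => //= c s IH; case: ifP => Pc /=.
  by case: eqVneq => _; case: eqVneq => _ //; rewrite ltnS IH.
case: eqVneq Pc => [->|_ Pc]; first by rewrite Pa.
by case: eqVneq Pc => [->|_ _]; rewrite ?Pb // ltnS IH.
Qed.

Definition tmpl (ms ss : seq nat) : seq item :=
  [seq (i, b) | i <- ms, b <- [:: false; true]] ++ [seq (i, false) | i <- ss].

(** The substitution erases all letters but the chosen ones and renames these by short indices; the
    result depends only on the order [t] of the surviving items. *)
Lemma restrict_word u g ms ss t : two u -> uniq (map g (ms ++ ss)) ->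
  (forall i, i \in ms -> count_mem (g i) u = 2) ->
  (forall i, i \in ss -> count_mem (g i) u = 1) ->
  perm_eq t (tmpl ms ss) ->
  sorted (fun i j => pos u (g i.1) i.2 < pos u (g j.1) j.2) t ->
  subst (fun a => if a \in map g (ms ++ ss)
                  then [:: nth 0 (ms ++ ss) (index a (map g (ms ++ ss)))] else [::]) u =
  map fst t.
Proof.
move=> tu U Hm Hs pe so; set l := ms ++ ss in U *.
have -> : forall w, subst (fun a => if a \in map g l then [:: nth 0 l (index a (map g l))]
              else [::]) w = map (fun a => nth 0 l (index a (map g l))) (filter (mem (map g l)) w).
  by elim=> //= a w IH; rewrite subst_cons IH; case: ifP.
have -> : filter (mem (map g l)) u = map fst (map (fun i : item => (g i.1, i.2)) t).
  rewrite -{1}(map_fst_ann u) filter_map; congr map.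
  apply: eq_sorted_bef.
  - by rewrite filter_uniq // uniq_ann.
  - move=> [a b]; rewrite mem_filter /=; apply/andP/mapP.
      case=> /mapP [i il ->] iu; exists (i, b) => //.
      rewrite (perm_mem pe) mem_cat; apply/orP.
      move: il; rewrite mem_cat => /orP [im|is_].
        by left; apply/allpairsP; exists (i, b); split=> //; case: (b).
      right; case: b iu => iu; last by apply/mapP; exists i.
      by move: iu; rewrite mem_ann_true Hs.
    case=> -[i c] /=; rewrite (perm_mem pe) mem_cat => it [-> ->].
    have il : i \in l /\ (c -> i \in ms).
      rewrite mem_cat; case/orP: it => [/allpairsP [[j d] [/= jm _ [-> _]]]|].
        by rewrite jm.
      by case/mapP=> j js [-> ->]; rewrite js orbT.
    split; first by apply/mapP; exists i; tauto.
    case: c {it} il => -[il im]; first by rewrite mem_ann_true Hm ?im.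
    rewrite mem_ann_false -has_pred1 has_count.
    by move: il; rewrite mem_cat => /orP [/Hm|/Hs] ->.
  rewrite sorted_map; move: so; rewrite /sorted; case: (t) pe => // i0 t' pe.
  have tl i : i \in i0 :: t' -> g i.1 \in map g l.
    rewrite (perm_mem pe) mem_cat => /orP [] it; apply/mapP; exists i.1 => //; rewrite mem_cat.
      by case/allpairsP: it => -[j d] [/= jm _ ->]; rewrite jm.
    by case/mapP: it => j js ->; rewrite js orbT.
  have : all (fun i : item => g i.1 \in map g l) (i0 :: t') by apply/allP.
  case/andP; elim: t' i0 {pe tl} => //= j t' IH i0 Pi0 /andP [Pj al] /andP [ij so].
  rewrite bef_filter //= IH // andbT; exact: ij.
rewrite -!map_comp -{2}[t]map_id -map_comp; apply/eq_in_map => -[i b] it /=.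
have il : i \in l.
  move: it; rewrite (perm_mem pe) !mem_cat => /orP [/allpairsP [[j d] [/= jm _ [-> _]]]|].
    by rewrite jm.
  by case/mapP=> j js [-> _]; rewrite js orbT.
have lti : index i l < size l by rewrite index_mem.
rewrite -{1}(nth_index 0 il) -(nth_map 0 0) // index_uniq ?size_map //.
by rewrite nth_index.
Qed.

(** The tool that turns a long identity into a flag: one substitution is applied to both sides and
    the two short words are read off from positions. *)
Lemma restrict E u v g ms ss t t' : theory E -> E u v -> two u -> two v -> perm_eq u v ->
  uniq (map g (ms ++ ss)) ->
  (forall i, i \in ms -> count_mem (g i) u = 2) ->
  (forall i, i \in ss -> count_mem (g i) u = 1) ->
  perm_eq t (tmpl ms ss) -> perm_eq t' (tmpl ms ss) ->
  sorted (fun i j => pos u (g i.1) i.2 < pos u (g j.1) j.2) t ->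
  sorted (fun i j => pos v (g i.1) i.2 < pos v (g j.1) j.2) t' ->
  E (map fst t) (map fst t').
Proof.
move=> tE uv tu tv /seq.permP pe U Hm Hs pt pt' so so'.
rewrite -(restrict_word tu U Hm Hs pt so) -(restrict_word tv U _ _ pt' so').
- exact: theoryF.
- by move=> i /Hm <-; rewrite -pe.
- by move=> i /Hs <-; rewrite -pe.
Qed.

(** * The identities that determine a subvariety *)

(* Letters: x = 0, y = 1, z = 2, t = 3, s = 4, c = 5. *)
Definition fe0 : identity := ([:: 0], [::]).
Definition fe1 : identity := ([:: 0], [:: 0; 0]).
Definition fe2 : identity := ([:: 0; 1], [:: 1; 0]).
Definition fe3 : identity := ([:: 0; 0; 3], [:: 3; 0; 0]).
Definition fe4 : identity := ([:: 0; 0; 3], [:: 0; 3; 0]).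
(** [fa1], [fa2], [fa3] invert two first occurrences, [fb1] and [fb2] a second and a first one. The
    variants differ in which letters have a simple letter between their two occurrences. *)
Definition fa1 : identity := ([:: 0; 0; 1; 1], [:: 1; 1; 0; 0]).
Definition fa2 : identity := ([:: 0; 0; 1; 3; 1], [:: 1; 0; 0; 3; 1]).
Definition fa3 : identity := ([:: 0; 1; 3; 0; 1], [:: 1; 0; 3; 0; 1]).
Definition fb1 : identity := ([:: 0; 3; 0; 1; 1], [:: 0; 3; 1; 1; 0]).
Definition fb2 : identity := ([:: 0; 3; 0; 1; 4; 1], [:: 0; 3; 1; 0; 4; 1]).
(** From here on two second occurrences are inverted. In [fg1] a simple letter separates the first
    occurrences. In the other identities z starts between x and y, and before its second occurrence
    stands a simple letter, the start of a non-square, or a square. *)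
Definition fg1 : identity := ([:: 0; 3; 1; 4; 0; 1], [:: 0; 3; 1; 4; 1; 0]).
Definition fg2 : identity := ([:: 0; 2; 1; 3; 0; 1; 4; 2], [:: 0; 2; 1; 3; 1; 0; 4; 2]).
Definition fg3 : identity :=
  ([:: 0; 2; 1; 3; 0; 1; 5; 2; 4; 5], [:: 0; 2; 1; 3; 1; 0; 5; 2; 4; 5]).
Definition fsg : identity :=
  ([:: 0; 2; 1; 3; 0; 1; 5; 5; 2], [:: 0; 2; 1; 3; 1; 0; 5; 5; 2]).

Definition strong_flags : seq identity :=
  [:: fe0; fe1; fe2; fe3; fe4; fa1; fa2; fa3; fb1; fb2; fg1; fg2].
Definition flags : seq identity := strong_flags ++ [:: fg3; fsg].

Definition holds (E : word -> word -> Prop) (e : identity) : Prop := E e.1 e.2.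

Definition id1 : identity := ([:: lx; ly; lx; lz], [:: lx; ly; lx; lz; lx]).
Definition id2 : identity :=
  ([:: lx; lxi 1; lx; lxi 0; lxi 1], [:: lx; lx; lxi 1; lxi 0; lxi 1]).

Record basic (E : word -> word -> Prop) : Prop := Basic {
  basic_theory :> theory E;
  basic1 : holds E id1;
  basic2 : holds E id2 }.

Section Implications.
Variables (E : word -> word -> Prop) (bE : basic E).

(** [H] is instantiated by [l] and placed between [p] and [q]; what remains is equality after
    truncation to two occurrences, checked by evaluation. *)
Ltac derive H l p q :=
  let K := fresh in
  have K := thCC bE p q (th_inst bE l H);
  apply: (thT2 bE _ _ K); apply: (red_eq bE (basic1 bE)); vm_compute; reflexivity.

Lemma sq_yxxy : E [:: 1; 0; 0; 1] [:: 1; 1; 0; 0].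
Proof.
by derive (basic2 bE) [:: [:: 1]; [::]; [::]; [::]; [::]; [::]; [::]; [:: 0; 0]]
  ([::] : word) ([::] : word).
Qed.

Lemma fe3_fe4 : holds E fe3 -> holds E fe4.
Proof.
move=> H; apply: (congS bE).
have K : E [:: 0; 3; 0] [:: 0; 0; 3].
  have /(congS bE) H' := H.
  by derive H' ([:: [:: 0]; [::]; [::]; [:: 3]] : seq word) ([:: 0] : word) ([::] : word).
exact: K.
Qed.

Lemma fa2_fa1 : holds E fa2 -> holds E fa1.
Proof.
move=> H; apply: (congT bE) sq_yxxy.
by derive H ([:: [:: 0]; [:: 1]] : seq word) ([::] : word) ([::] : word).
Qed.

Lemma fa3_fa2 : holds E fa3 -> holds E fa2.
Proof.
move=> H; apply: (@congT _ bE [:: 0; 1; 0; 3; 1]).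
  apply: (congS bE).
  by derive (basic2 bE) [:: [:: 0]; [::]; [::]; [::]; [:: 3]; [::]; [::]; [:: 1]]
    ([::] : word) ([::] : word).
by derive H ([:: [:: 0]; [:: 1]; [::]; [:: 0; 3]] : seq word) ([::] : word) ([::] : word).
Qed.

Lemma fb2_fb1 : holds E fb2 -> holds E fb1.
Proof.
move=> H; apply: (@congT _ bE [:: 0; 3; 1; 0; 1]).
  by derive H ([:: [:: 0]; [:: 1]; [::]; [:: 3]; [::]] : seq word) ([::] : word) ([::] : word).
by derive (basic2 bE) [:: [:: 1]; [::]; [::]; [::]; [::]; [::]; [::]; [:: 0]]
    ([:: 0; 3] : word) ([::] : word).
Qed.

Lemma fa1_fg2 : holds E fa1 -> holds E fg2.
Proof.
by move=> H; derive H ([:: [:: 0]; [:: 1]] : seq word) ([:: 0; 2; 1; 3] : word) ([:: 4; 2] : word).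
Qed.

Lemma fb1_fg2 : holds E fb1 -> holds E fg2.
Proof.
by move=> H; derive H ([:: [:: 0]; [:: 1]; [::]; [:: 2; 1; 3]] : seq word)
  ([::] : word) ([:: 4; 2] : word).
Qed.

Lemma fg1_fg2 : holds E fg1 -> holds E fg2.
Proof.
by move=> H; derive H ([:: [:: 0]; [:: 1]; [::]; [:: 2]; [:: 3]] : seq word)
  ([::] : word) ([:: 4; 2] : word).
Qed.

Lemma fg2_fg3 : holds E fg2 -> holds E fg3.
Proof.
by move=> H; derive H ([:: [:: 0]; [:: 1]; [:: 2]; [:: 3]; [:: 5]] : seq word)
  ([::] : word) ([:: 4; 5] : word).
Qed.

(** Erasing s from [fg3] makes c a square whose second occurrence follows that of z; the second
    identity carries it back next to the first one. *)
Lemma fg3_fsg : holds E fg3 -> holds E fsg.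
Proof.
move=> H.
have K p : E (p ++ [:: 5; 2; 5; 2]) (p ++ [:: 5; 5; 2; 2]).
  exact: (thCl bE p (th_inst bE
    [:: [:: 5]; [::]; [::]; [::]; [::]; [::]; [::]; [:: 2]] (basic2 bE))).
have K1 : E [:: 0; 2; 1; 3; 0; 1; 5; 2; 5] [:: 0; 2; 1; 3; 1; 0; 5; 2; 5].
  by derive H ([:: [:: 0]; [:: 1]; [:: 2]; [:: 3]; [::]; [:: 5]] : seq word)
    ([::] : word) ([::] : word).
have L1 := K [:: 0; 2; 1; 3; 0; 1]; have L2 := K [:: 0; 2; 1; 3; 1; 0].
have R u v : red u = red v -> E u v by apply: (red_eq bE (basic1 bE)).
apply: (@congT _ bE [:: 0; 2; 1; 3; 0; 1; 5; 2; 5]).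
  by apply: (congT bE _ (congT bE (congS bE L1) _)); apply: R.
apply: (congT bE K1); apply: (congT bE _ (congT bE L2 _)); exact: R.
Qed.

Lemma fe4_fg2 : holds E fe4 -> holds E fg2.
Proof.
move=> H; apply: (@congT _ bE [:: 0; 0; 2; 1; 3; 1; 4; 2]).
  have /(congS bE) H' := H.
  by derive H' ([:: [:: 0]; [::]; [::]; [:: 2; 1; 3]] : seq word) ([::] : word) ([:: 1; 4; 2] : word).
by derive H ([:: [:: 0]; [::]; [::]; [:: 2; 1; 3; 1]] : seq word) ([::] : word) ([:: 4; 2] : word).
Qed.

Lemma fe2_fg2 : holds E fe2 -> holds E fg2.
Proof.
by move=> H; derive H ([:: [:: 0]; [:: 1]] : seq word) ([:: 0; 2; 1; 3] : word) ([:: 4; 2] : word).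
Qed.

(** Doubling the first occurrences of x and y turns the later ones into third occurrences, whose
    order is lost. *)
Lemma fe1_fg2 : holds E fe1 -> holds E fg2.
Proof.
move=> H; apply: (@congT _ bE [:: 0; 0; 2; 1; 1; 3; 4; 2]).
  apply: (@congT _ bE [:: 0; 0; 2; 1; 3; 0; 1; 4; 2]).
    by derive H ([:: [:: 0]] : seq word) ([::] : word) ([:: 2; 1; 3; 0; 1; 4; 2] : word).
  by derive H ([:: [:: 1]] : seq word) ([:: 0; 0; 2] : word) ([:: 3; 0; 1; 4; 2] : word).
apply: (@congT _ bE [:: 0; 0; 2; 1; 3; 1; 0; 4; 2]); apply: (congS bE).
  by derive H ([:: [:: 1]] : seq word) ([:: 0; 0; 2] : word) ([:: 3; 1; 0; 4; 2] : word).
by derive H ([:: [:: 0]] : seq word) ([::] : word) ([:: 2; 1; 3; 1; 0; 4; 2] : word).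
Qed.

Lemma fe0_total : holds E fe0 -> forall u v, E u v.
Proof.
move=> H u v; suff K w : E w [::] by apply: (congT bE (K u)); apply: (congS bE).
by have := th_inst bE [:: w] H; rewrite /subst /inst /= cats0.
Qed.

Lemma strong_fg2 e : e \in strong_flags -> holds E e -> holds E fg2.
Proof.
rewrite !inE; do ![case/orP]; move=> /eqP -> H.
- exact: fe0_total.
- exact: fe1_fg2.
- exact: fe2_fg2.
- exact/fe4_fg2/fe3_fe4.
- exact: fe4_fg2.
- exact: fa1_fg2.
- exact/fa1_fg2/fa2_fa1.
- exact/fa1_fg2/fa2_fa1/fa3_fa2.
- exact: fb1_fg2.
- exact/fb1_fg2/fb2_fb1.
- exact: fg1_fg2.
- exact: H.
Qed.

Lemma flags_fsg e : e \in flags -> holds E e -> holds E fsg.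
Proof.
rewrite mem_cat => /orP [/strong_fg2 H /H|].
  by move/fg2_fg3/fg3_fsg.
by rewrite !inE => /orP [] /eqP -> // /fg3_fsg.
Qed.

End Implications.

(** * Inverted pairs of occurrences *)

(** Items not separated in this sense, in either order, lie in the same block between simple
    letters. *)
Definition sep (u : word) (x : nat) (b : bool) (y : nat) (c : bool) : Prop :=
  exists t, [/\ count_mem t u = 1, pos u x b < pos u t false
              & pos u t false < pos u y c].

Definition sq (u : word) (x : nat) : Prop := ~ sep u x false x true.

Lemma pos_inj w x b y c : (x, b) \in ann w -> pos w x b = pos w y c -> (x, b) = (y, c).
Proof.
move=> iw e; have jw : (y, c) \in ann w by rewrite -index_mem -[index _ _]e index_mem.
by rewrite -(nth_index (x, b) iw) -(nth_index (x, b) jw) -/(pos w x b) e.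
Qed.

Lemma pos_neq w x b y c : (x, b) \in ann w -> (x, b) != (y, c) ->
  (pos w x b < pos w y c) || (pos w y c < pos w x b).
Proof. by move=> iw ij; rewrite -neq_ltn; apply: contra ij => /eqP /(pos_inj iw) ->. Qed.

Lemma mem_first w x n : count_mem x w = n.+1 -> (x, false) \in ann w.
Proof. by move=> c; rewrite mem_ann_false -has_pred1 has_count c. Qed.

Lemma mem_second w x : count_mem x w = 2 -> (x, true) \in ann w.
Proof. by move=> c; rewrite mem_ann_true c. Qed.

Lemma pos_fs w x : count_mem x w = 2 -> pos w x false < pos w x true.
Proof. by move=> c; apply: pos_first_second; rewrite -has_pred1 has_count c. Qed.

Lemma ann_count w a d : two w -> (a, d) \in ann w ->
  count_mem a w = 1 /\ d = false \/ count_mem a w = 2.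
Proof.
move=> tw; have := tw a; case: d => [|].
  by rewrite mem_ann_true => *; right; lia.
rewrite mem_ann_false -has_pred1 has_count.
by case: (count_mem a w) => [|[|[|]]] //; [left | right].
Qed.

(* Disequalities make [lia] branch, and it never needs them here. *)
Ltac plia := repeat match goal with H : is_true (~~ (_ == _)) |- _ => clear H end; lia.

Ltac neqs := rewrite /= ?inE ?negb_or ?andbT;
  repeat (apply/andP; split); try done; apply/eqP => ?; subst; plia.

Ltac cnts := move=> ?; rewrite /= ?inE; repeat (case/orP); move=> /eqP ->.

Section Inverted.
Variables (E : word -> word -> Prop) (bE : basic E).
Hypothesis fw : E [:: 0; 1; 3; 0; 1] [:: 0; 1; 3; 1; 0].
Hypotheses (n2 : ~ holds E fe2) (n3 : ~ holds E fe3) (n4 : ~ holds E fe4).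

(** The form to which every identity of a theory without [fe0] and [fe1] reduces after
    truncation. *)
Definition linked (u v : word) : Prop := [/\ E u v, two u, two v & perm_eq u v].

Lemma linkedC u v : linked u v -> linked v u.
Proof. by case=> uv tu tv pe; split=> //; [apply: (congS bE) | rewrite perm_sym]. Qed.

Lemma linked_count u v x : linked u v -> count_mem x v = count_mem x u.
Proof. by case=> _ _ _ /seq.permP ->. Qed.

Lemma linked_restrict u v g ms ss t t' : linked u v ->
  uniq (map g (ms ++ ss)) ->
  (forall i, i \in ms -> count_mem (g i) u = 2) ->
  (forall i, i \in ss -> count_mem (g i) u = 1) ->
  perm_eq t (tmpl ms ss) -> perm_eq t' (tmpl ms ss) ->
  sorted (fun i j => pos u (g i.1) i.2 < pos u (g j.1) j.2) t ->
  sorted (fun i j => pos v (g i.1) i.2 < pos v (g j.1) j.2) t' ->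
  E (map fst t) (map fst t').
Proof. by case=> uv tu tv pe; apply: restrict bE uv tu tv pe. Qed.

Lemma inverted_simple u v s t : linked u v ->
  count_mem s u = 1 -> count_mem t u = 1 ->
  pos u s false < pos u t false -> pos v s false < pos v t false.
Proof.
move=> L cs ct Hu; have st : s != t by neqs.
have nst : (s, false) != (t, false) by rewrite xpair_eqE andbT.
have [//|Hv] := orP (pos_neq (mem_first (etrans (linked_count s L) cs)) nst).
case: n2; apply: (@linked_restrict u v (nth 0 [:: s; t]) [::] [:: 0; 1]
  [:: (0, false); (1, false)] [:: (1, false); (0, false)] L) => //=.
- by rewrite inE st.
- by cnts.
- by rewrite Hu.
- by rewrite Hv.
Qed.

(** Multiplying by x on the left and truncating turns the premise into xxt = xtx. *)
Lemma xtx_txx : E [:: 0; 3; 0] [:: 3; 0; 0] -> holds E fe3.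
Proof.
move=> H; apply: (congT bE _ H); apply: (thT2 bE _ _ (thCl bE [:: 0] H)).
  exact: (red_eq bE (basic1 bE)).
exact: (red_eq bE (basic1 bE)).
Qed.

Lemma pattern_xt w x t : count_mem x w = 2 -> count_mem t w = 1 ->
  [\/ pos w x true < pos w t false,
      pos w x false < pos w t false < pos w x true |
      pos w t false < pos w x false].
Proof.
move=> cx ct; have xt : x != t by neqs.
have n1 : (x, true) != (t, false) by rewrite xpair_eqE andbF.
have n2' : (x, false) != (t, false) by rewrite xpair_eqE andbT.
have /orP [H1|H1] := pos_neq (mem_second cx) n1; first by apply: Or31.
have /orP [H2|H2] := pos_neq (mem_first cx) n2'; last by apply: Or33.
by apply: Or32; rewrite H2.
Qed.

(** Erasing all but x and t leaves two of the words xxt, xtx, txx; if they differ, their identity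
    gives [fe3] or [fe4]. *)
Lemma inverted_letter u v x t b : linked u v ->
  count_mem x u = 2 -> count_mem t u = 1 ->
  (pos v x b < pos v t false) = (pos u x b < pos u t false).
Proof.
move=> L cx ct; have xt : x != t by neqs.
have cx' := etrans (linked_count x L) cx; have ct' := etrans (linked_count t L) ct.
have := pos_fs cx; have := pos_fs cx' => fv fu.
have K := @linked_restrict u v (nth 0 [:: x; 0; 0; t]) [:: 0] [:: 3] _ _ L _ _ _.
have U : uniq [:: x; t] by rewrite /= inE xt.
have C1 : forall i, i \in [:: 0] -> count_mem (nth 0 [:: x; 0; 0; t] i) u = 2 by cnts.
have C2 : forall i, i \in [:: 3] -> count_mem (nth 0 [:: x; 0; 0; t] i) u = 1 by cnts.
pose TA : seq item := [:: (0, false); (0, true); (3, false)].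
pose TB : seq item := [:: (0, false); (3, false); (0, true)].
pose TC : seq item := [:: (3, false); (0, false); (0, true)].
case: (pattern_xt cx ct) => [H|/andP [H H']|H]; case: (pattern_xt cx' ct') => [G|/andP [G G']|G];
  try (by case: b; plia).
- case: n4; apply: (K TA TB U C1 C2) => //=; plia.
- case: n3; apply: (K TA TC U C1 C2) => //=; plia.
- case: n4; apply: (congS bE); apply: (K TB TA U C1 C2) => //=; plia.
- case: n3; apply: xtx_txx; apply: (K TB TC U C1 C2) => //=; plia.
- case: n3; apply: (congS bE); apply: (K TC TA U C1 C2) => //=; plia.
- case: n3; apply: xtx_txx; apply: (congS bE); apply: (K TC TB U C1 C2) => //=; plia.
Qed.

Lemma linked_mem u v i : linked u v -> (i \in ann v) = (i \in ann u).
Proof.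
move=> L; case: i => x []; rewrite ?mem_ann_true ?mem_ann_false -?has_pred1 ?has_count;
by rewrite (linked_count x L).
Qed.

(** Simple letters act as walls that no item crosses; hence linked words have the same blocks,
    squares and separated pairs. *)
Lemma linked_block u v x b t : linked u v -> (x, b) \in ann u -> count_mem t u = 1 ->
  (pos v x b < pos v t false) = (pos u x b < pos u t false).
Proof.
move=> L xu ct; have [_ tu _ _] := L.
case: (ann_count tu xu) => [[cx b0]|cx]; last exact: inverted_letter.
subst b; have cx' := etrans (linked_count x L) cx; have ct' := etrans (linked_count t L) ct.
apply/idP/idP; last exact: inverted_simple.
exact: inverted_simple (linkedC L) cx' ct'.
Qed.

Lemma linked_block2 u v x b t : linked u v -> (x, b) \in ann u -> count_mem t u = 1 ->
  (pos v t false < pos v x b) = (pos u t false < pos u x b).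
Proof.
move=> L iu ct; have iv : (x, b) \in ann v by rewrite (linked_mem _ L).
have [[-> ->]|ni] := eqVneq (x, b) (t, false); first by rewrite !ltnn.
have := linked_block L iu ct; have := pos_neq iu ni; have := pos_neq iv ni; plia.
Qed.

Lemma linked_sep u v x b y c : linked u v -> (x, b) \in ann u -> (y, c) \in ann u ->
  sep u x b y c -> sep v x b y c.
Proof.
move=> L iu ju [t [ct H1 H2]]; exists t; rewrite (linked_count t L); split=> //.
  by rewrite (linked_block L).
by rewrite (linked_block2 L).
Qed.

Lemma linked_sepC u v x b y c : linked u v -> (x, b) \in ann u -> (y, c) \in ann u ->
  sep v x b y c <-> sep u x b y c.
Proof.
move=> L iu ju; split; last exact: linked_sep.
by apply: linked_sep; rewrite ?(linked_mem _ L) //; apply: linkedC.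
Qed.

Lemma linked_sq u v x : linked u v -> count_mem x u = 2 -> sq v x <-> sq u x.
Proof. by move=> L cx; rewrite /sq (linked_sepC L) ?(mem_first cx) ?mem_second. Qed.

Lemma pos_cases w x y b c : count_mem x w = 2 -> count_mem y w = 2 -> x != y ->
  (pos w x b < pos w y c) || (pos w y c < pos w x b).
Proof.
move=> cx cy xy; apply: pos_neq; last by rewrite xpair_eqE (negbTE xy).
by case: b; [apply: mem_second | apply: mem_first cx].
Qed.

Lemma sq_xyx r : E ([:: 0; 1; 0] ++ r ++ [:: 1]) ([:: 0; 0; 1] ++ r ++ [:: 1]).
Proof.
by have := th_inst bE [:: [:: 0]; [::]; [::]; [::]; r; [::]; [::]; [:: 1]] (basic2 bE).
Qed.

Lemma red_sound a b : red a = red b -> E a b.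
Proof. exact: (red_eq bE (basic1 bE)). Qed.

(** All interleavings starting with x equal xxyy by the second identity, so an inversion of first
    occurrences gives [fa1] whatever the places of the second ones. *)
Lemma norm_xy w x y : count_mem x w = 2 -> count_mem y w = 2 ->
  pos w x false < pos w y false ->
  exists t, [/\ perm_eq t (tmpl [:: 0; 1] [::]),
    sorted (fun i j => pos w (nth 0 [:: x; y] i.1) i.2 < pos w (nth 0 [:: x; y] j.1) j.2) t &
    E (map fst t) [:: 0; 0; 1; 1]].
Proof.
move=> cx cy H; have xy : x != y by neqs.
have fx := pos_fs cx; have fy := pos_fs cy.
have /orP [H1|H1] := pos_cases true false cx cy xy.
  exists [:: (0, false); (0, true); (1, false); (1, true)].
  by split=> //=; [plia | apply: (congR bE)].
have /orP [H2|H2] := pos_cases true true cx cy xy.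
  exists [:: (0, false); (1, false); (0, true); (1, true)].
  by split=> //=; [plia | apply: (sq_xyx [::])].
exists [:: (0, false); (1, false); (1, true); (0, true)].
split=> //=; first by plia.
have := th_inst bE [:: [:: 0]; [::]; [::]; [::]; [::]; [::]; [::]; [:: 1; 1]] (basic2 bE).
by move=> K; apply: (thT2 bE _ _ K); apply: red_sound.
Qed.

Lemma inverted_first u v x y : linked u v ->
  count_mem x u = 2 -> count_mem y u = 2 ->
  pos u x false < pos u y false -> pos v y false < pos v x false ->
  holds E fa1.
Proof.
move=> L cx cy Hu Hv; have xy : x != y by neqs.
have cx' := etrans (linked_count x L) cx; have cy' := etrans (linked_count y L) cy.
have [t [pt st Et]] := norm_xy cx cy Hu.
have [t' [pt' st' Et']] := norm_xy cy' cx' Hv.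
(* The second word was normalised with x and y exchanged; [1 - i.1] renames its letters back. *)
pose t2 := map (fun i : item => (1 - i.1, i.2)) t'.
have pt2 : perm_eq t2 (tmpl [:: 0; 1] [::]).
  by apply: perm_trans (perm_map _ pt') _.
have K : E (map fst t) (map fst t2).
  apply: (@linked_restrict u v (nth 0 [:: x; y]) [:: 0; 1] [::] t t2 L) => //=.
  - by rewrite inE xy.
  - by cnts.
  rewrite sorted_map; move: st'; apply: sub_in_sorted (_ : all (fun i : item => i.1 < 2) t').
    move=> [[|[|i]] b] [[|[|j]] c] //.
  by apply/allP => i; rewrite (perm_mem pt') !inE => /or4P [] /eqP ->.
apply: (congT bE (congS bE Et)); apply: (congT bE K).
have := th_inst bE [:: [:: 1]; [:: 0]] Et'.
rewrite (_ : subst _ (map fst t') = map fst t2) //.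
rewrite /t2 -map_comp /subst.
have : all (fun i : item => i.1 < 2) t'.
  by apply/allP => i; rewrite (perm_mem pt') !inE => /or4P [] /eqP ->.
by elim: (t') => //= -[[|[|i]] b] l IH //= /IH ->.
Qed.

Lemma inverted_first_sq u v x y : linked u v ->
  count_mem x u = 2 -> count_mem y u = 2 -> sq u x -> ~ sq u y ->
  pos u x false < pos u y false -> pos v y false < pos v x false ->
  holds E fa2.
Proof.
move=> L cx cy sx /contrapT [t [ct H1 H2]] Hu Hv; have xy : x != y by neqs.
have xt : x != t by neqs.
have yt : y != t by neqs.
have fx := pos_fs cx.
have cx' := etrans (linked_count x L) cx; have fx' := pos_fs cx'.
have xt1 : pos u x true < pos u t false.
  case: (pattern_xt cx ct) => [//|/andP [H3 H4]|]; last by plia.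
  by case: sx; exists t.
have L1 := linked_block L (mem_second cx) ct.
have L2 := linked_block2 L (mem_second cy) ct.
have U : uniq [:: x; y; t] by rewrite /= !inE negb_or xy xt yt.
have C1 : forall i, i \in [:: 0; 1] -> count_mem (nth 0 [:: x; y; 0; t] i) u = 2 by cnts.
have C2 : forall i, i \in [:: 3] -> count_mem (nth 0 [:: x; y; 0; t] i) u = 1 by cnts.
pose T' : seq item := [:: (1, false); (0, false); (0, true); (3, false); (1, true)].
have /orP [H5|H5] := pos_cases true false cx cy xy.
  pose T : seq item := [:: (0, false); (0, true); (1, false); (3, false); (1, true)].
  by apply: (@linked_restrict u v (nth 0 [:: x; y; 0; t]) [:: 0; 1] [:: 3] T T' L U C1 C2) => //=; plia.
pose T : seq item := [:: (0, false); (1, false); (0, true); (3, false); (1, true)].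
apply: (congT bE (congS bE (sq_xyx [:: 3]))).
by apply: (@linked_restrict u v (nth 0 [:: x; y; 0; t]) [:: 0; 1] [:: 3] T T' L U C1 C2) => //=; plia.
Qed.

(** The first occurrences share a block, so one simple letter lies after both of them and before
    both second occurrences. The order of the latter is then normalised by [fw]. *)
Lemma inverted_first_nsq u v x y : linked u v ->
  count_mem x u = 2 -> count_mem y u = 2 -> ~ sq u x -> ~ sq u y ->
  ~ sep u x false y false ->
  pos u x false < pos u y false -> pos v y false < pos v x false ->
  holds E fa3.
Proof.
move=> L cx cy /contrapT [t1 [ct1 H1 H2]] /contrapT [t2 [ct2 H3 H4]] ns Hu Hv.
have xy : x != y by neqs.
have [t [ct tx ty tx1 ty1]] : exists t, [/\ count_mem t u = 1,
    pos u x false < pos u t false, pos u y false < pos u t false,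
    pos u t false < pos u x true & pos u t false < pos u y true].
  have yt1 : pos u y false < pos u t1 false.
    case: (pattern_xt cy ct1) => [H|/andP [H _]|H] //; have := pos_fs cy; first by plia.
    by case: ns; exists t1.
  case: (pattern_xt cy ct1) => [H|/andP [_ H]|H]; [|by exists t1|by plia].
  by exists t2; split=> //; plia.
have xt : x != t by neqs.
have yt : y != t by neqs.
have L1 := linked_block L (mem_first cx) ct.
have L2 := linked_block2 L (mem_second cy) ct.
have L3 := linked_block2 L (mem_second cx) ct.
have cx' := etrans (linked_count x L) cx; have cy' := etrans (linked_count y L) cy.
have U : uniq [:: x; y; t] by rewrite /= !inE negb_or xy xt yt.
have C1 : forall i, i \in [:: 0; 1] -> count_mem (nth 0 [:: x; y; 0; t] i) u = 2 by cnts.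
have C2 : forall i, i \in [:: 3] -> count_mem (nth 0 [:: x; y; 0; t] i) u = 1 by cnts.
have fw' : E [:: 1; 0; 3; 1; 0] [:: 1; 0; 3; 0; 1].
  exact: (th_inst bE [:: [:: 1]; [:: 0]; [::]; [:: 3]] fw).
pose T1 : seq item := [:: (0, false); (1, false); (3, false); (0, true); (1, true)].
pose T2 : seq item := [:: (0, false); (1, false); (3, false); (1, true); (0, true)].
pose T1' : seq item := [:: (1, false); (0, false); (3, false); (0, true); (1, true)].
pose T2' : seq item := [:: (1, false); (0, false); (3, false); (1, true); (0, true)].
have K T T' := @linked_restrict u v (nth 0 [:: x; y; 0; t]) [:: 0; 1] [:: 3] T T' L U C1 C2.
have /orP [H5|H5] := pos_cases true true cx cy xy;
have /orP [H6|H6] := pos_cases true true cx' cy' xy.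
- by apply: (K T1 T1') => //=; plia.
- by apply: (congT bE) fw'; apply: (K T1 T2') => //=; plia.
- by apply: (congT bE fw); apply: (K T2 T1') => //=; plia.
- by apply: (congT bE fw); apply: (congT bE) fw'; apply: (K T2 T2') => //=; plia.
Qed.

Lemma inverted_second_first u v x y : linked u v ->
  count_mem x u = 2 -> count_mem y u = 2 -> x != y -> ~ sq u x ->
  pos u x true < pos u y false -> pos v y false < pos v x true ->
  holds E fb1 /\ (~ sq u y -> holds E fb2).
Proof.
move=> L cx cy xy /contrapT [t [ct H1 H2]] Hu Hv.
have xt : x != t by neqs.
have yt : y != t by neqs.
have fx := pos_fs cx; have fy := pos_fs cy.
have cx' := etrans (linked_count x L) cx; have cy' := etrans (linked_count y L) cy.
have fx' := pos_fs cx'; have fy' := pos_fs cy'.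
have L1 := linked_block L (mem_first cx) ct.
have L2 := linked_block2 L (mem_first cy) ct.
split; last first.
  move=> /contrapT [s [cs H3 H4]].
  have xs : x != s by neqs.
  have ys : y != s by neqs.
  have ts : t != s by neqs.
  have L3 := linked_block L (mem_second cx) cs.
  have L4 := linked_block2 L (mem_second cy) cs.
  apply: (@linked_restrict u v (nth 0 [:: x; y; 0; t; s]) [:: 0; 1] [:: 3; 4]
    [:: (0, false); (3, false); (0, true); (1, false); (4, false); (1, true)]
    [:: (0, false); (3, false); (1, false); (0, true); (4, false); (1, true)] L) => //=; try plia.
  - by rewrite !inE !negb_or xy xt yt xs ys ts.
  - by cnts.
  - by cnts.
have U : uniq [:: x; y; t] by rewrite /= !inE negb_or xy xt yt.
have C1 : forall i, i \in [:: 0; 1] -> count_mem (nth 0 [:: x; y; 0; t] i) u = 2 by cnts.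
have C2 : forall i, i \in [:: 3] -> count_mem (nth 0 [:: x; y; 0; t] i) u = 1 by cnts.
pose T : seq item := [:: (0, false); (3, false); (0, true); (1, false); (1, true)].
(* If y recurs after the second x in [v], the second identity first moves the second y next to its
   first occurrence. *)
have /orP [H5|H5] := pos_cases true true cx' cy' xy.
  pose T' : seq item := [:: (0, false); (3, false); (1, false); (0, true); (1, true)].
  apply: (@congT _ bE (map fst T')).
    by apply: (@linked_restrict u v (nth 0 [:: x; y; 0; t]) [:: 0; 1] [:: 3] T T' L U C1 C2) => //=; plia.
  have := thCl bE [:: 0; 3] (th_inst bE
    [:: [:: 1]; [::]; [::]; [::]; [::]; [::]; [::]; [:: 0]] (basic2 bE)).
  by move=> K; apply: (thT2 bE _ _ K); apply: red_sound.
pose T' : seq item := [:: (0, false); (3, false); (1, false); (1, true); (0, true)].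
by apply: (@linked_restrict u v (nth 0 [:: x; y; 0; t]) [:: 0; 1] [:: 3] T T' L U C1 C2) => //=; plia.
Qed.

Lemma inverted_second u v x y : linked u v ->
  count_mem x u = 2 -> count_mem y u = 2 -> ~ sq u y ->
  sep u x false y false -> ~ sep u x true y true ->
  pos u x true < pos u y true -> pos v y true < pos v x true ->
  holds E fg1.
Proof.
move=> L cx cy /contrapT [s [cs H1 H2]] [t [ct H3 H4]] ns Hu Hv.
have xy : x != y by neqs.
have xt : x != t by neqs.
have yt : y != t by neqs.
have xs : x != s by neqs.
have ys : y != s by neqs.
have ts : t != s by neqs.
have sx : pos u s false < pos u x true.
  have : (x, true) != (s, false) by rewrite xpair_eqE andbF.
  move/(pos_neq (mem_second cx)) => /orP [H|//].
  by case: ns; exists s.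
have L1 := linked_block L (mem_first cx) ct.
have L2 := linked_block2 L (mem_first cy) ct.
have L3 := linked_block L (mem_first cy) cs.
have L4 := linked_block2 L (mem_second cy) cs.
apply: (@linked_restrict u v (nth 0 [:: x; y; 0; t; s]) [:: 0; 1] [:: 3; 4]
  [:: (0, false); (3, false); (1, false); (4, false); (0, true); (1, true)]
  [:: (0, false); (3, false); (1, false); (4, false); (1, true); (0, true)] L) => //=; try plia.
- by rewrite !inE !negb_or xy xt yt xs ys ts.
- by cnts.
- by cnts.
Qed.

End Inverted.

Section Independence.
Variables (E : word -> word -> Prop) (bE : basic E).
Hypothesis fw : E [:: 0; 1; 3; 0; 1] [:: 0; 1; 3; 1; 0].
Hypotheses (n2 : ~ holds E fe2) (n3 : ~ holds E fe3) (n4 : ~ holds E fe4).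

Let lblock := linked_block bE n2 n3 n4.
Let lblock2 := linked_block2 bE n2 n3 n4.
Let lsep := linked_sep bE n2 n3 n4.
Let inv21 := inverted_second_first bE n2 n3 n4.
Let inv22 := inverted_second bE n2 n3 n4.

Section Barrier.
Hypothesis ng2 : ~ holds E fg2.

Lemma first_order u v x y : linked E u v -> count_mem x u = 2 -> count_mem y u = 2 ->
  pos u x false < pos u y false -> pos v x false < pos v y false.
Proof.
move=> L cx cy H; have xy : x != y by neqs.
have cx' := etrans (linked_count x L) cx; have cy' := etrans (linked_count y L) cy.
have /orP [//|H'] := pos_cases false false cx' cy' xy.
by case: ng2; apply: (fa1_fg2 bE); apply: inverted_first L cx cy H H'.
Qed.

Lemma second_first_order u v x y : linked E u v ->
  count_mem x u = 2 -> count_mem y u = 2 -> x != y -> ~ sq u x ->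
  (pos v x true < pos v y false) = (pos u x true < pos u y false).
Proof.
move=> L cx cy xy nx.
have cx' := etrans (linked_count x L) cx; have cy' := etrans (linked_count y L) cy.
have nx' : ~ sq v x by rewrite (linked_sq bE n2 n3 n4 L).
have /orP [H'|H'] := pos_cases true false cx' cy' xy;
have /orP [H|H] := pos_cases true false cx cy xy; try plia.
  case: ng2; apply: (fb1_fg2 bE).
  by have [] := inv21 (linkedC bE L) cx' cy' xy nx' H' H.
case: ng2; apply: (fb1_fg2 bE).
by have [] := inv21 L cx cy xy nx H H'.
Qed.

(** Why a letter c starting between the second occurrences of x, y and that of z hinders their
    exchange: erasing nearly all letters leaves [fg2] when c is simple, [fsg] when it is repeated,
    and also [fg3] when it is repeated but no square. *)
Lemma inverted_barrier u v x y z c : linked E u v ->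
  count_mem x u = 2 -> count_mem y u = 2 -> count_mem z u = 2 -> c \in u -> ~ sq u x ->
  ~ sep u x false y false -> ~ sep u y true x true ->
  pos u x false < pos u z false -> pos u z false < pos u y false ->
  pos u x true < pos u c false -> pos u y true < pos u c false ->
  pos u c false < pos u z true ->
  (pos v x true < pos v y true) = ~~ (pos u x true < pos u y true) ->
  count_mem c u = 2 /\ (holds E fsg /\ (sq u c \/ holds E fg3)).
Proof.
move=> L cx cy cz cu /contrapT [t [ct xt0 tx1]] ns1 ns2 xz zy xc yc cz1 inv.
have fx := pos_fs cx; have fy := pos_fs cy.
have xy : x != y by neqs.
have nxz : x != z by neqs.
have nyz : y != z by neqs.
have xt : x != t by neqs.
have yt : y != t by neqs.
have zt : z != t by neqs.
have nxc : x != c by neqs.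
have nyc : y != c by neqs.
have yt0 : pos u y false < pos u t false.
  case: (pattern_xt cy ct) => [H|/andP [H _]|H] //; first by plia.
  by case: ns1; exists t.
have ty1 : pos u t false < pos u y true.
  case: (pattern_xt cy ct) => [H|/andP [_ H]|H] //; last by plia.
  by case: ns2; exists t.
have nzc : z != c by neqs.
have ntc : t != c by neqs.
have ny : ~ sq u y by apply; exists t.
have nx : ~ sq u x by apply; exists t.
have nz : ~ sq u z by apply; exists t; split=> //; plia.
have cx' := etrans (linked_count x L) cx; have cy' := etrans (linked_count y L) cy.
have cz' := etrans (linked_count z L) cz.
have xz' := first_order L cx cz xz; have zy' := first_order L cz cy zy.
have L1 := lblock L (mem_first cy) ct.
have L2 := lblock2 L (mem_second cx) ct.
have L3 := lblock2 L (mem_second cy) ct.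
have o : (pos u x true < pos u y true /\ pos v y true < pos v x true) \/
         (pos u y true < pos u x true /\ pos v x true < pos v y true).
  have := pos_cases true true cx cy xy; have := pos_cases true true cx' cy' xy; plia.
(* A simple letter between these second occurrences and that of z would give [fg2]. *)
have simple s : count_mem s u = 1 -> pos u x true < pos u s false ->
    pos u y true < pos u s false -> pos u s false < pos u z true -> False.
  move=> cs xs1 ys1 sz1.
  have xs : x != s by neqs.
  have ys : y != s by neqs.
  have zs : z != s by neqs.
  have ts : t != s by neqs.
  have L4 := lblock L (mem_second cx) cs.
  have L5 := lblock L (mem_second cy) cs.
  have L6 := lblock2 L (mem_second cz) cs.
  have U : uniq [:: x; y; z; t; s].
    by rewrite /= !inE !negb_or xy nxz xt xs nyz yt ys zt zs ts.
  have C1 : forall i, i \in [:: 0; 1; 2] -> count_mem (nth 0 [:: x; y; z; t; s] i) u = 2.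
    by cnts.
  have C2 : forall i, i \in [:: 3; 4] -> count_mem (nth 0 [:: x; y; z; t; s] i) u = 1 by cnts.
  have K T T' := @linked_restrict E bE u v (nth 0 [:: x; y; z; t; s]) [:: 0; 1; 2]
     [:: 3; 4] T T' L U C1 C2.
  pose T1 : seq item := [:: (0, false); (2, false); (1, false); (3, false); (0, true);
                            (1, true); (4, false); (2, true)].
  pose T2 : seq item := [:: (0, false); (2, false); (1, false); (3, false); (1, true);
                            (0, true); (4, false); (2, true)].
  apply: ng2; case: o => [[o1 o2]|[o1 o2]].
    by apply: (K T1 T2) => //=; plia.
  by apply: (congS bE); apply: (K T2 T1) => //=; plia.
have cc : count_mem c u = 2.
  have [_ tu _ _] := L; have := tu c; move: cu; rewrite -has_pred1 has_count.
  case cE: (count_mem c u) => [|[|[|//]]] // _ _; first by case: (simple c).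
have cc' := etrans (linked_count c L) cc.
have xc' : pos v x true < pos v c false by rewrite (second_first_order L cx cc).
have yc' : pos v y true < pos v c false by rewrite (second_first_order L cy cc).
have cz1' : pos v c false < pos v z true.
  have := second_first_order L cz cc nzc nz.
  by have := pos_cases true false cz' cc' nzc; plia.
have fc := pos_fs cc; have fc' := pos_fs cc'.
split=> //.
have U : uniq [:: x; y; z; c; t].
  by rewrite /= !inE !negb_or xy nxz nxc xt nyz nyc yt nzc zt eq_sym ntc.
have C1 : forall i, i \in [:: 0; 1; 2; 5] -> count_mem (nth 0 [:: x; y; z; t; 0; c] i) u = 2.
  by cnts.
have C2 : forall i, i \in [:: 3] -> count_mem (nth 0 [:: x; y; z; t; 0; c] i) u = 1 by cnts.
have K T T' := @linked_restrict E bE u v (nth 0 [:: x; y; z; t; 0; c]) [:: 0; 1; 2; 5]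
     [:: 3] T T' L U C1 C2.
split.
  (* [d] fixes the order of the second x and y, [e] that of the second c and z; the latter order is
     immaterial by the second identity. *)
  pose T (d e : bool) : seq item := [:: (0, false); (2, false); (1, false); (3, false);
    ((if d then 0 else 1), true); ((if d then 1 else 0), true); (5, false);
    ((if e then 5 else 2), true); ((if e then 2 else 5), true)].
  have ET d e : E (map fst (T d true)) (map fst (T d e)).
    case: e; first exact: (congR bE).
    pose p := [:: 0; 2; 1; 3] ++ if d then [:: 0; 1] else [:: 1; 0].
    have /(congS bE) := thCl bE p (th_inst bE
      [:: [:: 5]; [::]; [::]; [::]; [::]; [::]; [::]; [:: 2]] (basic2 bE)).
    by move=> K'; apply: (thT2 bE _ _ K'); apply: red_sound => //; rewrite /p; case: (d).
  have [e [pe so]] : exists e, perm_eq (T (pos u x true < pos u y true) e) (tmpl [:: 0; 1; 2; 5] [:: 3]) /\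
      sorted (fun i j => pos u (nth 0 [:: x; y; z; t; 0; c] i.1) i.2 <
        pos u (nth 0 [:: x; y; z; t; 0; c] j.1) j.2) (T (pos u x true < pos u y true) e).
    exists (pos u c true < pos u z true); rewrite /T.
    have := pos_cases true true cz cc nzc.
    by case: (ltnP (pos u c true)) => ? ?; case: o => -[o1 o2];
      case: (ltnP (pos u x true)) => ?; split=> //=; plia.
  have [e' [pe' so']] : exists e, perm_eq (T (pos v x true < pos v y true) e) (tmpl [:: 0; 1; 2; 5] [:: 3]) /\
      sorted (fun i j => pos v (nth 0 [:: x; y; z; t; 0; c] i.1) i.2 <
        pos v (nth 0 [:: x; y; z; t; 0; c] j.1) j.2) (T (pos v x true < pos v y true) e).
    exists (pos v c true < pos v z true); rewrite /T.
    have := pos_cases true true cz' cc' nzc.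
    by case: (ltnP (pos v c true)) => ? ?; case: o => -[o1 o2];
      case: (ltnP (pos v x true)) => ?; split=> //=; plia.
  have := K _ _ pe pe' so so'.
  rewrite inv; case: (pos u x true < pos u y true) => /= KK.
    by apply: (congT bE (congT bE (ET true e) KK)); apply: (congS bE); apply: (ET false e').
  apply: (congS bE).
  by apply: (congT bE (congT bE (ET false e) KK)); apply: (congS bE); apply: (ET true e').
case: (pselect (sq u c)) => [|/contrapT [s [cs cs0 sc1]]]; first by left.
right.
have xs : x != s by neqs.
have ys : y != s by neqs.
have ts : t != s by neqs.
have zs : z != s by neqs.
have ncs : c != s by neqs.
have zs1 : pos u z true < pos u s false.
  have : (z, true) != (s, false) by rewrite xpair_eqE andbF.
  move/(pos_neq (mem_second cz)) => /orP [//|H].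
  by case: (simple s) => //; plia.
have L4 := lblock L (mem_second cz) cs.
have L5 := lblock2 L (mem_second cc) cs.
pose T (d : bool) : seq item := [:: (0, false); (2, false); (1, false); (3, false);
    ((if d then 0 else 1), true); ((if d then 1 else 0), true); (5, false);
    (2, true); (4, false); (5, true)].
have {}U : uniq [:: x; y; z; c; t; s].
  by rewrite /= !inE !negb_or xy nxz nxc xt xs nyz nyc yt ys nzc zt zs (eq_sym c t) ntc ncs ts.
have {C1} D1 : forall i, i \in [:: 0; 1; 2; 5] -> count_mem (nth 0 [:: x; y; z; t; s; c] i) u = 2.
  by cnts.
have {C2} D2 : forall i, i \in [:: 3; 4] -> count_mem (nth 0 [:: x; y; z; t; s; c] i) u = 1 by cnts.
have {}K T T' := @linked_restrict E bE u v (nth 0 [:: x; y; z; t; s; c]) [:: 0; 1; 2; 5]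
     [:: 3; 4] T T' L U D1 D2.
case: o => [[o1 o2]|[o1 o2]].
  by apply: (K (T true) (T false)) => //=; plia.
by apply: (congS bE); apply: (K (T false) (T true)) => //=; plia.
Qed.

End Barrier.

(** The three alternatives negate what [inverted_barrier] proves about such a letter. *)
Definition barrier (u : word) (c : nat) : Prop :=
  [/\ c \in u, ~ holds E fg2 &
    [\/ count_mem c u = 1, ~ holds E fg3 /\ ~ sq u c | ~ holds E fsg]].

Definition blocked (u : word) (x y : nat) : Prop :=
  exists z c, [/\ barrier u c, count_mem z u = 2,
    (pos u x false < pos u z false < pos u y false) ||
    (pos u y false < pos u z false < pos u x false),
    pos u x true < pos u c false /\ pos u y true < pos u c false &
    pos u c false < pos u z true].

Definition ind11 u x y : Prop :=
  [/\ sq u x -> sq u y -> holds E fa1, sq u x -> ~ sq u y -> holds E fa2,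
      ~ sq u x -> sq u y -> holds E fa2 & ~ sq u x -> ~ sq u y -> holds E fa3].

(** Nothing is required when x is a square, since its second occurrence moves freely inside its
    block. *)
Definition ind21 u x y : Prop :=
  ~ sq u x -> (sq u y -> holds E fb1) /\ (~ sq u y -> holds E fb2).

Definition ind22 u x y : Prop :=
  ~ sq u x -> ~ sq u y ->
  (sep u x false y false \/ sep u y false x false -> holds E fg1) /\ ~ blocked u x y.

(** The independence relation of the trace argument, read off from [u] and the flags of [E]. It has
    to contain every inversion that [E] produces, yet be narrow enough for each transposition to be
    derivable from the flags. *)
Definition indep (u : word) (i j : item) : Prop :=
  let: (x, b) := i in let: (y, c) := j in
  [/\ x != y, count_mem x u = 2 /\ count_mem y u = 2, ~ sep u x b y c, ~ sep u y c x b &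
    match b, c with
    | false, false => ind11 u x y
    | true, false => ind21 u x y
    | false, true => ind21 u y x
    | true, true => ind22 u x y
    end].

Lemma blockedC u x y : blocked u x y -> blocked u y x.
Proof.
move=> [z [c [H1 H2 H3 [H4 H4'] H5]]]; exists z, c; split=> //.
by rewrite orbC.
Qed.

Lemma indepC u i j : indep u i j -> indep u j i.
Proof.
case: i j => x b [y c] [xy [cx cy] s1 s2 H]; split=> //; first by rewrite eq_sym.
case: b c H {s1 s2} => -[] //.
- move=> H ny nx; have [H1 H2] := H nx ny; split.
    by move=> s; apply: H1; tauto.
  by move/blockedC.
- by case=> H1 H2 H3 H4; split=> *; auto.
Qed.

Lemma inverted_indep u v x b y c : linked E u v -> (x, b) \in ann u -> (y, c) \in ann u ->
  pos u x b < pos u y c -> pos v y c < pos v x b -> indep u (x, b) (y, c).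
Proof.
move=> L xu yu Hu Hv.
have xv : (x, b) \in ann v by rewrite (linked_mem _ L).
have yv : (y, c) \in ann v by rewrite (linked_mem _ L).
have [_ tu tv _] := L.
have cx : count_mem x u = 2.
  case: (ann_count tu xu) => // -[cx b0]; subst b.
  by have := lblock2 L yu cx; plia.
have cy : count_mem y u = 2.
  case: (ann_count tu yu) => // -[cy c0]; subst c.
  by have := lblock L xu cy; plia.
have cx' := etrans (linked_count x L) cx; have cy' := etrans (linked_count y L) cy.
have xy : x != y.
  apply/eqP => exy; subst y; have := pos_fs cx; have := pos_fs cx'.
  by case: b c Hu Hv {xu yu xv yv} => -[]; plia.
have ns1 : ~ sep u x b y c.
  by move/(lsep L xu yu) => [t [_ H1 H2]]; plia.
have ns2 : ~ sep u y c x b by move=> [t [_ H1 H2]]; plia.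
have L' := linkedC bE L.
have sqv w : count_mem w u = 2 -> sq v w <-> sq u w by apply: (linked_sq bE n2 n3 n4 L).
split=> //; case: b c xu yu xv yv Hu Hv ns1 ns2 => -[] xu yu xv yv Hu Hv ns1 ns2.
- move=> nx ny; split.
    case=> s; first exact: inverted_second L cx cy ny s ns1 Hu Hv.
    apply: (inv22 L' cy' cx' _ _ _ Hv Hu).
    + by rewrite sqv.
    + by apply: (lsep L _ _ s); [apply: mem_first cy | apply: mem_first cx].
    + by move/(lsep L' yv xv).
  move=> [z [c [[cu ng2 bar] cz /orP [/andP [H1 H2]|/andP [H1 H2]] [H3 H3'] H4]]].
  (* [inverted_barrier] wants the first occurrences in one block; were they separated, [fg1] would
     hold and with it the excluded [fg2]. *)
  + have ns : ~ sep u x false y false.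
      by move=> s; apply/ng2/(fg1_fg2 bE); apply: inverted_second L cx cy ny s ns1 Hu Hv.
    have [|cc [H5 H6]] := inverted_barrier ng2 L cx cy cz cu nx ns ns2 H1 H2 H3 H3' H4.
      by plia.
    by case: bar => [|[g3 nc]|] //; [plia | case: H6].
  + have ns : ~ sep u y false x false.
      move=> s; apply/ng2/(fg1_fg2 bE).
      apply: (inv22 L' cy' cx' _ _ _ Hv Hu).
      * by rewrite sqv.
      * by apply: (lsep L _ _ s); [apply: mem_first cy | apply: mem_first cx].
      * by move/(lsep L' yv xv).
    have [|cc [H5 H6]] := inverted_barrier ng2 L cy cx cz cu ny ns ns1 H1 H2 H3' H3 H4.
      by plia.
    by case: bar => [|[g3 nc]|] //; [plia | case: H6].
- move=> nx; have [] := inv21 L cx cy xy nx Hu Hv.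
  by split.
- move=> ny; have ny' : ~ sq v y by rewrite sqv.
  have [|H1 H2] := inv21 L' cy' cx' _ ny' Hv Hu.
    by rewrite eq_sym.
  by split=> // nx; apply: H2; rewrite sqv.
- split=> sx sy.
  + exact: inverted_first L cx cy Hu Hv.
  + exact: inverted_first_sq L cx cy sx sy Hu Hv.
  + apply: (inverted_first_sq bE n2 n3 n4 L' cy' cx' _ _ Hv Hu); by rewrite sqv.
  + exact: inverted_first_nsq L cx cy sx sy ns1 Hu Hv.
Qed.

End Independence.

(** * Transposing independent occurrences *)

Lemma cut_lt A B x b y c : (x, b) \in ann A -> (y, c) \notin ann A ->
  pos (A ++ B) x b < pos (A ++ B) y c.
Proof.
move=> xA yA; rewrite /pos /ann annc_cat !index_cat -!/(ann _) xA (negbTE yA).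
by apply: leq_trans (leq_addr _ _); rewrite index_mem.
Qed.

(** Cuts off the longest prefix free of bad letters, where badness may depend on what has been read
    so far. *)
Lemma find_bad (bad : word -> nat -> Prop) A R : exists T R',
  [/\ R = T ++ R', (forall T1 c T2, T = T1 ++ c :: T2 -> ~ bad (A ++ T1) c) &
      R' = [::] \/ exists c R'', R' = c :: R'' /\ bad (A ++ T) c].
Proof.
elim: R A => [|c R IH] A; first by exists [::], [::]; split; [|case|left].
case: (pselect (bad A c)) => H.
  exists [::], (c :: R); split=> //; first by case.
  by right; exists c, R; rewrite cats0.
have [T [R' [-> H1 H2]]] := IH (A ++ [:: c]); exists (c :: T), R'; split=> //.
  move=> [|d T1] e T2 /=; first by case=> <- _; rewrite cats0.
  by case=> <- /H1; rewrite -catA.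
case: H2 => [->|[d [R'' [-> H2]]]]; first by left.
by right; exists d, R''; move: H2; rewrite -catA.
Qed.

Section Swap.
Variables (E : word -> word -> Prop) (bE : basic E).

Lemma add3 p v w : (forall x, x \in v -> 2 <= count_mem x p) -> w = p ++ v -> E p w.
Proof.
move=> H ->; apply: (congS bE).
by have := @del3s _ bE (basic1 bE) p v [::] H; rewrite !cats0.
Qed.

Lemma sq_ins A c R1 R2 : (forall d, d \in R1 -> 2 <= count_mem d (A ++ c :: R1 ++ c :: R2)) ->
  E (A ++ c :: R1 ++ c :: R2) (A ++ c :: c :: R1 ++ c :: R2).
Proof. exact: (@square_insert _ bE (basic1 bE) (basic2 bE) A c [::]). Qed.

(** [fa1] acts on xxyy: as no simple letter precedes the next x and the next y, extra copies of both
    can be inserted, and removed after the exchange. *)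
Lemma swap_fa1 A x y Q1 Q2 R1 R2 : holds E fa1 ->
  Q1 ++ x :: Q2 = R1 ++ y :: R2 ->
  let w := A ++ x :: y :: Q1 ++ x :: Q2 in
  (forall d, d \in Q1 ++ R1 -> 2 <= count_mem d w) ->
  2 <= count_mem x w -> 2 <= count_mem y w ->
  E w (A ++ y :: x :: Q1 ++ x :: Q2).
Proof.
move=> H QR w Hd cx cy.
have cw p d : 2 <= count_mem d w ->
    2 <= count_mem d (A ++ p ++ [:: x, y & Q1 ++ x :: Q2]).
  by rewrite /w; cnt; lia.
have cw' p d : 2 <= count_mem d w ->
    2 <= count_mem d (A ++ p ++ [:: y, x & Q1 ++ x :: Q2]).
  by rewrite /w; cnt; lia.
have HQ d : d \in Q1 -> 2 <= count_mem d w by move=> dQ; apply: Hd; rewrite mem_cat dQ.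
have HR d : d \in R1 -> 2 <= count_mem d w by move=> dR; apply: Hd; rewrite mem_cat dR orbT.
apply: (@congT _ bE (A ++ [:: x, x, y, y & Q1 ++ x :: Q2])).
  apply: (@congT _ bE (A ++ [:: x, x, y & Q1 ++ x :: Q2])).
    apply: (@sq_ins A x (y :: Q1) Q2) => d; rewrite inE => /orP [/eqP ->|/HQ] //.
  rewrite QR; have := @sq_ins (A ++ [:: x; x]) y R1 R2; rewrite -!catA -QR /=; apply.
  by move=> d /HR; apply: (cw [:: x]).
apply: (@congT _ bE (A ++ [:: y, y, x, x & Q1 ++ x :: Q2])).
  have := thCC bE A (Q1 ++ x :: Q2) (th_inst bE [:: [:: x]; [:: y]] H).
  by rewrite /subst /inst /=; lcat.
apply: (congS bE).
apply: (@congT _ bE (A ++ [:: y, y, x & Q1 ++ x :: Q2])).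
  rewrite QR; have := @sq_ins A y (x :: R1) R2; rewrite /= -QR; apply => d.
  rewrite inE => /orP [/eqP ->|/HR]; exact: (cw' [::]).
have := @sq_ins (A ++ [:: y; y]) x Q1 Q2; rewrite -!catA /=; apply.
by move=> d /HQ; apply: (cw' [:: y]).
Qed.

(** Only x is doubled; the final y demanded by [fa2] is a redundant copy at the end of the word. *)
Lemma swap_fa2 A x y Q1 Q2 : holds E fa2 ->
  let w := A ++ x :: y :: Q1 ++ x :: Q2 in
  (forall d, d \in Q1 -> 2 <= count_mem d w) ->
  2 <= count_mem x w -> 2 <= count_mem y w ->
  E w (A ++ y :: x :: Q1 ++ x :: Q2).
Proof.
move=> H w Hd cx cy.
apply: (@congT _ bE (A ++ [:: x, x, y & Q1 ++ x :: Q2])).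
  apply: (@sq_ins A x (y :: Q1) Q2) => d; rewrite inE => /orP [/eqP ->|/Hd] //.
apply: (congS bE).
apply: (@congT _ bE (A ++ [:: y, x, x & Q1 ++ x :: Q2])).
  have := @sq_ins (A ++ [:: y]) x Q1 Q2; rewrite -!catA /=; apply.
  by move=> d /Hd; rewrite /w; cnt; lia.
have K := thCC bE A [::] (th_inst bE [:: [:: x]; [:: y]; [::]; Q1 ++ x :: Q2] H).
move/(congS bE): K; rewrite /subst /inst /= => K; apply: (thT2 bE _ _ K).
  apply: (@add3 (A ++ [:: y, x, x & Q1 ++ x :: Q2]) [:: y]) => [d|]; last by rewrite ?/w; lcat.
  rewrite inE => /eqP ->.
  by move: cy; rewrite /w; cnt; lia.
apply: (@add3 (A ++ [:: x, x, y & Q1 ++ x :: Q2]) [:: y]) => [d|]; last by rewrite ?/w; lcat.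
  rewrite inE => /eqP ->.
by move: cy; rewrite /w; cnt; lia.
Qed.

Lemma swap_fa3 A x y Q : holds E fa3 ->
  let w := A ++ x :: y :: Q in
  2 <= count_mem x w -> 2 <= count_mem y w -> E w (A ++ y :: x :: Q).
Proof.
move=> H w cx cy.
have K := thCC bE A [::] (th_inst bE [:: [:: x]; [:: y]; [::]; Q] H).
rewrite /subst /inst /= in K; apply: (thT2 bE _ _ K).
  apply: (@add3 w [:: x; y]) => [d|]; last by rewrite ?/w; lcat.
  by rewrite !inE => /orP [] /eqP ->.
apply: (@add3 (A ++ y :: x :: Q) [:: x; y]) => [d|]; last by rewrite ?/w; lcat.
by rewrite !inE => /orP [] /eqP ->; move: cx cy; rewrite /w; cnt; lia.
Qed.

Lemma swap_fb1 P1 x P2 y R1 R2 : holds E fb1 ->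
  let w := P1 ++ x :: P2 ++ x :: y :: R1 ++ y :: R2 in
  (forall d, d \in R1 -> 2 <= count_mem d w) ->
  E w (P1 ++ x :: P2 ++ y :: x :: R1 ++ y :: R2).
Proof.
move=> H w Hd.
apply: (@congT _ bE (P1 ++ x :: P2 ++ [:: x, y, y & R1 ++ y :: R2])).
  have := @sq_ins (P1 ++ x :: P2 ++ [:: x]) y R1 R2; rewrite -!catA /= -!catA /=; apply.
  exact: Hd.
apply: (congS bE).
apply: (@congT _ bE (P1 ++ x :: P2 ++ [:: y, y, x & R1 ++ y :: R2])).
  have := @sq_ins (P1 ++ x :: P2) y (x :: R1) R2; rewrite -!catA /=; apply => d.
  rewrite inE => /orP [/eqP ->|/Hd]; last by rewrite /w; cnt; lia.
  by cnt; rewrite eqxx; lia.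
have := thCC bE P1 (R1 ++ y :: R2) (th_inst bE [:: [:: x]; [:: y]; [::]; P2] H).
by rewrite /subst /inst /= => /(congS bE); lcat.
Qed.

Lemma swap_fb2 P1 x P2 y Q : holds E fb2 ->
  let w := P1 ++ x :: P2 ++ x :: y :: Q in 2 <= count_mem y w ->
  E w (P1 ++ x :: P2 ++ y :: x :: Q).
Proof.
move=> H w cy.
have K := thCC bE P1 [::] (th_inst bE [:: [:: x]; [:: y]; [::]; P2; Q] H).
rewrite /subst /inst /= in K; apply: (thT2 bE _ _ K).
  apply: (@add3 w [:: y]) => [d|]; last by rewrite ?/w; lcat.
  by rewrite !inE => /eqP ->.
apply: (@add3 (P1 ++ x :: P2 ++ y :: x :: Q) [:: y]) => [d|]; last by rewrite ?/w; lcat.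
by rewrite !inE => /eqP ->; move: cy; rewrite /w; cnt; lia.
Qed.

Lemma swap_fg1 P1 x P2 y P3 Q : holds E fg1 ->
  E (P1 ++ x :: P2 ++ y :: P3 ++ x :: y :: Q) (P1 ++ x :: P2 ++ y :: P3 ++ y :: x :: Q).
Proof.
move=> H; have := thCC bE P1 Q (th_inst bE [:: [:: x]; [:: y]; [::]; P2; P3] H).
by rewrite /subst /inst /=; lcat.
Qed.

End Swap.

(** The letters of [Z] have recurred by the end of [T], and a letter may start inside [T] only as
    far as the flags of [E] tolerate it. *)
Definition run_free (E : word -> word -> Prop) (u P : word) (x : nat) (Z : word)
    (y : nat) (Q T R : word) : Prop :=
  (forall z, z \in Z -> 2 <= count_mem z (P ++ x :: Z ++ y :: Q ++ x :: y :: T)) /\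
  (forall T1 c T2, T = T1 ++ c :: T2 -> c \notin P ++ x :: Z ++ y :: Q ++ x :: y :: T1 ->
     [/\ holds E fsg, count_mem c u = 2 &
         holds E fg3 \/ exists r1 r2, T2 ++ R = r1 ++ c :: r2 /\
                        forall d, d \in r1 -> count_mem d u = 2]).

(** Relative to [u], because in one application these exchanges are available for short words
    only. *)
Definition run_swaps (E E' : word -> word -> Prop) (u : word) : Prop :=
  forall P x Z y Q T R, x != y ->
  perm_eq (P ++ x :: Z ++ y :: Q ++ x :: y :: T ++ R) u ->
  count_mem x u = 2 -> count_mem y u = 2 ->
  (forall z, z \in Z -> count_mem z u = 2) ->
  holds E fg2 \/ run_free E u P x Z y Q T R ->
  E' (P ++ x :: Z ++ y :: Q ++ x :: y :: T ++ R) (P ++ x :: Z ++ y :: Q ++ y :: x :: T ++ R).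

Lemma count_mem_gt0 (x : nat) w : (0 < count_mem x w) = (x \in w).
Proof. by rewrite -has_count has_pred1. Qed.

(* [I] is a symmetric independence relation containing all inverted pairs of
   occurrences; every intermediate word agrees with [u] on dependent pairs. *)
Lemma trace_words (E : word -> word -> Prop) (cE : congruence E) u v
    (I : item -> item -> Prop) : two u -> two v -> perm_eq u v ->
  (forall i j, I i j -> I j i) ->
  (forall x b y c, I (x, b) (y, c) -> x != y) ->
  (forall x b y c, (x, b) \in ann u -> (y, c) \in ann u ->
     pos u x b < pos u y c -> pos v y c < pos v x b -> I (x, b) (y, c)) ->
  (forall w P x y Q, perm_eq w u ->
     (forall x b y c, (x, b) \in ann u -> (y, c) \in ann u -> ~ I (x, b) (y, c) ->
        (pos w x b < pos w y c) = (pos u x b < pos u y c)) ->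
     w = P ++ x :: y :: Q -> I (x, x \in P) (y, y \in P) -> E w (P ++ y :: x :: Q)) ->
  E u v.
Proof.
move=> tu tv pe Isym Iirr sound swap; pose D i j := ~ I i j.
have memuv i : (i \in ann v) = (i \in ann u).
  case: i => x []; rewrite ?mem_ann_true ?mem_ann_false; last by rewrite (perm_mem pe).
  by move/seq.permP: pe => ->.
have so (c d : item) : c \in ann u -> d \in ann u -> D c d ->
    bef (ann v) c d = bef (ann u) c d.
  case: c d => x b [y c] cu du Dcd; rewrite /bef -!/(pos _ _ _).
  have [[-> ->]|ne] := eqVneq (x, b) (y, c); first by rewrite !ltnn.
  have cv : (x, b) \in ann v by rewrite memuv.
  have /orP [Hu|Hu] := pos_neq cu ne; have /orP [Hv|Hv] := pos_neq cv ne; try plia.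
    by case: Dcd; apply: sound.
  by case: Dcd; apply: Isym; apply: sound.
rewrite -(map_fst_ann u) -(map_fst_ann v).
apply: (@trace _ D (fun s s' => E (map fst s) (map fst s')) (ann u)).
- exact: uniq_ann.
- by move=> s; apply: (congR cE).
- by move=> s2 s1 s3; apply: (congT cE).
- by move=> a b H1 /Isym.
- move=> p [x b] [y c] q [ps od] /contrapT ind.
  set s := p ++ _ in ps od.
  (* The two occurrences of one letter are dependent, so each intermediate sequence still annotates
     a word. *)
  have annE : ann (map fst s) = s.
    apply: annK; first by rewrite (perm_uniq ps) uniq_ann.
    move=> z; rewrite !(perm_mem ps) => zu.
    have zu' : (z, false) \in ann u.
      by move: zu; rewrite mem_ann_true mem_ann_false -count_mem_gt0; apply: leq_trans.
    split=> //; rewrite od // => [|/Iirr]; last by rewrite eqxx.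
    by rewrite /bef -!/(pos _ _ _) pos_first_second // -mem_ann_false.
  have pw : perm_eq (map fst s) u by rewrite -[X in perm_eq _ X](map_fst_ann u) perm_map.
  have [eb ec] : b = (x \in map fst p) /\ c = (y \in map fst p).
    move: annE; rewrite /s map_cat /= /ann annc_cat /= cats0 => /eqP.
    rewrite eqseq_cat; last by rewrite -[in RHS](size_map fst) -[LHS](size_map fst) map_fst_annc.
    case/andP=> _ /eqP [<- <- _]; rewrite inE !mem_rev; split=> //.
    by have := Iirr _ _ _ _ ind; rewrite eq_sym => /negbTE ->.
  subst b c.
  have wE : map fst s = map fst p ++ x :: y :: map fst q by rewrite /s map_cat.
  have ord x' b' y' c' : (x', b') \in ann u -> (y', c') \in ann u ->
      ~ I (x', b') (y', c') ->
      (pos (map fst s) x' b' < pos (map fst s) y' c') = (pos u x' b' < pos u y' c').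
    by move=> xu yu dep; rewrite /pos annE; apply: od.
  have := swap _ _ _ _ _ pw ord wE ind.
  by rewrite [map fst (p ++ (y, _) :: _)]map_cat.
- split; last exact: so.
  apply: uniq_perm; try exact: uniq_ann.
  exact: memuv.
Qed.

Section Complete.
Variables (E : word -> word -> Prop) (bE : basic E).

Section OneSwap.
Variables (u w : word).
Hypothesis tu : two u.
Hypothesis pwu : perm_eq w u.
Hypothesis order : forall x b y c, (x, b) \in ann u -> (y, c) \in ann u ->
  ~ indep E u (x, b) (y, c) -> (pos w x b < pos w y c) = (pos u x b < pos u y c).

Lemma wcount x : count_mem x w = count_mem x u.
Proof. by move/seq.permP: pwu => ->. Qed.

Lemma order_simple x b t : (x, b) \in ann u -> count_mem t u = 1 ->
  (pos w x b < pos w t false) = (pos u x b < pos u t false) /\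
  (pos w t false < pos w x b) = (pos u t false < pos u x b).
Proof.
move=> xu ct; split; apply: order; rewrite ?(mem_first ct) // => -[_ [c1 c2]] _ _ _.
  by rewrite ct in c2.
by rewrite ct in c1.
Qed.

Lemma count12 c : c \in w -> count_mem c u = 1 \/ count_mem c u = 2.
Proof.
rewrite -count_mem_gt0 wcount; have := tu c.
by case: (count_mem c u) => [|[|[|]]] //; [left | right].
Qed.

(** Simple letters depend on every item, so the intermediate word [w] has the blocks of [u], and a
    square of [u] stays one in [w]. *)
Lemma no_simple_in_square x P1 P2 P3 : sq u x -> w = P1 ++ x :: P2 ++ x :: P3 ->
  count_mem x u = 2 -> forall c, c \in P2 -> count_mem c u = 2.
Proof.
move=> sx wE cx c cP; have cw : c \in w by rewrite wE !(mem_cat, inE) cP !orbT.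
case: (count12 cw) => // c1; case: sx; exists c; split=> //.
  rewrite -(proj1 (order_simple (mem_first cx) c1)) wE -cat_rcons.
  apply: cut_lt; first by rewrite mem_ann_false mem_rcons mem_head.
  rewrite mem_ann_false -count_mem_gt0 -cats1; move: (wcount c) cP; rewrite c1 wE -count_mem_gt0.
  by cnt; lia.
rewrite -(proj2 (order_simple (mem_second cx) c1)) wE -cat_cons catA.
apply: cut_lt; first by rewrite mem_ann_false mem_cat inE cP !orbT.
by rewrite mem_ann_true; move: (wcount x); rewrite cx wE; cnt; rewrite eqxx; lia.
Qed.

Lemma no_simple_in_gap x y P Z R : w = P ++ x :: Z ++ R -> ~ sep u x false y false ->
  (y, false) \in ann u -> y \notin P ++ x :: Z -> x \in u -> forall c, c \in Z -> count_mem c u = 2.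
Proof.
move=> wE ns yu yP xu c cZ; have cw : c \in w by rewrite wE !(mem_cat, inE) cZ !orbT.
case: (count12 cw) => // c1; case: ns; exists c; split=> //.
  rewrite -(proj1 (order_simple _ c1)) ?mem_ann_false // wE -cat_rcons.
  apply: cut_lt; first by rewrite mem_ann_false mem_rcons mem_head.
  rewrite mem_ann_false -count_mem_gt0 -cats1; move: (wcount c) cZ; rewrite c1 wE -count_mem_gt0.
  by cnt; lia.
rewrite -(proj2 (order_simple yu c1)) wE -cat_cons catA.
apply: cut_lt; first by rewrite mem_ann_false mem_cat inE cZ !orbT.
by rewrite mem_ann_false.
Qed.

(** Without [fg2] no strong flag holds and these pairs are rigid; hence the positions that define
    [blocked] compare alike in [w] and in [u]. *)
Lemma dep_first x z : ~ holds E fg2 -> ~ indep E u (x, false) (z, false).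
Proof.
move=> ng2 [_ _ _ _ [H1 H2 H3 H4]].
have G a : holds E a -> a \in strong_flags -> False by move=> + /(strong_fg2 bE) H => /H.
by case: (pselect (sq u x)) => sx; case: (pselect (sq u z)) => sz;
  [have := H1 sx sz | have := H2 sx sz | have := H3 sx sz | have := H4 sx sz] => /G; apply.
Qed.

Lemma dep_second_first x z : ~ holds E fg2 -> ~ sq u x -> ~ indep E u (x, true) (z, false).
Proof.
move=> ng2 nx [_ _ _ _ /(_ nx) [H1 H2]].
have G a : holds E a -> a \in strong_flags -> False by move=> + /(strong_fg2 bE) H => /H.
by case: (pselect (sq u z)) => sz; [have := H1 sz | have := H2 sz] => /G; apply.
Qed.

(** [T] is the longest stretch after the pair in which no barrier starts. Should a letter of [Z]
    recur only later, it would block x and y together with the barrier that ends [T]. The factor [e]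
    covers both orders of the pair. *)
Lemma run_cond P x Z y Q e R0 : w = P ++ x :: Z ++ y :: Q ++ e ++ R0 ->
  perm_eq e [:: x; y] -> x != y -> count_mem x u = 2 -> count_mem y u = 2 ->
  ~ sq u x -> ~ sq u y -> ~ sep u x false y false -> ~ blocked E u x y ->
  (forall z, z \in Z -> count_mem z u = 2) /\
  exists T R, R0 = T ++ R /\ (holds E fg2 \/ run_free E u P x Z y Q T R).
Proof.
move=> wE pe xy cx cy nx ny ns nb.
have ce d : count_mem d e = (x == d) + (y == d).
  by move/seq.permP: pe => ->; rewrite /= addn0.
have yx : (y == x) = false by rewrite eq_sym (negbTE xy).
have cx' := wcount x; have cy' := wcount y.
rewrite cx wE in cx'; rewrite cy wE in cy'; move: cx' cy'.
cnt; rewrite !ce !eqxx yx (negbTE xy) => cx' cy'.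
have Z2 : forall z, z \in Z -> count_mem z u = 2.
  apply: (@no_simple_in_gap x y P Z (y :: Q ++ e ++ R0) wE ns (mem_first cy)).
    by rewrite -count_mem_gt0; cnt; rewrite (negbTE xy); lia.
  by rewrite -count_mem_gt0 cx.
split=> //.
case: (pselect (holds E fg2)) => g2; first by exists R0, [::]; rewrite cats0; split; [|left].
pose bad (A : word) c := c \notin A /\ barrier E u c.
have [T [R [R0E H1 H2]]] := find_bad bad (P ++ x :: Z ++ y :: Q ++ e) R0.
exists T, R; split=> //; right.
have cnt2 T1 c : count_mem c (P ++ x :: Z ++ y :: Q ++ x :: y :: T1) =
                 count_mem c ((P ++ x :: Z ++ y :: Q ++ e) ++ T1).
  by cnt; rewrite ce; lia.
have mem2 T1 c : (c \in P ++ x :: Z ++ y :: Q ++ x :: y :: T1) =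
                 (c \in (P ++ x :: Z ++ y :: Q ++ e) ++ T1).
  by rewrite -!count_mem_gt0 cnt2.
split.
  move=> z zZ; rewrite cnt2 leqNgt; apply/negP => lt2.
  have cz := Z2 z zZ; have cz' := wcount z; rewrite cz wE R0E in cz'.
  have zR : 0 < count_mem z R.
    by move: lt2 cz'; cnt; lia.
  case: H2 => [RE|[c [R'' [RE [nc bc]]]]]; first by rewrite RE in zR.
  have [cu _ _] := bc.
  have zZ' := zZ; rewrite -count_mem_gt0 in zZ'.
  have nxz : x != z by apply/eqP => xz; subst z; move: lt2; cnt; rewrite ce eqxx; lia.
  have nyz : y != z by apply/eqP => xz; subst z; move: lt2; cnt; rewrite ce eqxx; lia.
  have nzc : c != z.
    by apply/eqP => xz; subst z; move: nc; rewrite !(mem_cat, inE) zZ !orbT.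
  have wE2 : w = ((P ++ x :: Z ++ y :: Q ++ e) ++ T) ++ c :: R''.
    by rewrite wE R0E RE; lcat.
  have cuf : (c, false) \in ann u by rewrite mem_ann_false.
  have x1c : pos w x true < pos w c false.
    rewrite wE2; apply: cut_lt; last by rewrite mem_ann_false.
    by rewrite mem_ann_true; cnt; rewrite ce eqxx; lia.
  have y1c : pos w y true < pos w c false.
    rewrite wE2; apply: cut_lt; last by rewrite mem_ann_false.
    by rewrite mem_ann_true; cnt; rewrite ce eqxx; lia.
  have cz1 : pos w c false < pos w z true.
    rewrite wE2 -cat_rcons; apply: cut_lt.
      by rewrite mem_ann_false mem_rcons mem_head.
    by rewrite mem_ann_true -cats1; move: lt2; cnt; rewrite (negbTE nzc); lia.
  have xz0 : pos w x false < pos w z false.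
    rewrite wE -cat_rcons; apply: cut_lt; first by rewrite mem_ann_false mem_rcons mem_head.
    rewrite mem_ann_false -count_mem_gt0 -cats1 -leqNgt; move: lt2 zZ'.
    by cnt; rewrite ce (negbTE nxz); lia.
  have zy0 : pos w z false < pos w y false.
    rewrite wE -cat_cons catA; apply: cut_lt; first by rewrite mem_ann_false mem_cat inE zZ !orbT.
    by rewrite mem_ann_false -count_mem_gt0; cnt; rewrite (negbTE xy); lia.
  (* A simple letter inside x also lies inside z, since x and y start in one block and z between
     them. *)
  case/contrapT: (nx) => t [ct xt0 tx1].
  have ty0 : pos w y false < pos w t false.
    have tw : (y, false) \in ann w by rewrite (mem_first (n := 1)) // wcount.
    have nyt : (y, false) != (t, false) by apply/eqP => -[yt]; rewrite yt ct in cy.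
    have /orP [//|H] := pos_neq tw nyt; case: ns; exists t; split=> //.
    by rewrite -(proj2 (order_simple (mem_first cy) ct)).
  have tx1' : pos w t false < pos w x true by rewrite (proj2 (order_simple (mem_second cx) ct)).
  have nz : ~ sq u z.
    apply; exists t; split=> //.
      by rewrite -(proj1 (order_simple (mem_first cz) ct)); plia.
    by rewrite -(proj2 (order_simple (mem_second cz) ct)); plia.
  case: nb; exists z, c; split=> //.
  - apply/orP; left; apply/andP; split.
      by rewrite -order ?(mem_first cx) ?(mem_first cz) //; apply: dep_first.
    by rewrite -order ?(mem_first cy) ?(mem_first cz) //; apply: dep_first.
  - split.
      by rewrite -order ?(mem_second cx) //; apply: dep_second_first.
    by rewrite -order ?(mem_second cy) //; apply: dep_second_first.
  - rewrite -order ?(mem_second cz) // => /indepC; exact: dep_second_first.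
move=> T1 c T2 TE nc.
have nbad : ~ barrier E u c.
  by move=> bc; apply: (H1 T1 c T2 TE); split=> //; rewrite -mem2.
have cu : c \in u.
  by rewrite -(perm_mem pwu) wE R0E TE !(mem_cat, inE) eqxx !orbT.
have g3 : count_mem c u <> 1 /\ (holds E fsg /\ (holds E fg3 \/ sq u c)).
  split; first by move=> c1; apply: nbad; split=> //; apply: Or31.
  split; first by apply: contrapT => nsg; apply: nbad; split=> //; apply: Or33.
  apply: contrapT => /not_orP [H3 H4]; apply: nbad; split=> //; by apply: Or32.
have c2 : count_mem c u = 2.
  by case: (@count12 c) => //; [rewrite (perm_mem pwu) | case: g3].
split=> //; first by case: g3 => _ [].
case: g3 => _ [_ [|sc]]; first by left.
right.
have cR : c \in T2 ++ R.
  rewrite -count_mem_gt0; move: nc; rewrite mem2 -count_mem_gt0 -leqNgt.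
  have := wcount c; rewrite c2 wE R0E TE; cnt; rewrite eqxx; lia.
have [r1 [r2 TR]] : exists r1 r2, T2 ++ R = r1 ++ c :: r2.
  by case/splitPr: cR => r1 r2; exists r1, r2.
exists r1, r2; split=> //.
apply: (@no_simple_in_square c (P ++ x :: Z ++ y :: Q ++ e ++ T1) r1 r2 sc _ c2).
by rewrite wE R0E TE; lcat; rewrite TR.
Qed.

Variables (E' : word -> word -> Prop) (bE' : basic E').
Hypothesis flags_sub : forall e, e \in [:: fa1; fa2; fa3; fb1; fb2; fg1] ->
  holds E e -> holds E' e.
Hypothesis runs : run_swaps E E' u.

(** Second occurrences of squares go first, as they move by the second identity alone; the remaining
    pairs are treated by kind, each with its own flag. *)
Lemma one_swap P x y Q : w = P ++ x :: y :: Q ->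
  indep E u (x, x \in P) (y, y \in P) -> E' w (P ++ y :: x :: Q).
Proof.
move=> wE [xy [cx cy] ns1 ns2 ind].
have c2 d : count_mem d u = 2 -> 2 <= count_mem d (P ++ x :: y :: Q).
  by move=> cd; rewrite -wE wcount cd.
have c2' d : count_mem d u = 2 -> 2 <= count_mem d (P ++ y :: x :: Q).
  by move/c2; cnt; lia.
have cx2 := wcount x; have cy2 := wcount y; rewrite cx wE in cx2; rewrite cy wE in cy2.
have yx : (y == x) = false by rewrite eq_sym (negbTE xy).
move: cx2 cy2; cnt; rewrite !eqxx yx (negbTE xy) => cx2 cy2.
have [[xP sx]|sx] := pselect (x \in P /\ sq u x).
  case/splitPr: xP wE c2 {ind c2' ns1 ns2 cx2 cy2} => P1 P2 wE c2.
  have wE' : w = P1 ++ x :: P2 ++ x :: y :: Q by rewrite wE; lcat.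
  rewrite wE' (_ : (P1 ++ x :: P2) ++ _ = P1 ++ x :: P2 ++ y :: x :: Q); last by lcat.
  apply: (square_swap bE' (basic1 bE') (basic2 bE')) => d.
  rewrite -wE' wcount inE => /orP [/eqP ->|dP]; first by rewrite cy.
  by rewrite (no_simple_in_square sx wE' cx dP).
have [[yP sy]|sy] := pselect (y \in P /\ sq u y).
  case/splitPr: yP wE c2 {ind c2' ns1 ns2 cx2 cy2 sx} => P1 P2 wE c2.
  have wE' : w = P1 ++ y :: (P2 ++ [:: x]) ++ y :: Q by rewrite wE; lcat.
  apply: (congS bE').
  rewrite (_ : w = P1 ++ y :: P2 ++ x :: y :: Q); last by rewrite wE'; lcat.
  rewrite (_ : (P1 ++ y :: P2) ++ _ = P1 ++ y :: P2 ++ y :: x :: Q); last by lcat.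
  apply: (square_swap bE' (basic1 bE') (basic2 bE')) => d dP.
  have -> : count_mem d (P1 ++ y :: P2 ++ y :: x :: Q) = count_mem d w.
    by rewrite wE'; cnt; lia.
  rewrite wcount (no_simple_in_square sy wE' cy) //.
  by move: dP; rewrite inE mem_cat mem_seq1 orbC.
have mem_tail d : d \notin P -> count_mem d u = 2 ->
    (d == x) + (d == y) = 1 -> exists Q1 Q2, Q = Q1 ++ d :: Q2.
  move=> dP cd dxy; suff : d \in Q by case/splitPr=> Q1 Q2; exists Q1, Q2.
  move: dP; rewrite -!count_mem_gt0; move: (wcount d); rewrite cd wE.
  by cnt; rewrite (eq_sym x) (eq_sym y); lia.
case xP: (x \in P) ind ns1 ns2 sx; case yP: (y \in P) sy => sy ind ns1 ns2 sx.
- have nx : ~ sq u x by move=> s; apply: sx.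
  have ny : ~ sq u y by move=> s; apply: sy.
  have [sepfg1 nb] := ind nx ny.
  case/splitPr: xP yP wE {c2 c2' mem_tail} cx2 cy2 => A B + wE cx2 cy2.
  rewrite mem_cat inE yx /= => /orP [yA|yB].
    case/splitPr: yA wE cx2 cy2 => P1 Z wE cx2 cy2.
    have wE' : w = P1 ++ y :: Z ++ x :: B ++ [:: x; y] ++ Q by rewrite wE; lcat.
    rewrite (_ : _ ++ y :: x :: Q = P1 ++ y :: Z ++ x :: B ++ y :: x :: Q); last by lcat.
    case: (pselect (sep u y false x false)) => s.
      rewrite wE'; apply: (congS bE'); apply: (swap_fg1 bE').
      by apply: flags_sub => //; apply: sepfg1; right.
    have nb' : ~ blocked E u y x by move/blockedC.
    have nyx : y != x by rewrite yx.
    have pxy : perm_eq [:: x; y] [:: y; x] by rewrite (perm_catC [:: x] [:: y]).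
    have [Z2 [T [R [QE fr]]]] := run_cond wE' pxy nyx cy cx ny nx s nb'.
    rewrite wE' QE; apply: (congS bE'); apply: runs => //.
    apply: (perm_trans _ pwu).
    rewrite wE' QE perm_cat2l perm_cons perm_cat2l perm_cons perm_cat2l.
    by rewrite (perm_catCA [:: y] [:: x]).
  case/splitPr: yB wE cx2 cy2 => Z B2 wE cx2 cy2.
  have wE' : w = A ++ x :: Z ++ y :: B2 ++ [:: x; y] ++ Q by rewrite wE; lcat.
  rewrite (_ : _ ++ y :: x :: Q = A ++ x :: Z ++ y :: B2 ++ y :: x :: Q); last by lcat.
  case: (pselect (sep u x false y false)) => s.
    rewrite wE'; apply: (swap_fg1 bE').
    by apply: flags_sub => //; apply: sepfg1; left.
  have [Z2 [T [R [QE fr]]]] := run_cond wE' (perm_refl _) xy cx cy nx ny s nb.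
  rewrite wE' QE; apply: runs => //.
  by apply: (perm_trans _ pwu); rewrite wE' QE.
- have nx : ~ sq u x by move=> s; apply: sx.
  have [b1 b2] := ind nx.
  have [|Q1 [Q2 QE]] := mem_tail y (negbT yP) cy; first by rewrite yx eqxx.
  case/splitPr: xP yP wE c2 {cx2 cy2 sx sy ns1 ns2 mem_tail c2' ind} => P1 P2 yP wE c2.
  have wE' : w = P1 ++ x :: P2 ++ x :: y :: Q by rewrite wE; lcat.
  rewrite (_ : _ ++ y :: x :: Q = P1 ++ x :: P2 ++ y :: x :: Q); last by lcat.
  case: (pselect (sq u y)) => sy.
    rewrite wE' QE; apply: (swap_fb1 bE').
      by apply: flags_sub => //; apply: b1.
    move=> d dQ; rewrite -QE -wE' wcount.
    rewrite (@no_simple_in_square y (P1 ++ x :: P2 ++ [:: x]) Q1 Q2 sy _ cy) //.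
    by rewrite wE' QE; lcat.
  rewrite wE'; apply: (swap_fb2 bE').
    by apply: flags_sub => //; apply: b2.
  by rewrite -wE' wcount cy.
- have ny : ~ sq u y by move=> s; apply: sy.
  have [b1 b2] := ind ny.
  have [|Q1 [Q2 QE]] := mem_tail x (negbT xP) cx; first by rewrite (negbTE xy) eqxx.
  case/splitPr: yP xP wE c2' {cx2 cy2 sx sy ns1 ns2 mem_tail c2 ind} => P1 P2 xP wE c2'.
  have wE' : w = P1 ++ y :: P2 ++ x :: y :: Q by rewrite wE; lcat.
  rewrite (_ : _ ++ y :: x :: Q = P1 ++ y :: P2 ++ y :: x :: Q) in c2' *; last by lcat.
  apply: (congS bE'); case: (pselect (sq u x)) => sx.
    rewrite wE' QE; apply: (swap_fb1 bE').
      by apply: flags_sub => //; apply: b1.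
    move=> d dQ; rewrite -QE; apply: c2'.
    apply: (@no_simple_in_square x (P1 ++ y :: P2) (y :: Q1) Q2 sx _ cx).
      by rewrite wE' QE; lcat.
    by rewrite inE dQ orbT.
  rewrite wE'; apply: (swap_fb2 bE').
    by apply: flags_sub => //; apply: b2.
  exact: c2'.
have [a1 a2 a2' a3] := ind.
have [|Q1 [Q2 QE]] := mem_tail x (negbT xP) cx; first by rewrite (negbTE xy) eqxx.
have [|R1 [R2 RE]] := mem_tail y (negbT yP) cy; first by rewrite yx eqxx.
have mQ : sq u x -> forall d, d \in y :: Q1 -> count_mem d u = 2.
  by move=> s; apply: (@no_simple_in_square x P (y :: Q1) Q2 s _ cx); rewrite wE QE.
have mR : sq u y -> forall d, d \in R1 -> count_mem d u = 2.
  move=> s; apply: (@no_simple_in_square y (P ++ [:: x]) R1 R2 s _ cy).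
  by rewrite wE RE; lcat.
have w2 d : count_mem d u = 2 -> 2 <= count_mem d w by move=> e; rewrite wcount e.
case: (pselect (sq u x)) => s; case: (pselect (sq u y)) => s'.
- rewrite wE QE; apply: (swap_fa1 bE' (R1 := R1) (R2 := R2)); rewrite -?QE ?RE -?RE //.
  + by apply: flags_sub => //; apply: a1.
  + move=> d dd; rewrite -wE; apply: w2; move: dd; rewrite mem_cat => /orP [dQ|]; last exact: mR.
    by apply: mQ; rewrite // inE dQ orbT.
  + by rewrite -wE; apply: w2.
  + by rewrite -wE; apply: w2.
- rewrite wE QE; apply: (swap_fa2 bE'); rewrite -?QE -?wE; try exact: w2.
  + by apply: flags_sub => //; apply: a2.
  + by move=> d dQ; apply: w2; apply: mQ; rewrite // inE dQ orbT.
- rewrite wE RE; apply: (congS bE'); apply: (swap_fa2 bE'); rewrite -?RE; try exact: c2'.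
  + by apply: flags_sub => //; apply: a2'.
  + by move=> d dQ; apply: c2'; apply: mR.
- rewrite wE; apply: (swap_fa3 bE'); rewrite -?wE; try exact: w2.
  by apply: flags_sub => //; apply: a3.
Qed.

End OneSwap.

Hypothesis fw : E [:: 0; 1; 3; 0; 1] [:: 0; 1; 3; 1; 0].
Hypotheses (n2 : ~ holds E fe2) (n3 : ~ holds E fe3) (n4 : ~ holds E fe4).
Variables (E' : word -> word -> Prop) (bE' : basic E').
Hypothesis flags_sub : forall e, e \in [:: fa1; fa2; fa3; fb1; fb2; fg1] ->
  holds E e -> holds E' e.

Lemma linked_complete u v : linked E u v -> run_swaps E E' u -> E' u v.
Proof.
move=> L runs; have [uv tu tv pe] := L.
apply: (@trace_words E' bE' u v (indep E u) tu tv pe).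
- by move=> i j /indepC.
- by move=> x b y c [].
- by move=> x b y c; apply: (inverted_indep bE fw n2 n3 n4 L).
- by move=> w P x y Q pw ord; apply: one_swap.
Qed.

End Complete.

(** * Transposing adjacent second occurrences *)

Section RunSwaps.
Variables (E : word -> word -> Prop) (bE : basic E).

Lemma del_mid p v r w : (forall x, x \in v -> 2 <= count_mem x p) -> w = p ++ v ++ r ->
  E (p ++ r) w.
Proof. by move=> H ->; apply: (congS bE); apply: (@del3s _ bE (basic1 bE)). Qed.

Lemma run_fg2 P x Z y Q R : holds E fg2 ->
  (forall z, z \in Z -> 2 <= count_mem z (P ++ x :: Z ++ y :: Q ++ x :: y :: R)) ->
  E (P ++ x :: Z ++ y :: Q ++ x :: y :: R) (P ++ x :: Z ++ y :: Q ++ y :: x :: R).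
Proof.
move=> H HZ.
have K := thCC bE P [::] (th_inst bE [:: [:: x]; [:: y]; Z; Q; R] H).
rewrite /subst /inst /= in K; apply: (thT2 bE _ _ K).
  by apply: (@add3 _ bE _ Z _ HZ); lcat.
apply: (@add3 _ bE _ Z); last by lcat.
by move=> z /HZ; cnt; lia.
Qed.

(** A redundant copy of [Z] before [R] and one of [T] after it produce the ending T Z R T of an
    instance of [fg3]. *)
Lemma run_fg3 P x Z y Q T R : holds E fg3 ->
  (forall z, z \in Z -> 2 <= count_mem z (P ++ x :: Z ++ y :: Q ++ x :: y :: T)) ->
  (forall z, z \in T -> 2 <= count_mem z (P ++ x :: Z ++ y :: Q ++ x :: y :: T ++ R)) ->
  E (P ++ x :: Z ++ y :: Q ++ x :: y :: T ++ R) (P ++ x :: Z ++ y :: Q ++ y :: x :: T ++ R).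
Proof.
move=> H HZ HT.
have K := thCC bE P [::] (th_inst bE [:: [:: x]; [:: y]; Z; Q; R; T] H).
rewrite /subst /inst /= in K; apply: (thT2 bE _ _ K).
  apply: (@congT _ bE (P ++ x :: Z ++ y :: Q ++ x :: y :: T ++ Z ++ R)).
    have := @del_mid _ Z R _ HZ erefl; by lcat.
  apply: (@add3 _ bE _ T); last by lcat.
  by move=> z /HT; cnt; lia.
apply: (@congT _ bE (P ++ x :: Z ++ y :: Q ++ y :: x :: T ++ Z ++ R)).
  have := @del_mid (P ++ x :: Z ++ y :: Q ++ y :: x :: T) Z R _ _ erefl.
  by lcat; apply=> z /HZ; cnt; lia.
apply: (@add3 _ bE _ T); last by lcat.
by move=> z /HT; cnt; lia.
Qed.

Definition repeatable (A T R : word) : Prop :=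
  forall T1 c T2, T = T1 ++ c :: T2 -> c \notin A ++ T1 ->
  exists r1 r2, T2 ++ R = r1 ++ c :: r2 /\
    forall d, d \in r1 -> 2 <= count_mem d (A ++ T ++ R).

(** The second copy of [T] is written letter by letter. A letter that has already occurred twice is
    added freely; otherwise it starts in [T], and a copy can be inserted before its next occurrence
    because no simple letter intervenes. *)
Lemma repeat_factor A T R : repeatable A T R -> E (A ++ T ++ R) (A ++ T ++ T ++ R).
Proof.
move=> HT; suff K T1 T2 : T = T1 ++ T2 -> E (A ++ T ++ R) (A ++ T ++ T1 ++ R).
  by apply: (K T [::]); rewrite cats0.
elim/last_ind: T1 T2 => [|T1 c IH] T2 TE; first exact: (congR bE).
rewrite cat_rcons in TE.
apply: (congT bE (IH _ TE)); rewrite cat_rcons.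
have cT : 0 < count_mem c T by rewrite count_mem_gt0 TE mem_cat mem_head orbT.
have [c2|c2] := leqP 2 (count_mem c (A ++ T ++ T1)).
  apply: (congS bE); have := @del3 _ bE (basic1 bE) (A ++ T ++ T1) c R c2.
  by rewrite -!catA.
have cA : c \notin A ++ T1.
  by rewrite -count_mem_gt0; move: c2 cT; cnt; lia.
have [r1 [r2 [TR Hr]]] := HT T1 c T2 TE cA.
have cT2 : c \notin T2.
  by rewrite -count_mem_gt0; move: c2; rewrite TE; cnt; rewrite eqxx; lia.
have [r [r1E RE]] : exists r, r1 = T2 ++ r /\ R = r ++ c :: r2.
  elim: (T2) (r1) cT2 TR => [|d D IHD] r1' cD TR; first by exists r1'.
  case: r1' TR => [|d' r1'] /= [dd TR].
    by move: cD; rewrite dd mem_head.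
  have [|r [rE RE]] := IHD r1' _ TR; first by move: cD; rewrite inE negb_or => /andP [].
  by exists r; rewrite dd rE.
have := @square_insert _ bE (basic1 bE) (basic2 bE) (A ++ T1) c (T2 ++ T1) r r2.
rewrite RE TE; lcat; apply => d dd.
have : d \in T1 \/ d \in r1.
  by move: dd; rewrite r1E !mem_cat => /orP [->|/orP [->|->]]; rewrite ?orbT; auto.
case=> [|/Hr]; last by rewrite RE TE; cnt; lia.
by rewrite -count_mem_gt0; cnt; lia.
Qed.

(** The factor ccz of [fsg] becomes T T Z, with the second T from [repeat_factor] and a redundant
    Z. *)
Lemma run_fsg P x Z y Q T R : holds E fsg ->
  (forall z, z \in Z -> 2 <= count_mem z (P ++ x :: Z ++ y :: Q ++ x :: y :: T)) ->
  repeatable (P ++ x :: Z ++ y :: Q ++ [:: x; y]) T R ->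
  E (P ++ x :: Z ++ y :: Q ++ x :: y :: T ++ R) (P ++ x :: Z ++ y :: Q ++ y :: x :: T ++ R).
Proof.
move=> H HZ HT.
have HT' : repeatable (P ++ x :: Z ++ y :: Q ++ [:: y; x]) T R.
  move=> T1 c T2 TE nc; have [|r1 [r2 [TR Hr]]] := HT T1 c T2 TE.
    by move: nc; rewrite -!count_mem_gt0; cnt; lia.
  by exists r1, r2; split=> // d /Hr; cnt; lia.
have K := thCC bE P R (th_inst bE [:: [:: x]; [:: y]; Z; Q; [::]; T] H).
rewrite /subst /inst /= in K; apply: (thT2 bE _ _ K).
  apply: (@congT _ bE (P ++ x :: Z ++ y :: Q ++ x :: y :: T ++ T ++ R)).
    by have := repeat_factor HT; lcat.
  have := @del_mid (P ++ x :: Z ++ y :: Q ++ x :: y :: T ++ T) Z R _ _ erefl.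
  by lcat; apply=> z /HZ; cnt; lia.
apply: (@congT _ bE (P ++ x :: Z ++ y :: Q ++ y :: x :: T ++ T ++ R)).
  by have := repeat_factor HT'; lcat.
have := @del_mid (P ++ x :: Z ++ y :: Q ++ y :: x :: T ++ T) Z R _ _ erefl.
by lcat; apply=> z /HZ; cnt; lia.
Qed.

End RunSwaps.

Lemma perm_extend (N m : nat) (f : nat -> nat) : m <= N ->
  (forall j, j < m -> f j < N) -> {in [pred j | j < m] &, injective f} ->
  exists p : 'S_N, forall j : 'I_N, j < m -> p j = f j :> nat.
Proof.
move=> mN fN fi.
pose s := map f (iota 0 m) ++ filter [predC map f (iota 0 m)] (iota 0 N).
have us1 : uniq (map f (iota 0 m)).
  by rewrite map_inj_in_uniq ?iota_uniq // => i j; rewrite !mem_iota /= !add0n; apply: fi.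
have us : uniq s.
  rewrite cat_uniq us1 filter_uniq ?iota_uniq //= andbT.
  by apply/hasPn => j; rewrite mem_filter /= => /andP [].
have ms j : (j \in s) = (j < N).
  rewrite mem_cat mem_filter mem_iota /= add0n.
  case jf: (j \in map f (iota 0 m)) => //=.
  by case/mapP: jf => i; rewrite mem_iota /= add0n => im ->; rewrite fN.
have ss : size s = N.
  rewrite -(size_iota 0 N); apply/perm_size/uniq_perm => // [|j]; first exact: iota_uniq.
  by rewrite ms mem_iota.
have lt (j : 'I_N) : nth 0 s j < N by rewrite -ms mem_nth // ss.
pose g (j : 'I_N) := Ordinal (lt j).
have gi : injective g.
  move=> i j /(congr1 val) /= /eqP; rewrite nth_uniq ?ss // => /eqP; exact: val_inj.
exists (perm gi) => j jm; rewrite permE /= nth_cat size_map size_iota jm.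
by rewrite (nth_map 0) ?size_iota // nth_iota.
Qed.

Lemma bigcat_flatten (I : Type) (r : seq I) (F : I -> word) :
  \big[cat/[::]]_(i <- r) F i = flatten (map F r).
Proof. by elim: r => [|a r IH]; rewrite ?big_nil // big_cons IH. Qed.

Lemma subst_flatten f (l : seq word) : subst f (flatten l) = flatten (map (subst f) l).
Proof. by elim: l => //= a l IH; rewrite subst_cat IH. Qed.

Lemma flatten_iota (V : word) (g : nat -> word) N : size V <= N ->
  (forall k, k < size V -> g k = [:: nth 0 V k]) ->
  (forall k, size V <= k -> k < N -> g k = [::]) -> flatten (map g (iota 0 N)) = V.
Proof.
move=> VN H1 H2; rewrite -(subnKC VN) iotaD map_cat flatten_cat add0n.
have -> : flatten (map g (iota (size V) (N - size V))) = [::].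
  rewrite (_ : map g _ = map (fun=> [::]) (iota (size V) (N - size V))).
    by elim: (iota _ _).
  apply/eq_in_map => k; rewrite mem_iota => /andP [k1 k2]; apply: H2 => //.
  by rewrite subnKC in k2.
rewrite cats0.
have -> : map g (iota 0 (size V)) = map (fun k => [:: nth 0 V k]) (iota 0 (size V)).
  by apply/eq_in_map => k; rewrite mem_iota /= => kV; apply: H1.
by elim: (V) => //= a W IH; rewrite -[1]addn0 iotaDl -map_comp IH.
Qed.

Lemma lxiK i : ((lxi i - 4) %/ 3 = i) * ((lxi i - 4) %% 3 = 0) * (3 < lxi i).
Proof. by rewrite /lxi; do !split; lia. Qed.
Lemma lziK i : ((lzi i - 4) %/ 3 = i) * ((lzi i - 4) %% 3 = 1) * (3 < lzi i).
Proof. by rewrite /lzi; do !split; lia. Qed.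
Lemma ltiK i : ((lti i - 4) %/ 3 = i) * ((lti i - 4) %% 3 = 2) * (3 < lti i).
Proof. by rewrite /lti; do !split; lia. Qed.

Section WnSwap.
Variables (E : word -> word -> Prop) (bE : basic E).
Hypothesis wn : forall n (p q : 'S_(2 * n)), 1 <= n -> E (w_word p q) (w'_word p q).

(** Any run [T] of second occurrences is the beginning of the tail of a substituted w_n. Letters of
    [P] and [Q] that recur in [T] are values of the x_i, the others of the t_i, and letters of [Z]
    are values of the z_i; the permutations are chosen to list [T] in its order. *)
Lemma run_wn (P : word) x (Z : word) y (Q T R : word) : uniq T ->
  (forall a, a \in T -> count_mem a (P ++ Z ++ Q) = 1) ->
  (forall z, z \in Z -> 2 <= count_mem z (P ++ x :: Z ++ y :: Q ++ x :: y :: T)) ->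
  E (P ++ x :: Z ++ y :: Q ++ x :: y :: T ++ R) (P ++ x :: Z ++ y :: Q ++ y :: x :: T ++ R).
Proof.
move=> uT T1 HZ.
(* [n] leaves room for [m] indices beyond [P] and beyond [Z] at which the substitution is empty. *)
pose m := size T; pose n := (size P + size Z + size Q + m).+1.
pose pick (b : bool) (V : word) k : word :=
  if (k < size V) && ((nth 0 V k \in T) == b) then [:: nth 0 V k] else [::].
pose fxt b k := if k < n then pick b P k else pick b Q (k - n).
pose fz k : word := if k < size Z then [:: nth 0 Z k] else [::].
pose phi (a : nat) : word :=
  if a == 0 then [:: x] else if a == 1 then [:: y] else if a <= 3 then [::]
  else let k := ((a - 4) %/ 3).-1 in
    if (a - 4) %% 3 == 0 then fxt true k else if (a - 4) %% 3 == 1 then fz k else fxt false k.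
have phi4 b : 3 < b -> phi b = let k := ((b - 4) %/ 3).-1 in
    if (b - 4) %% 3 == 0 then fxt true k else if (b - 4) %% 3 == 1 then fz k else fxt false k.
  by case: b => [|[|[|[|b]]]].
have phix i : phi (lxi i.+1) = fxt true i by rewrite phi4 !lxiK.
have phiz i : phi (lzi i.+1) = fz i by rewrite phi4 !lziK.
have phit i : phi (lti i.+1) = fxt false i by rewrite phi4 !ltiK.
have pick2 V k : k < size V -> pick true V k ++ pick false V k = [:: nth 0 V k] /\
                              pick false V k ++ pick true V k = [:: nth 0 V k].
  by move=> kV; rewrite /pick kV /=; case: (nth 0 V k \in T).
have pick0 b V k : size V <= k -> pick b V k = [::].
  by move=> kV; rewrite /pick ltnNge kV.
have iotaS b N : iota b.+1 N = map (addn b.+1) (iota 0 N) by rewrite -iotaDl addn0.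
have partP : subst phi (\big[cat/[::]]_(1 <= i < n.+1) [:: lxi i; lti i]) = P.
  rewrite bigcat_flatten subst_flatten /index_iota subn1 iotaS -!map_comp.
  apply: flatten_iota => [|k kP|k kP kn] /=.
  - by rewrite /n; lia.
  - rewrite /subst /= cats0 !add1n phix phit /fxt (_ : k < n); last by rewrite /n; lia.
    exact: (pick2 P k kP).1.
  - by rewrite /subst /= cats0 !add1n phix phit /fxt kn !pick0.
have partZ : subst phi (\big[cat/[::]]_(1 <= i < (2 * n).+1) [:: lzi i]) = Z.
  rewrite bigcat_flatten subst_flatten /index_iota subn1 iotaS -!map_comp.
  apply: flatten_iota => [|k kP|k kP kn] /=.
  - by rewrite /n; lia.
  - by rewrite /subst /= cats0 !add1n phiz /fz kP.
  - by rewrite /subst /= cats0 !add1n phiz /fz ltnNge kP.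
have partQ : subst phi (\big[cat/[::]]_(n.+1 <= i < (2 * n).+1) [:: lti i; lxi i]) = Q.
  rewrite bigcat_flatten subst_flatten /index_iota subSS iotaS -!map_comp.
  rewrite mul2n -addnn addnK.
  apply: flatten_iota => [|k kP|k kP kn] /=.
  - by rewrite /n; lia.
  - rewrite /subst /= cats0 !(addSn n k) phix phit /fxt ltnNge leq_addr /= addKn.
    exact: (pick2 Q k kP).2.
  - by rewrite /subst /= cats0 !(addSn n k) phix phit /fxt ltnNge leq_addr /= addKn !pick0.
pose a j := nth 0 T j.
have aT j : j < m -> a j \in T by move=> jm; apply: mem_nth.
have cT j : j < m -> (a j \in P) + (a j \in Z) + (a j \in Q) = 1.
  move/aT/T1; rewrite !count_cat -!count_mem_gt0.
  by case: (count_mem _ P) => [|[|?]]; case: (count_mem _ Z) => [|[|?]];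
     case: (count_mem _ Q) => [|[|?]].
(* The j-th pair of the tail must produce the j-th letter of [T] and nothing else. That letter comes
   from exactly one of [P], [Z], [Q]; the other member of the pair is sent to the empty index
   [size P + j] or [size Z + j]. *)
pose f j := if a j \in P then index (a j) P else if a j \in Q then n + index (a j) Q
            else size P + j.
pose g j := if a j \in Z then index (a j) Z else size Z + j.
have ai i j : i < m -> j < m -> a i = a j -> i = j.
  by move=> im jm /eqP; rewrite nth_uniq // => /eqP.
have ii (V : word) i j : i < m -> j < m -> a i \in V -> a j \in V -> index (a i) V = index (a j) V -> i = j.
  by move=> im jm iV jV e; apply: ai => //; rewrite -(nth_index 0 iV) -(nth_index 0 jV) e.
have iV (V : word) b : b \in V -> index b V < size V by rewrite index_mem.
have [p pf] : exists p : 'S_(2 * n), forall j : 'I_(2 * n), j < m -> p j = f j :> nat.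
  apply: perm_extend; first by rewrite /n; lia.
    move=> j jm; rewrite /f; case: ifP => [/iV|_]; first by rewrite /n; lia.
    by case: ifP => [/iV|_]; rewrite /n; lia.
  move=> i j; rewrite !inE => im jm; rewrite /f.
  case Pi: (a i \in P); case Pj: (a j \in P); first exact: ii.
  - by have := iV _ _ Pi; case: ifP => _; rewrite /n; lia.
  - by have := iV _ _ Pj; case: ifP => _; rewrite /n; lia.
  case Qi: (a i \in Q); case Qj: (a j \in Q).
  - by move/addnI; apply: ii.
  - by rewrite /n; lia.
  - by rewrite /n; lia.
  - by move/addnI.
have [q qg] : exists q : 'S_(2 * n), forall j : 'I_(2 * n), j < m -> q j = g j :> nat.
  apply: perm_extend; first by rewrite /n; lia.
    by move=> j jm; rewrite /g; case: ifP => [/iV|_]; rewrite /n; lia.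
  move=> i j; rewrite !inE => im jm; rewrite /g.
  case: ifP => [Pi|_]; case: ifP => [Pj|_].
  - exact: ii.
  - by have := iV _ _ Pi; lia.
  - by have := iV _ _ Pj; lia.
  - by move/addnI.
pose h (i : 'I_(2 * n)) := fxt true (p i) ++ fz (q i).
have tailE : subst phi (\big[cat/[::]]_(i < 2 * n) [:: lxi (p i).+1; lzi (q i).+1]) =
             flatten (map h (enum 'I_(2 * n))).
  rewrite bigcat_flatten [index_enum _]unlock -enumT.
  rewrite subst_flatten -map_comp; congr flatten.
  by apply: eq_map => i; rewrite /= /subst /= cats0 phix phiz.
have sPn k : k < m -> size P + k < n by rewrite /n; lia.
have hT (i : 'I_(2 * n)) : i < m -> h i = [:: a i].
  move=> im; rewrite /h pf // qg //; have := cT i im.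
  rewrite /f /g /fxt /fz; have := aT i im => aTi.
  case iP: (a i \in P) => /=.
    case iZ: (a i \in Z); case iQ: (a i \in Q) => // _.
    have lt := iV _ _ iP.
    rewrite (_ : index (a i) P < n); last by apply: leq_trans lt _; rewrite /n; lia.
    by rewrite /pick lt nth_index // aTi /= ltnNge leq_addr.
  case iZ: (a i \in Z); case iQ: (a i \in Q) => // _.
    rewrite (sPn i im).
    by rewrite pick0 ?leq_addr //= iV // nth_index.
  by rewrite ltnNge leq_addr /= addKn /pick iV // nth_index // aTi /= ltnNge leq_addr.
have mN : m <= 2 * n by rewrite /n; lia.
(* Behind its first [m] pairs the tail only contains letters of [T] and [Z], which have occurred
   twice by then. *)
have [rest [restE restT]] : exists rest, flatten (map h (enum 'I_(2 * n))) = T ++ rest /\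
    forall b, b \in rest -> b \in T \/ b \in Z.
  exists (flatten (map h (drop m (enum 'I_(2 * n))))); split.
    rewrite -{1}(cat_take_drop m (enum 'I_(2 * n))) map_cat flatten_cat; congr cat.
    have -> : map h (take m (enum 'I_(2 * n))) = map (fun b => [:: b]) T.
      apply: (@eq_from_nth _ [::]); rewrite !size_map size_takel ?size_enum_ord // => i im.
      have i2 : i < 2 * n by apply: leq_trans mN.
      rewrite (nth_map (Ordinal i2)) ?size_takel ?size_enum_ord // nth_take //.
      rewrite (nth_map 0) // hT; last by rewrite nth_enum_ord.
      by rewrite /a nth_enum_ord.
    exact: (subst_id T).
  move=> b /flattenP [l /mapP [i _ ->]]; rewrite /h mem_cat => /orP [|].
    rewrite /fxt /pick; case: ifP => _; case: ifP => //; rewrite inE => /andP [_ /eqP bT] /eqP ->;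
    by left.
  rewrite /fz; case: ifP => // iZ; rewrite inE => /eqP ->.
  by right; apply: mem_nth.
have n1 : 1 <= n by [].
have := thCr bE R (theoryF bE phi (wn p q n1)).
rewrite /w_word /w'_word !subst_cat partP partZ partQ tailE restE.
rewrite /subst /= -!catA /=.
have RT d W : d \in rest -> (forall z, count_mem z W = count_mem z (P ++ x :: Z ++ y :: Q ++ x :: y :: T)) ->
    2 <= count_mem d W.
  move=> /restT [dT|dZ] ->; last exact: HZ.
  by have := T1 d dT; move: dT; rewrite -count_mem_gt0; cnt; lia.
move=> K; apply: (thT2 bE _ _ K).
  have := @del_mid _ bE (P ++ x :: Z ++ y :: Q ++ x :: y :: T) rest R _ _ erefl.
  by lcat; apply=> d dr; apply: (RT d _ dr).
have := @del_mid _ bE (P ++ x :: Z ++ y :: Q ++ y :: x :: T) rest R _ _ erefl.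
by lcat; apply=> d dr; apply: (RT d _ dr) => z; cnt; lia.
Qed.

End WnSwap.

(** * A theory is determined by its flags *)

Record Gtheory (E : word -> word -> Prop) : Prop := GTheory {
  Gtheory_basic :> basic E;
  Gtheory_w : forall n (p q : 'S_(2 * n)), 1 <= n -> E (w_word p q) (w'_word p q) }.

(** What is left of w_n = w_n' when all factors but one simple letter between x, y and their
    recurrence are empty. *)
Lemma Gtheory_fw E : Gtheory E -> E [:: 0; 1; 3; 0; 1] [:: 0; 1; 3; 1; 0].
Proof. by move=> gE; apply: (@run_wn E gE (Gtheory_w gE) [::] 0 [::] 1 [:: 3] [::] [::]). Qed.

Lemma first_split (c : nat) T : c \in T ->
  exists T1 T2, T = T1 ++ c :: T2 /\ c \notin T1.
Proof.
elim: T => //= a T IH; have [->|ca] := eqVneq c a; first by exists [::], T.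
rewrite inE (negbTE ca) => /IH [T1 [T2 [-> nc]]].
by exists (a :: T1), T2; rewrite inE negb_or ca.
Qed.

(** Without [fsg] no letter starts in [T], and [run_wn] applies; with [fg3] it is enough that all
    letters of [T] are repeated; with [fsg] but not [fg3] the letters starting in [T] are squares,
    so [T] is repeatable. *)
Lemma Gtheory_runs E E' u : Gtheory E' ->
  (forall e, e \in [:: fg2; fg3; fsg] -> holds E e -> holds E' e) ->
  two u -> run_swaps E E' u.
Proof.
move=> gE' fl tu P x Z y Q T R xy pe cx cy Z2 H.
have cw d : count_mem d (P ++ x :: Z ++ y :: Q ++ x :: y :: T ++ R) = count_mem d u.
  by move/seq.permP: pe => ->.
case: H => [g2|[HZ HT]].
  apply: (run_fg2 gE'); first by apply: fl => //; rewrite inE eqxx.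
  by move=> z zZ; rewrite cw Z2.
have ge2 T1 c T2 : T = T1 ++ c :: T2 -> c \in P ++ x :: Z ++ y :: Q ++ x :: y :: T1 ->
    2 <= count_mem c u.
  by move=> TE; rewrite -(cw c) TE -count_mem_gt0; cnt; rewrite eqxx; lia.
case: (pselect (holds E fsg)) => sg; last first.
  have inW c : c \in T -> 0 < count_mem c (P ++ x :: Z ++ y :: Q ++ [:: x; y]).
    move=> /first_split [T1 [T2 [TE cT1]]].
    have [|/(HT _ _ _ TE) [] //] := boolP (c \in P ++ x :: Z ++ y :: Q ++ x :: y :: T1).
    by move: cT1; rewrite -!count_mem_gt0; cnt; lia.
  have cT c : c \in T -> count_mem c (P ++ Z ++ Q) = 1 /\ count_mem c T = 1.
    move=> cT; have := inW c cT; move: cT; rewrite -count_mem_gt0.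
    have := tu c; rewrite -(cw c); cnt.
    by case: (x == c); case: (y == c) => /=; lia.
  apply: (run_wn gE' (Gtheory_w gE')) => //; last by move=> a /cT [].
  apply: count_mem_uniq => c; case cTE: (c \in T); first by case: (cT c cTE).
  by apply/count_memPn; rewrite cTE.
case: (pselect (holds E fg3)) => g3.
  apply: (run_fg3 gE') => //; first by apply: fl => //; rewrite !inE eqxx orbT.
  move=> z zT; rewrite cw.
  have [T1 [T2 TE]] : exists T1 T2, T = T1 ++ z :: T2.
    by case/splitPr: zT => T1 T2; exists T1, T2.
  have [/(ge2 _ _ _ TE)//|nz] := boolP (z \in P ++ x :: Z ++ y :: Q ++ x :: y :: T1).
  by have [_ -> _] := HT _ _ _ TE nz.
apply: (run_fsg gE') => //; first by apply: fl => //; rewrite !inE eqxx !orbT.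
move=> T1 c T2 TE nc; have [|_ c2 [//|[r1 [r2 [TR Hr]]]]] := HT _ _ _ TE.
  by move: nc; rewrite -!count_mem_gt0; cnt; lia.
exists r1, r2; split=> // d /Hr dd.
by have := cw d; rewrite dd; cnt; lia.
Qed.

(** * Letter counts and degenerate theories *)

Section Degenerate.
Variables (E : word -> word -> Prop) (bE : basic E).

(** Erasing all letters but x leaves an identity between powers with exponents at most 2; distinct
    exponents give [fe0] if one of them is 0, and [fe1] otherwise. *)
Lemma count_class u v x : ~ holds E fe0 -> E u v -> two u -> two v ->
  (x \in u) = (x \in v) /\ (~ holds E fe1 -> count_mem x u = count_mem x v).
Proof.
move=> n0 uv tu tv.
have sub w : subst (fun a => if a == x then [:: 0] else [::]) w = nseq (count_mem x w) 0.
  by elim: w => //= a w IH; rewrite subst_cons IH; case: (a == x).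
have := theoryF bE (fun a => if a == x then [:: 0] else [::]) uv.
rewrite !sub -!count_mem_gt0; have := tu x; have := tv x.
have e02 : E [::] [:: 0; 0] -> False.
  move=> H; apply: n0.
  have K : E [:: 0; 0; 0] [:: 0; 0] by apply: (red_eq bE (basic1 bE)).
  apply: (congT bE) (congS bE H); apply: (congT bE) K.
  exact: (thCl bE [:: 0] H).
case: (count_mem x u) => [|[|[|//]]]; case: (count_mem x v) => [|[|[|//]]] //= _ _ H.
- by case: n0; apply: (congS bE).
- by case: e02; apply: (congS bE).
- by split=> // n1; case: n1; apply: (congS bE).
Qed.

Lemma commutative_perm u v : holds E fe2 -> perm_eq u v -> E u v.
Proof.
move=> H; elim: v u => [|b v IH] u; first by move/perm_nilP => ->; apply: (congR bE).
move=> pe; have bu : b \in u by rewrite (perm_mem pe) mem_head.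
case/splitPr: bu pe => p q pe.
apply: (@congT _ bE (b :: p ++ q)).
  have := thCr bE q (th_inst bE [:: p; [:: b]] H).
  by rewrite /subst /inst /=; lcat.
apply: (thCl bE [:: b]); apply: IH.
by move: pe; rewrite (perm_catCA p [:: b] q) /= perm_cons.
Qed.

Section Idempotent.
Hypothesis e1 : holds E fe1.

Lemma idem_del p x r : x \in p -> E (p ++ x :: r) (p ++ r).
Proof.
case/splitPr=> p1 p2.
have D y s t : E (s ++ y :: t) (s ++ y :: y :: t).
  have := thCC bE s t (th_inst bE [:: [:: y]] e1).
  by rewrite /subst /inst /=; lcat.
apply: (@thT2 _ bE _ _ ((p1 ++ x :: x :: p2) ++ x :: r) ((p1 ++ x :: x :: p2) ++ r)).
- by have := D x p1 (p2 ++ x :: r); lcat.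
- by have := D x p1 (p2 ++ r); lcat.
by apply: (@del3 _ bE (basic1 bE)); cnt; rewrite eqxx; lia.
Qed.

Lemma idem_keep_cat p v : E (p ++ v) (p ++ keep (fun x => 1 - (x \in p)) v).
Proof.
elim: v p => [|a v IH] p; first exact: (congR bE).
rewrite /=; case ap: (a \in p) => /=.
  apply: (congT bE (idem_del v ap)); apply: (congT bE (IH p)).
  rewrite (_ : keep _ v = keep (fun x => 1 - (x \in p) - (x == a)) v); first exact: (congR bE).
  by apply: eq_keep => x; case: eqVneq => [->|_]; rewrite ?ap ?subn0.
have := IH (rcons p a); rewrite !cat_rcons.
rewrite (_ : keep _ v = keep (fun x => 1 - (x \in p) - (x == a)) v) //.
by apply: eq_keep => x; rewrite mem_rcons inE; case: (x == a); case: (x \in p).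
Qed.

Lemma idem_keep w : E w (keep (fun=> 1) w).
Proof. exact: idem_keep_cat [::] w. Qed.

End Idempotent.

Lemma fe4_left P x Q R : holds E fe4 -> E (P ++ x :: Q ++ x :: R) (P ++ x :: x :: Q ++ R).
Proof.
move=> H; have /(congS bE) := thCC bE P R (th_inst bE [:: [:: x]; [::]; [::]; Q] H).
by rewrite /subst /inst /=; lcat.
Qed.

Lemma fe4_swap P x y Q : holds E fe4 -> x \in P -> E (P ++ x :: y :: Q) (P ++ y :: x :: Q).
Proof.
move=> H /splitPr [P1 P2].
apply: (@thT2 _ bE _ _ (P1 ++ x :: x :: P2 ++ y :: Q) (P1 ++ x :: x :: P2 ++ y :: Q)).
- by have := fe4_left P1 x P2 (y :: Q) H; lcat.
- by have := fe4_left P1 x (P2 ++ [:: y]) Q H; lcat.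
exact: (congR bE).
Qed.

Lemma fe4_ins P x Q : holds E fe4 -> x \in Q -> E (P ++ x :: Q) (P ++ x :: x :: Q).
Proof.
move=> H /splitPr [Q1 Q2]; apply: (congT bE (fe4_left P x Q1 Q2 H)).
apply: (congS bE); have := @del3 _ bE (basic1 bE) (P ++ x :: x :: Q1) x Q2.
by lcat; apply; cnt; rewrite eqxx; lia.
Qed.

Lemma fe4_swap_first P x y Q : holds E fe4 -> holds E fa1 -> x \in Q -> y \in Q ->
  E (P ++ x :: y :: Q) (P ++ y :: x :: Q).
Proof.
move=> H H1 xQ yQ.
have ins a b : a \in Q -> b \in Q -> E (P ++ a :: b :: Q) (P ++ a :: a :: b :: b :: Q).
  move=> aQ bQ; apply: (@congT _ bE (P ++ a :: a :: b :: Q)).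
    by apply: fe4_ins; rewrite // inE aQ orbT.
  by have := @fe4_ins (P ++ [:: a; a]) b Q H bQ; lcat.
apply: (thT2 bE (ins _ _ xQ yQ) (ins _ _ yQ xQ)).
have := thCC bE P Q (th_inst bE [:: [:: x]; [:: y]] H1).
by rewrite /subst /inst /=; lcat.
Qed.

(** When x has not occurred before, both of its occurrences can be carried to the place of the later
    one, on either side of the identity. *)
Lemma fe3_swap P x y Q : holds E fe3 -> 2 <= count_mem x (P ++ x :: y :: Q) ->
  E (P ++ x :: y :: Q) (P ++ y :: x :: Q).
Proof.
move=> H; have H4 := fe3_fe4 bE H => cx.
have [xP|xP] := boolP (x \in P); first exact: fe4_swap.
have [yx|yx] := eqVneq y x; first by rewrite yx; apply: (congR bE).
have xQ : x \in Q.
  move: xP cx; rewrite -!count_mem_gt0; cnt; rewrite eqxx (negbTE yx); lia.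
case/splitPr: xQ => Q1 Q2.
have mv A W R : E (A ++ x :: W ++ x :: R) (A ++ W ++ x :: x :: R).
  apply: (congT bE (fe4_left A x W R H4)).
  have := thCC bE A R (th_inst bE [:: [:: x]; [::]; [::]; W] H).
  by rewrite /subst /inst /=; lcat.
apply: (@thT2 _ bE _ _ (P ++ y :: Q1 ++ x :: x :: Q2) (P ++ y :: Q1 ++ x :: x :: Q2)).
- exact: (mv P (y :: Q1) Q2).
- by have := mv (P ++ [:: y]) Q1 Q2; lcat.
exact: (congR bE).
Qed.

End Degenerate.

Lemma inverted_first_simple E (bE : basic E) u v x t : ~ holds E fe3 -> linked E u v ->
  count_mem x u = 2 -> count_mem t u = 1 ->
  pos u x false < pos u t false -> pos v t false < pos v x false -> False.
Proof.
move=> n3 L cx ct Hu Hv; have xt : x != t by neqs.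
have cx' := etrans (linked_count x L) cx; have ct' := etrans (linked_count t L) ct.
have fv := pos_fs cx'; have fu := pos_fs cx.
have U : uniq [:: x; t] by rewrite /= inE xt.
have C1 : forall i, i \in [:: 0] -> count_mem (nth 0 [:: x; 0; 0; t] i) u = 2 by cnts.
have C2 : forall i, i \in [:: 3] -> count_mem (nth 0 [:: x; 0; 0; t] i) u = 1 by cnts.
have K T T' := @linked_restrict E bE u v (nth 0 [:: x; 0; 0; t]) [:: 0] [:: 3] T T' L U C1 C2.
pose TA : seq item := [:: (0, false); (0, true); (3, false)].
pose TB : seq item := [:: (0, false); (3, false); (0, true)].
pose TC : seq item := [:: (3, false); (0, false); (0, true)].
case: (pattern_xt cx ct) => [H|/andP [H H']|H]; last by plia.
  by apply: n3; apply: (K TA TC) => //=; plia.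
by apply: n3; apply: (xtx_txx bE); apply: (K TB TC) => //=; plia.
Qed.

Lemma pos_index w x : x \in w -> pos w x false = index x w.
Proof.
rewrite /pos /ann; have : x \notin [::] by [].
elim: w [::] => //= a w IH S xS; rewrite inE xpair_eqE.
have [<-|xa] := eqVneq x a; first by rewrite (negbTE xS).
by move=> /= xw; rewrite IH // inE negb_or xa.
Qed.

(** Degenerate flags change the normal form: under [fe1] only the order of first occurrences counts,
    under [fe2] only multiplicities, under [fe3] repeated letters are free, under [fe4] second
    occurrences are. Otherwise [linked_complete] applies. *)
Theorem determinacy E E' : Gtheory E -> Gtheory E' ->
  (forall e, e \in flags -> holds E e -> holds E' e) -> forall u v, E u v -> E' u v.
Proof.
move=> gE gE' fl u0 v0 uv0.
have {}fl e : e \in flags -> holds E e -> holds E' e by apply: fl.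
case: (pselect (holds E fe0)) => e0; first by apply: (fe0_total gE'); apply: fl.
set u := red u0; set v := red v0.
have uv : E u v.
  apply: (thT2 gE _ _ uv0); apply: (congS gE); exact: (E_red gE (basic1 gE)).
apply: (thT2 gE' (E_red gE' (basic1 gE') u0) (E_red gE' (basic1 gE') v0)).
have tu : two u := two_red u0; have tv : two v := two_red v0.
rewrite -/u -/v; move: (u) (v) uv tu tv => {u0 v0 uv0} {}u {}v uv tu tv.
have cl x := count_class gE x e0 uv tu tv.
case: (pselect (holds E fe1)) => e1.
  have e1' : holds E' fe1 by apply: fl.
  apply: (thT2 gE' (idem_keep gE' e1' u) (idem_keep gE' e1' v)).
  case: (pselect (holds E fe2)) => e2.
    apply: (commutative_perm gE') => //; first by apply: fl.
    rewrite /perm_eq; apply/allP => x _ /=; rewrite !count_keep.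
    by have := (cl x).1; rewrite -!count_mem_gt0; lia.
  have -> : keep (fun=> 1) u = keep (fun=> 1) v; last exact: (congR gE').
  have uq w : uniq (keep (fun=> 1) w).
    apply: count_mem_uniq => x; rewrite count_keep -count_mem_gt0 count_keep.
    by case: (count_mem x w) => [|[|?]].
  have me x : (x \in keep (fun=> 1) u) = (x \in keep (fun=> 1) v).
    by rewrite -!count_mem_gt0 !count_keep; have := (cl x).1; rewrite -!count_mem_gt0; lia.
  have pw : perm_eq (keep (fun=> 1) u) (keep (fun=> 1) v) by apply: uniq_perm.
  have L : linked E (keep (fun=> 1) u) (keep (fun=> 1) v).
    split=> //.
    - by apply: (thT2 gE _ _ uv); apply: (congS gE); apply: (idem_keep gE).
    - by move=> x; rewrite count_keep; lia.
    - by move=> x; rewrite count_keep; lia.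
  apply: eq_sorted_bef => //.
  have c1 w x : x \in keep (fun=> 1) w -> count_mem x (keep (fun=> 1) w) = 1.
    by rewrite -count_mem_gt0 count_keep; lia.
  apply: (@sub_in_sorted _ (mem (keep (fun=> 1) v))) (sorted_bef (uq v)); last by apply/allP.
  move=> c d cv dv; rewrite /bef -!pos_index ?me // => H.
  exact: (inverted_simple gE e2 (linkedC gE L) (c1 _ _ cv) (c1 _ _ dv) H).
have pe : perm_eq u v.
  by rewrite /perm_eq; apply/allP => x _ /=; have [_ ->] := cl x.
case: (pselect (holds E fe2)) => e2.
  by apply: (commutative_perm gE') => //; apply: fl.
have L : linked E u v by split.
case: (pselect (holds E fe3)) => e3.
  have e3' : holds E' fe3 by apply: fl.
  pose I (i j : item) := i.1 != j.1 /\ (count_mem i.1 u = 2 \/ count_mem j.1 u = 2).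
  apply: (@trace_words E' gE' u v I tu tv pe).
  - by move=> i j [ij cij]; split; [rewrite eq_sym | tauto].
  - by move=> x b y c [].
  - move=> x b y c xu yu Hu Hv.
    case: (ann_count tu xu) => [[cx b0]|cx]; case: (ann_count tu yu) => [[cy c0]|cy].
    + subst b c; have := inverted_simple gE e2 L cx cy Hu; lia.
    + by split; [neqs | right].
    + by split; [neqs | left].
    + split; [|by left]; apply/eqP => /= xy; subst y.
      have := pos_fs cx; have := pos_fs (etrans (linked_count x L) cx).
      by case: b c Hu Hv {xu yu} => -[]; lia.
  - move=> w P x y Q pw _ wE [xy c2].
    have cw d : count_mem d (P ++ x :: y :: Q) = count_mem d u.
      by rewrite -wE; move/seq.permP: pw => ->.
    rewrite wE; case: c2 => c2; first by apply: (fe3_swap gE'); rewrite // cw c2.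
    apply: (congS gE'); apply: (fe3_swap gE') => //.
    by move: (cw y); rewrite c2; cnt; lia.
have nsep x y : count_mem x u = 2 -> count_mem y u = 2 -> x != y ->
    pos u x false < pos u y false -> pos v y false < pos v x false -> holds E fa1.
  by move=> cx cy xy Hu Hv; exact: (inverted_first gE L cx cy Hu Hv).
case: (pselect (holds E fe4)) => e4.
  have e4' : holds E' fe4 by apply: fl.
  (* Second occurrences commute with other letters; two first occurrences of repeated letters need
     [fa1]; pairs involving a simple letter and a first occurrence are rigid. *)
  pose I (i j : item) := i.1 != j.1 /\
    [\/ i.2 /\ count_mem i.1 u = 2, j.2 /\ count_mem j.1 u = 2 |
        [/\ count_mem i.1 u = 2, count_mem j.1 u = 2 & holds E fa1]].
  apply: (@trace_words E' gE' u v I tu tv pe).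
  - move=> i j [ij cij]; split; first by rewrite eq_sym.
    by case: cij => [H|H|[H1 H2 H3]]; [apply: Or32 | apply: Or31 | apply: Or33].
  - by move=> x b y c [].
  - move=> x b y c xu yu Hu Hv.
    have xy : x != y.
      apply/eqP => /= xy; subst y; case: (ann_count tu xu) => [[cx b0]|cx].
        subst b; case: (ann_count tu yu) => [[_ c0]|]; last by rewrite cx.
        by subst c; rewrite ltnn in Hu.
      have := pos_fs cx; have := pos_fs (etrans (linked_count x L) cx).
      by case: b c Hu Hv {xu yu} => -[]; lia.
    split=> //=; case: (ann_count tu xu) => [[cx b0]|cx]; case: (ann_count tu yu) => [[cy c0]|cy].
    + by subst b c; have := inverted_simple gE e2 L cx cy Hu; lia.
    + case: c yu Hu Hv => yu Hu Hv; first by apply: Or32.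
      subst b; case: (@inverted_first_simple E gE v u y x e3 (linkedC gE L)) => //;
      by rewrite (linked_count _ L).
    + case: b xu Hu Hv => xu Hu Hv; first by apply: Or31.
      by subst c; case: (@inverted_first_simple E gE u v x y e3 L).
    + case: b xu Hu Hv => xu Hu Hv; first by apply: Or31.
      case: c yu Hu Hv => yu Hu Hv; first by apply: Or32.
      by apply: Or33; split=> //; apply: nsep Hu Hv.
  - move=> w P x y Q pw _ wE [/= xy c2].
    have cw d : count_mem d (P ++ x :: y :: Q) = count_mem d u.
      by rewrite -wE; move/seq.permP: pw => ->.
    rewrite wE; case: c2 => [[xP c2]|[yP c2]|[cx cy a1]].
    + exact: (fe4_swap gE').
    + by apply: (congS gE'); apply: (fe4_swap gE').
    have [xP|xP] := boolP (x \in P); first exact: (fe4_swap gE').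
    have [yP|yP] := boolP (y \in P); first by apply: (congS gE'); apply: (fe4_swap gE').
    apply: (fe4_swap_first gE') => //; first by apply: fl.
      move: xP; rewrite -!count_mem_gt0; move: (cw x); rewrite cx; cnt.
      by rewrite eqxx (eq_sym y) (negbTE xy); lia.
    move: yP; rewrite -!count_mem_gt0; move: (cw y); rewrite cy; cnt.
    by rewrite eqxx (negbTE xy); lia.
apply: (linked_complete gE (Gtheory_fw gE) e2 e3 e4 gE' _ L).
  by move=> e ef; apply: fl; move: e ef; apply/allP.
by apply: Gtheory_runs => // e ef; apply: fl; move: e ef; apply/allP.
Qed.

(** * The theory of a language of words with prescribed truncation *)

(** The syntactic fully invariant congruence: the largest theory whose classes do not cross the
    boundary of the language [A]. *)
Definition syn (A : word -> Prop) (a b : word) : Prop :=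
  forall f p q, A (p ++ subst f a ++ q) <-> A (p ++ subst f b ++ q).

Lemma syn_theory A : theory (syn A).
Proof.
split; first split.
- by [].
- by move=> u v uv f p q; rewrite uv.
- by move=> v u w uv vw f p q; rewrite uv vw.
- move=> a b c d ab cd f p q; rewrite !subst_cat -!catA ab.
  by rewrite !(catA p) cd.
- by move=> g u v uv f p q; rewrite !subst_comp; apply: uv.
Qed.

(* The condition on [M] records letters that are truncated to one occurrence
   but must occur at least twice. *)
Definition target (k : nat -> nat) (M W w : word) : Prop :=
  keep k w = W /\ forall c, c \in M -> 2 <= count_mem c w.

(** Together, [count_mem t W = 1] and [k t = 2] force [t] to be simple in every word that truncates
    to [W]. *)
Definition squarefree (k : nat -> nat) (W : word) : Prop :=
  forall a W1 W2 W3, W = W1 ++ a :: W2 ++ a :: W3 ->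
  exists2 t, t \in W2 & count_mem t W = 1 /\ k t = 2.

Lemma keep_del k p v r : (forall x, x \in v -> k x <= count_mem x p) ->
  keep k (p ++ v ++ r) = keep k (p ++ r).
Proof.
move=> H; rewrite !keep_cat; congr cat.
rewrite keep0 /= => [|x /H]; last by rewrite -subn_eq0 => /eqP.
apply: eq_in_keep => x _; have [/H|/count_memPn ->] := boolP (x \in v); last by rewrite subn0.
by rewrite -subn_eq0 => /eqP ->.
Qed.

Lemma mem_keep k w x : x \in keep k w -> x \in w.
Proof. by rewrite -!count_mem_gt0 count_keep; lia. Qed.

Lemma keep_square k A a B R : k a = 2 -> a \notin A -> a \notin B ->
  exists W1 W2 W3, keep k (A ++ a :: B ++ a :: R) = W1 ++ a :: W2 ++ a :: W3 /\
    {subset W2 <= B}.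
Proof.
move=> ka aA aB; rewrite keep_cat /= ka (count_memPn aA) subn0 /= keep_cat /=.
rewrite eqxx ka (count_memPn aA) (count_memPn aB) /=.
by do 3!eexists; split; first reflexivity; move=> t /mem_keep.
Qed.

Section Target.
Variables (k : nat -> nat) (M W : word).
Hypothesis k2 : forall x, k x <= 2.
Hypothesis sqf : squarefree k W.

Lemma square_free_keep A a B R : keep k (A ++ a :: B ++ a :: R) = W ->
  k a = 2 -> a \notin A -> a \notin B ->
  (forall t, t \in B -> 2 <= count_mem t (A ++ a :: B ++ a :: R)) -> False.
Proof.
move=> kW ka aA aB H; have [W1 [W2 [W3 [E sub]]]] := keep_square R ka aA aB.
rewrite kW in E; have [t tW [c1 kt]] := sqf E.
have := H t (sub t tW).
by move: c1; rewrite -kW count_keep kt; lia.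
Qed.

(** An unsaturated letter of [X] would occur for the first time in [X] and recur in [B] with only
    repeated letters in between, against [squarefree]. *)
Lemma saturated p X B r : keep k (p ++ X ++ B ++ r) = W -> {subset X <= B} ->
  (forall a, a \in X ++ B -> 2 <= count_mem a (p ++ X ++ B ++ r)) ->
  forall a, a \in X -> k a <= count_mem a (p ++ X).
Proof.
move=> kW XB H a aX; rewrite leqNgt; apply/negP => lt.
have ka : k a = 2.
  by have := k2 a; move: lt aX; rewrite -count_mem_gt0; cnt; lia.
have [X1 [X2 XE]] : exists X1 X2, X = X1 ++ a :: X2.
  by case/splitPr: aX => X1 X2; exists X1, X2.
have [B1 [B2 [BE aB1]]] := first_split (XB a aX).
have ww : p ++ X ++ B ++ r = (p ++ X1) ++ a :: (X2 ++ B1) ++ a :: (B2 ++ r).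
  by rewrite XE BE; lcat.
rewrite ka XE in lt.
apply: (@square_free_keep (p ++ X1) a (X2 ++ B1) (B2 ++ r)) => //.
- by rewrite -ww.
- by rewrite -count_mem_gt0; move: lt; cnt; rewrite eqxx; lia.
- by move: aB1; rewrite -!count_mem_gt0; move: lt; cnt; rewrite eqxx; lia.
- move=> t tB; rewrite -ww; apply: H; move: tB.
  by rewrite XE BE !(mem_cat, inE) => /orP [->|->]; rewrite !orbT.
Qed.

Lemma target_id1 : syn (target k M W) id1.1 id1.2.
Proof.
move=> f p q; rewrite /id1 /= !subst_cons /=.
set X := f lx; set Y := f ly; set Z := f lz.
have kE : keep k (p ++ (X ++ Y ++ X ++ Z ++ X ++ [::]) ++ q) =
          keep k (p ++ (X ++ Y ++ X ++ Z ++ [::]) ++ q).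
  have := @keep_del k (p ++ X ++ Y ++ X ++ Z) X q; lcat; apply=> x.
  by rewrite -count_mem_gt0; have := k2 x; cnt; lia.
rewrite /target kE; split=> -[-> H]; split=> // c /H; cnt; first by lia.
by lia.
Qed.

(** After one X its letters are saturated on either side, so the second X is invisible to the
    truncation wherever it stands. *)
Lemma target_id2 : syn (target k M W) id2.1 id2.2.
Proof.
move=> f p q; rewrite /id2 /= !subst_cons /=.
set X := f lx; set Y := f (lxi 1); set Z := f (lxi 0).
have E1 : keep k (p ++ X ++ Y ++ X ++ Z ++ Y ++ q) = W ->
    forall a, a \in X -> k a <= count_mem a (p ++ X).
  move=> kW; apply: (@saturated p X (Y ++ X) (Z ++ Y ++ q)); rewrite -?catA //.
    by move=> a aX; rewrite mem_cat aX orbT.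
  by move=> a; rewrite -count_mem_gt0; cnt; lia.
have E2 : keep k (p ++ X ++ X ++ Y ++ Z ++ Y ++ q) = W ->
    forall a, a \in X -> k a <= count_mem a (p ++ X).
  move=> kW; apply: (@saturated p X X (Y ++ Z ++ Y ++ q)) => //.
  by move=> a; rewrite -count_mem_gt0; cnt; lia.
have kE : (forall a, a \in X -> k a <= count_mem a (p ++ X)) ->
    keep k (p ++ X ++ Y ++ X ++ Z ++ Y ++ q) = keep k (p ++ X ++ X ++ Y ++ Z ++ Y ++ q).
  move=> H; transitivity (keep k (p ++ X ++ Y ++ Z ++ Y ++ q)).
    have := @keep_del k (p ++ X ++ Y) X (Z ++ Y ++ q); lcat; apply=> a /H.
    by cnt; lia.
  by have := @keep_del k (p ++ X) X (Y ++ Z ++ Y ++ q); lcat => ->.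
have cE c : count_mem c (p ++ X ++ Y ++ X ++ Z ++ Y ++ q) =
            count_mem c (p ++ X ++ X ++ Y ++ Z ++ Y ++ q) by cnt; lia.
rewrite -!catA /= /target; split=> -[kW H]; split.
- by rewrite -kE //; apply: E1.
- by move=> c /H; rewrite cE.
- by rewrite kE //; apply: E2.
- by move=> c /H; rewrite -cE.
Qed.

End Target.

(* The [i]-th occurrence of [a] in [W] comes before the [j]-th one of [b]. *)
Definition prec (W : word) (a i b j : nat) : Prop :=
  forall W1 W2, W = W1 ++ W2 -> j <= count_mem b W1 -> i <= count_mem a W1.

Lemma prec_keep k W w A B a i b j : keep k w = W -> w = A ++ B -> prec W a i b j ->
  j <= k b -> j <= count_mem b A -> i <= count_mem a A.
Proof.
move=> kW wE pr jk jA; rewrite wE keep_cat in kW.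
have := pr _ _ (esym kW); rewrite !count_keep; lia.
Qed.

(** The exchange shows only through letters of X and Y that both still count; having occurred in
    [w0], they must be there for the second time. *)
Lemma keep_swap k w0 (X Y T : word) : (forall x, k x <= 2) ->
  {subset X <= w0} -> {subset Y <= w0} ->
  (forall a b, a \in X -> b \in Y -> count_mem a w0 = 1 -> k a = 2 ->
     count_mem b w0 = 1 -> k b = 2 -> False) ->
  keep k (w0 ++ X ++ Y ++ T) = keep k (w0 ++ Y ++ X ++ T).
Proof.
move=> k2 Xw Yw H.
have del V U R : (forall c, c \in V -> k c <= count_mem c w0) ->
    keep k (w0 ++ V ++ U ++ R) = keep k (w0 ++ U ++ R) /\
    keep k (w0 ++ U ++ V ++ R) = keep k (w0 ++ U ++ R).
  move=> HV; split; first exact: keep_del.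
  by have := @keep_del k (w0 ++ U) V R; rewrite -!catA; apply=> c /HV; cnt; lia.
case: (pselect (exists2 a, a \in X & count_mem a w0 < k a)) => [[a aX lta]|nX]; last first.
  have [|-> ->//] := del X Y T; move=> a aX; rewrite leqNgt; apply/negP => lt.
  by apply: nX; exists a.
have [|-> ->//] := del Y X T; move=> b bY; rewrite leqNgt; apply/negP => ltb.
have := Xw a aX; have := Yw b bY; rewrite -!count_mem_gt0 => cb ca.
have := k2 a; have := k2 b => kb ka.
by apply: (H a b aX bY); lia.
Qed.

(** * A language that satisfies the identities of G and violates [fsg] *)

Definition k0 (a : nat) : nat := if a == 5 then 1 else 2.
(** The left side xzytxyccz of [fsg] with c counted once: written twice, c would be a square in
    [W0], against [squarefree]. *)
Definition W0 : word := [:: 0; 2; 1; 3; 0; 1; 5; 2].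

Lemma prec_compute (W : word) (a i b j : nat) :
  all (fun n => (j <= count_mem b (take n W)) ==> (i <= count_mem a (take n W)))
      (iota 0 (size W).+1) -> prec W a i b j.
Proof.
move=> /allP H W1 W2 WE; have := H (size W1).
rewrite mem_iota WE size_cat ltnS /= leq_addr => /(_ isT).
by rewrite take_size_cat // => /implyP.
Qed.

Section Common.
Variables w w0 : word.
Hypothesis kw : keep k0 w = W0.

Lemma in_W0 c : 2 <= count_mem c w -> k0 c = 2 -> [\/ c = 0, c = 1 | c = 2].
Proof.
move=> c2 kc; have : count_mem c W0 = 2 by rewrite -kw count_keep kc; lia.
have [cW|/count_memPn -> //] := boolP (c \in W0).
move: cW; rewrite !inE; do ![case/orP]; move=> /eqP ->;
  first [by move=> _; apply: Or31 | by move=> _; apply: Or32 | by move=> _; apply: Or33 | by []].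
Qed.

(** In [W0] the letter c precedes the second z. As [A] brings no new letter, c already lies in [w0],
    and so do the second y and the second x, which precede c. *)
Lemma z2_y2 A B : w = w0 ++ A ++ B -> {subset A <= w0} -> 2 <= count_mem 2 (w0 ++ A) ->
  2 <= count_mem 1 w0 /\ 2 <= count_mem 0 w0.
Proof.
move=> wE Aw z2.
have wE' : w = (w0 ++ A) ++ B by rewrite -catA.
have c1 : 1 <= count_mem 5 (w0 ++ A).
  by apply: (prec_keep kw wE' (b := 2) (j := 2)) => //; apply: prec_compute.
have c1' : 1 <= count_mem 5 w0.
  rewrite count_mem_gt0; move: c1; rewrite count_mem_gt0 mem_cat => /orP [//|]; exact: Aw.
have y2 : 2 <= count_mem 1 w0.
  by apply: (prec_keep kw wE (b := 5) (j := 1)) => //; apply: prec_compute.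
split=> //.
by apply: (prec_keep kw wE (b := 1) (j := 2)) => //; apply: prec_compute.
Qed.

End Common.

Section SwapW0.
Variables (P X Z Y Q T1 T2 : word).
Let w0 := P ++ X ++ Z ++ Y ++ Q.
Hypothesis T1w : {subset T1 <= w0}.
Hypothesis ZT1 : {subset Z <= T1}.
Variables (a b : nat).
Hypotheses (aX : a \in X) (bY : b \in Y).
Hypotheses (ca : count_mem a w0 = 1) (ka : k0 a = 2).
Hypotheses (cb : count_mem b w0 = 1) (kb : k0 b = 2).

Lemma Xw0 : {subset X <= w0}.
Proof. by move=> c cX; rewrite !mem_cat cX !orbT. Qed.
Lemma Yw0 : {subset Y <= w0}.
Proof. by move=> c cX; rewrite !mem_cat cX !orbT. Qed.

Lemma aY : a \notin Y.
Proof. by move: aX ca; rewrite -!count_mem_gt0 /w0; cnt; lia. Qed.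
Lemma bX : b \notin X.
Proof. by move: bY cb; rewrite -!count_mem_gt0 /w0; cnt; lia. Qed.

(** The letters recurring in X and Y can only be x and y, and then z starts in [Z]. Since [T1]
    contains the letters of [Z] and no new ones, [z2_y2] places the second y already in [w0]. *)
Lemma no_swap_xy : keep k0 (w0 ++ X ++ Y ++ T1 ++ T2) = W0 -> False.
Proof.
move=> kw; set w := w0 ++ _ in kw.
have aX' := aX; have bY' := bY; rewrite -count_mem_gt0 in aX'; rewrite -count_mem_gt0 in bY'.
have a2 : 2 <= count_mem a (w0 ++ X) by rewrite count_cat ca; lia.
have b2 : 2 <= count_mem b (w0 ++ X ++ Y) by rewrite count_cat cb count_cat; lia.
have b1 : count_mem b (w0 ++ X) = 1 by rewrite count_cat cb (count_memPn bX).
have wE1 : w = w0 ++ X ++ (Y ++ T1 ++ T2) by [].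
have wE2 : w = w0 ++ (X ++ Y) ++ (T1 ++ T2) by rewrite /w; lcat.
have wE3 : w = w0 ++ (X ++ Y ++ T1) ++ T2 by rewrite /w; lcat.
have sXY : {subset X ++ Y <= w0}.
  by move=> c; rewrite mem_cat => /orP [/Xw0|/Yw0].
have sXYT : {subset X ++ Y ++ T1 <= w0}.
  by move=> c; rewrite catA mem_cat => /orP [/sXY|/T1w].
have aw : 2 <= count_mem a w by rewrite wE1 catA count_cat; lia.
have bw : 2 <= count_mem b w by rewrite wE2 catA count_cat; lia.
have noz : count_mem 2 (w0 ++ X ++ Y) < 2.
  rewrite ltnNge; apply/negP => z2.
  have [y2 x2] := z2_y2 kw wE2 sXY z2.
  case: (in_W0 kw aw ka) => ea; subst a; try lia.
  case: (in_W0 kw bw kb) => eb; subst b; try lia.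
have a01 : a = 0 \/ a = 1.
  case: (in_W0 kw aw ka) => ea; [by left | by right | subst a].
  by move: a2 noz; rewrite catA [count_mem _ (_ ++ Y)]count_cat; lia.
have b01 : b = 0 \/ b = 1.
  by case: (in_W0 kw bw kb) => eb; [left | right | subst b; lia].
have wE1' : w = (w0 ++ X) ++ (Y ++ T1 ++ T2) by rewrite -catA.
have ax : a = 0.
  case: a01 => // a1; subst a.
  have x2 : 2 <= count_mem 0 (w0 ++ X).
    by apply: (prec_keep kw wE1' (b := 1) (j := 2)) => //; apply: prec_compute.
  have : count_mem 1 (w0 ++ X) <> 1 by lia.
  by case: b01 => eb; subst b; lia.
have bx : b = 1.
  by case: b01 => // b0; move: a2; rewrite ax -b0 b1.
subst a b.
have pz := prec_keep kw (a := 2) (i := 1) (b := 1) (j := 1).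
have px := prec_keep kw (a := 0) (i := 1) (b := 2) (j := 1).
have zP : 2 \notin P.
  rewrite -count_mem_gt0; apply/negP => zP.
  have : 1 <= count_mem 0 P.
    by apply: (px P (X ++ Z ++ Y ++ Q ++ X ++ Y ++ T1 ++ T2)) => //;
      [rewrite /w /w0; lcat | apply: prec_compute].
  by move: ca aX'; rewrite /w0; cnt; lia.
have zX : 2 \notin X.
  apply/negP => zX; move: noz zX; rewrite -count_mem_gt0 /w0; cnt; lia.
have [Y1 [Y2 [YE yY1]]] := first_split bY.
have zY1 : 2 \notin Y1.
  apply/negP; rewrite -count_mem_gt0 => zY1.
  by move: noz zY1; rewrite YE /w0 YE; cnt; lia.
have zZ : 2 \in Z.
  have : 1 <= count_mem 2 (P ++ X ++ Z ++ Y1 ++ [:: 1]).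
    apply: (pz _ (Y2 ++ Q ++ X ++ Y ++ T1 ++ T2)) => //.
    - by rewrite /w /w0 YE; lcat.
    - exact: prec_compute.
    - by cnt; lia.
  rewrite count_mem_gt0 !mem_cat (negbTE zP) (negbTE zX) (negbTE zY1) /=.
  by rewrite orbF.
have [|y2 _] := z2_y2 kw wE3 sXYT; last by lia.
have := ZT1 zZ; have := zZ; rewrite -!count_mem_gt0 /w0; cnt; lia.
Qed.

(** Here y would recur in X and x in Y, so that y would start before x, unlike in [W0]. *)
Lemma no_swap_yx : keep k0 (w0 ++ Y ++ X ++ T1 ++ T2) = W0 -> False.
Proof.
move=> kw; set w := w0 ++ _ in kw.
have aX' := aX; have bY' := bY; rewrite -count_mem_gt0 in aX'; rewrite -count_mem_gt0 in bY'.
have b2 : 2 <= count_mem b (w0 ++ Y) by rewrite count_cat cb; lia.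
have a2 : 2 <= count_mem a (w0 ++ Y ++ X) by rewrite count_cat ca count_cat; lia.
have a1 : count_mem a (w0 ++ Y) = 1 by rewrite count_cat ca (count_memPn aY).
have wE1 : w = (w0 ++ Y) ++ (X ++ T1 ++ T2) by rewrite /w; lcat.
have wE2 : w = w0 ++ (Y ++ X) ++ (T1 ++ T2) by rewrite /w; lcat.
have sYX : {subset Y ++ X <= w0}.
  by move=> c; rewrite mem_cat => /orP [/Yw0|/Xw0].
have bw : 2 <= count_mem b w by rewrite wE1 count_cat; lia.
have aw : 2 <= count_mem a w by rewrite wE2 catA count_cat; lia.
have noz : count_mem 2 (w0 ++ Y ++ X) < 2.
  rewrite ltnNge; apply/negP => z2.
  have [y2 x2] := z2_y2 kw wE2 sYX z2.
  case: (in_W0 kw aw ka) => ea; subst a; try lia.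
  case: (in_W0 kw bw kb) => eb; subst b; try lia.
have b01 : b = 0 \/ b = 1.
  case: (in_W0 kw bw kb) => eb; [by left | by right | subst b].
  by move: b2 noz; rewrite catA [count_mem _ (_ ++ X)]count_cat; lia.
have a01 : a = 0 \/ a = 1.
  by case: (in_W0 kw aw ka) => eb; [left | right | subst a; lia].
have bx : b = 0.
  case: b01 => // b1; subst b.
  have x2 : 2 <= count_mem 0 (w0 ++ Y).
    by apply: (prec_keep kw wE1 (b := 1) (j := 2)) => //; apply: prec_compute.
  by case: a01 => ea; subst a; lia.
have ay : a = 1 by case: a01 => // a0; move: b2; rewrite bx -a0 a1.
subst a b.
have : 1 <= count_mem 0 (P ++ X).
  apply: (prec_keep kw (b := 1) (j := 1) (B := Z ++ Y ++ Q ++ Y ++ X ++ T1 ++ T2)) => //.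
  - by rewrite /w /w0; lcat.
  - exact: prec_compute.
  - by move: aX'; cnt; lia.
by move: cb bY'; rewrite /w0; cnt; lia.
Qed.

End SwapW0.

Lemma split_unique (t : nat) U V U' V' : U ++ t :: V = U' ++ t :: V' ->
  t \notin U -> t \notin U' -> U = U' /\ V = V'.
Proof.
elim: U U' => [|a U IH] [|b U'] //=.
- by case=> ->.
- by case=> <- _ _; rewrite mem_head.
- by case=> <- _; rewrite mem_head.
case=> <- e; rewrite !inE !negb_or => /andP [_ nU] /andP [_ nU'].
by have [-> ->] := IH _ e nU nU'.
Qed.

(** Neither half repeats a letter, so two occurrences of a letter lie in different halves and
    enclose [t]. *)
Lemma squarefree_halves k t U V : uniq U -> uniq V -> t \notin U -> t \notin V -> k t = 2 ->
  squarefree k (U ++ t :: V).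
Proof.
move=> uU uV tU tV kt a W1 W2 W3 WE; exists t; last first.
  by rewrite count_cat /= eqxx (count_memPn tU) (count_memPn tV).
have ct : count_mem t (U ++ t :: V) = 1.
  by rewrite count_cat /= eqxx (count_memPn tU) (count_memPn tV).
have notin s1 s2 : W1 ++ a :: W2 ++ a :: W3 = s1 ++ t :: s2 -> t \notin s1.
  by move=> e; rewrite -count_mem_gt0; move: ct; rewrite WE e; cnt; rewrite eqxx; lia.
have at_ : a != t by apply/eqP => e; move: ct; rewrite WE e; cnt; rewrite eqxx; lia.
have : t \in W1 ++ a :: W2 ++ a :: W3 by rewrite -WE mem_cat mem_head orbT.
rewrite !(mem_cat, inE) (eq_sym t) (negbTE at_) /= => /or3P [tW|//|tW].
  case/splitPr: tW WE notin => s1 s2; rewrite -catA /= => WE /(_ _ _ erefl) n1.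
  have [_ VE] := split_unique WE tU n1.
  by move: uV; rewrite VE cat_uniq /= mem_cat mem_head orbT !andbF.
case/splitPr: tW WE notin => s1 s2 WE notin.
have e : W1 ++ a :: W2 ++ a :: s1 ++ t :: s2 = (W1 ++ a :: W2 ++ a :: s1) ++ t :: s2 by lcat.
have [UE _] := split_unique (etrans WE e) tU (notin _ _ e).
by move: uU; rewrite UE cat_uniq /= mem_cat mem_head orbT !andbF.
Qed.

Lemma mem_subst f c u : c \in subst f u <-> exists2 a, a \in u & c \in f a.
Proof. by split=> [/flatten_mapP|H]; last apply/flatten_mapP. Qed.

Lemma sub_subst f u v : {subset u <= v} -> {subset subst f u <= subst f v}.
Proof. by move=> uv c /mem_subst [a /uv av ca]; apply/mem_subst; exists a. Qed.

Section Shape.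
Variables (n : nat) (p q : 'S_(2 * n)).

Definition wA := \big[cat/[::]]_(1 <= i < n.+1) [:: lxi i; lti i].
Definition wB := \big[cat/[::]]_(1 <= i < (2 * n).+1) [:: lzi i].
Definition wC := \big[cat/[::]]_(n.+1 <= i < (2 * n).+1) [:: lti i; lxi i].
Definition wD := \big[cat/[::]]_(i < 2 * n) [:: lxi (p i).+1; lzi (q i).+1].

Lemma wD_sub : {subset wD <= wA ++ wB ++ wC}.
Proof.
move=> c; rewrite /wD bigcat_flatten => /flatten_mapP [i _].
rewrite !inE => /orP [] /eqP ->; rewrite !mem_cat.
  have [pn|pn] := ltnP (p i) n.
    apply/orP; left; rewrite /wA bigcat_flatten; apply/flatten_mapP; exists (p i).+1.
      by rewrite mem_index_iota.
    by rewrite mem_head.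
  apply/orP; right; apply/orP; right; rewrite /wC bigcat_flatten; apply/flatten_mapP.
  exists (p i).+1; last by rewrite !inE eqxx orbT.
  by rewrite mem_index_iota !ltnS pn /=.
apply/orP; right; apply/orP; left; rewrite /wB bigcat_flatten; apply/flatten_mapP.
by exists (q i).+1; rewrite ?mem_index_iota ?mem_head //= ltnS.
Qed.

Lemma wB_sub : {subset wB <= wD}.
Proof.
move=> c; rewrite /wB bigcat_flatten => /flatten_mapP [j].
rewrite mem_index_iota => /andP [j1 j2]; rewrite inE => /eqP ->.
have jn : j.-1 < 2 * n by lia.
rewrite /wD bigcat_flatten; apply/flatten_mapP; exists ((q^-1)%g (Ordinal jn)).
  exact: mem_index_enum.
by rewrite permKV /= prednK // !inE eqxx orbT.
Qed.

End Shape.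

Lemma W0_squarefree : squarefree k0 W0.
Proof. exact: (@squarefree_halves k0 3 [:: 0; 2; 1] [:: 0; 1; 5; 2]). Qed.

Lemma W0_Gtheory : Gtheory (syn (target k0 [:: 5] W0)).
Proof.
have k02 x : k0 x <= 2 by rewrite /k0; case: ifP.
split; first split.
- exact: syn_theory.
- exact: target_id1.
- exact: target_id2 W0_squarefree.
move=> n p q n1 f p' q'.
set P := p' ++ subst f (wA n); set Z := subst f (wB n); set X := f lx; set Y := f ly.
set Q := subst f (wC n) ++ f lt; set T1 := subst f (wD p q).
have -> : p' ++ subst f (w_word p q) ++ q' = (P ++ X ++ Z ++ Y ++ Q) ++ X ++ Y ++ T1 ++ q'.
  rewrite /w_word -/(wA n) -/(wB n) -/(wC n) -/(wD p q) !subst_cat /=.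
  by rewrite /subst /= /P /Q /X /Y /Z /T1; lcat.
have -> : p' ++ subst f (w'_word p q) ++ q' = (P ++ X ++ Z ++ Y ++ Q) ++ Y ++ X ++ T1 ++ q'.
  rewrite /w'_word -/(wA n) -/(wB n) -/(wC n) -/(wD p q) !subst_cat /=.
  by rewrite /subst /= /P /Q /X /Y /Z /T1; lcat.
have T1w : {subset T1 <= P ++ X ++ Z ++ Y ++ Q}.
  move=> c /(sub_subst (@wD_sub n p q)); rewrite !subst_cat !mem_cat.
  by case/or3P=> ->; rewrite ?orbT.
have ZT : {subset Z <= T1} := sub_subst (@wB_sub n p q).
have cE c : count_mem c ((P ++ X ++ Z ++ Y ++ Q) ++ X ++ Y ++ T1 ++ q') =
            count_mem c ((P ++ X ++ Z ++ Y ++ Q) ++ Y ++ X ++ T1 ++ q') by cnt; lia.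
have kE : (keep k0 ((P ++ X ++ Z ++ Y ++ Q) ++ X ++ Y ++ T1 ++ q') = W0 \/
           keep k0 ((P ++ X ++ Z ++ Y ++ Q) ++ Y ++ X ++ T1 ++ q') = W0) ->
   keep k0 ((P ++ X ++ Z ++ Y ++ Q) ++ X ++ Y ++ T1 ++ q') =
   keep k0 ((P ++ X ++ Z ++ Y ++ Q) ++ Y ++ X ++ T1 ++ q').
  move=> H; apply: keep_swap => //; [exact: Xw0 | exact: Yw0 |].
  move=> a b aX bY ca ka cb kb; case: H => H.
    exact: (no_swap_xy T1w ZT aX bY ca ka cb kb H).
  exact: (no_swap_yx aX bY ca ka cb kb H).
split=> -[kW cM]; split.
- by rewrite -kE; [|left].
- by move=> c /cM; rewrite cE.
- by rewrite kE; [|right].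
- by move=> c /cM; rewrite -cE.
Qed.

Lemma W0_fsg : ~ holds (syn (target k0 [:: 5] W0)) fsg.
Proof.
move=> /(_ (fun a => [:: a]) [::] [::]); rewrite !subst_id !cats0 /= => -[H _].
by have [] : target k0 [:: 5] W0 [:: 0; 2; 1; 3; 1; 0; 5; 5; 2]
  by apply: H; split=> // c; rewrite inE => /eqP ->.
Qed.

(** * The word [w_n] for the identity permutations *)

#[local] Arguments lxi : simpl never.
#[local] Arguments lzi : simpl never.
#[local] Arguments lti : simpl never.

(** Segments are given by start and length, so that they can be cut at any index. *)
Definition sA (s b : nat) : word := flatten [seq [:: lxi i; lti i] | i <- iota s b].
Definition sZ (s b : nat) : word := [seq lzi i | i <- iota s b].
Definition sB (s b : nat) : word := flatten [seq [:: lti i; lxi i] | i <- iota s b].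
Definition sC (s b : nat) : word := flatten [seq [:: lxi i; lzi i] | i <- iota s b].

Definition Wn (n : nat) : word :=
  sA 1 n ++ 0 :: sZ 1 (2 * n) ++ 1 :: sB n.+1 n ++ [:: 3; 0; 1] ++ sC 1 (2 * n).

Lemma w_word1 n : w_word (1%g : 'S_(2 * n)) 1%g = Wn n.
Proof.
rewrite /w_word /Wn /sA /sB /sC /sZ !bigcat_flatten /index_iota !subn1 /=.
congr (_ ++ _ :: _ ++ _ :: _ ++ _ :: _ :: _ :: _).
- by elim: (iota _ _) => //= a r ->.
- by rewrite subSS mul2n -addnn addnK.
- rewrite -bigcat_flatten.
  transitivity (\big[cat/[::]]_(0 <= i < 2 * n) [:: lxi i.+1; lzi i.+1]).
    by rewrite big_mkord; apply: eq_bigr => i _; rewrite !perm1.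
  by rewrite bigcat_flatten /index_iota subn0 -[1]addn0 iotaDl -map_comp.
Qed.

Lemma lxi_eq i j : (lxi i == lxi j) = (i == j). Proof. by rewrite /lxi; lia. Qed.
Lemma lzi_eq i j : (lzi i == lzi j) = (i == j). Proof. by rewrite /lzi; lia. Qed.
Lemma lti_eq i j : (lti i == lti j) = (i == j). Proof. by rewrite /lti; lia. Qed.
Lemma lxz_eq i j : ((lxi i == lzi j) = false) * ((lzi j == lxi i) = false).
Proof. by rewrite /lxi /lzi; split; lia. Qed.
Lemma lxt_eq i j : ((lxi i == lti j) = false) * ((lti j == lxi i) = false).
Proof. by rewrite /lxi /lti; split; lia. Qed.
Lemma lzt_eq i j : ((lzi i == lti j) = false) * ((lti j == lzi i) = false).
Proof. by rewrite /lzi /lti; split; lia. Qed.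
Lemma small_eq i a : a < 4 -> ((lxi i == a) = false) * ((lzi i == a) = false) * ((lti i == a) = false) *
  ((a == lxi i) = false) * ((a == lzi i) = false) * ((a == lti i) = false).
Proof. by move=> a4; rewrite /lxi /lzi /lti; do !split; lia. Qed.

Definition letter_eqs := (lxi_eq, lzi_eq, lti_eq, lxz_eq, lxt_eq, lzt_eq,
  fun i => @small_eq i 0 isT, fun i => @small_eq i 1 isT, fun i => @small_eq i 3 isT).

Lemma count_seg (F : nat -> word) c j s b :
  (forall i, count_mem c (F i) = (i == j)) ->
  count_mem c (flatten (map F (iota s b))) = (s <= j < s + b).
Proof.
move=> H; elim: b s => [|b IH] s /=; first by lia.
by rewrite count_cat H IH; lia.
Qed.

Lemma count_seg0 (F : nat -> word) c s b : (forall i, count_mem c (F i) = 0) ->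
  count_mem c (flatten (map F (iota s b))) = 0.
Proof. by move=> H; elim: b s => [|b IH] s //=; rewrite count_cat H IH. Qed.

Lemma sZ_flatten s b : sZ s b = flatten (map (fun i => [:: lzi i]) (iota s b)).
Proof. by rewrite /sZ; elim: (iota s b) => //= a r ->. Qed.

Ltac seg := move=> *; rewrite ?sZ_flatten /sA /sB /sC;
  first [apply: count_seg => i | apply: count_seg0 => i]; rewrite /= ?letter_eqs; lia.

Lemma sA_counts s b : (forall j, count_mem (lxi j) (sA s b) = (s <= j < s + b)) *
  (forall j, count_mem (lti j) (sA s b) = (s <= j < s + b)) *
  (forall j, count_mem (lzi j) (sA s b) = 0) * (count_mem 0 (sA s b) = 0) *
  (count_mem 1 (sA s b) = 0) * (count_mem 3 (sA s b) = 0).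
Proof. by do !split; seg. Qed.
Lemma sB_counts s b : (forall j, count_mem (lxi j) (sB s b) = (s <= j < s + b)) *
  (forall j, count_mem (lti j) (sB s b) = (s <= j < s + b)) *
  (forall j, count_mem (lzi j) (sB s b) = 0) * (count_mem 0 (sB s b) = 0) *
  (count_mem 1 (sB s b) = 0) * (count_mem 3 (sB s b) = 0).
Proof. by do !split; seg. Qed.
Lemma sZ_counts s b : (forall j, count_mem (lzi j) (sZ s b) = (s <= j < s + b)) *
  (forall j, count_mem (lxi j) (sZ s b) = 0) * (forall j, count_mem (lti j) (sZ s b) = 0) *
  (count_mem 0 (sZ s b) = 0) * (count_mem 1 (sZ s b) = 0) * (count_mem 3 (sZ s b) = 0).
Proof. by do !split; seg. Qed.
Lemma sC_counts s b : (forall j, count_mem (lxi j) (sC s b) = (s <= j < s + b)) *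
  (forall j, count_mem (lzi j) (sC s b) = (s <= j < s + b)) *
  (forall j, count_mem (lti j) (sC s b) = 0) * (count_mem 0 (sC s b) = 0) *
  (count_mem 1 (sC s b) = 0) * (count_mem 3 (sC s b) = 0).
Proof. by do !split; seg. Qed.

Definition seg_counts := (sA_counts, sB_counts, sZ_counts, sC_counts).

Lemma sA_cat s b c : sA s (b + c) = sA s b ++ sA (s + b) c.
Proof. by rewrite /sA iotaD map_cat flatten_cat. Qed.
Lemma sB_cat s b c : sB s (b + c) = sB s b ++ sB (s + b) c.
Proof. by rewrite /sB iotaD map_cat flatten_cat. Qed.
Lemma sZ_cat s b c : sZ s (b + c) = sZ s b ++ sZ (s + b) c.
Proof. by rewrite /sZ iotaD map_cat. Qed.
Lemma sC_cat s b c : sC s (b + c) = sC s b ++ sC (s + b) c.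
Proof. by rewrite /sC iotaD map_cat flatten_cat. Qed.

(** A single cut between the two occurrences decides: shorter prefixes contain too few [b], longer
    ones enough [a]. *)
Lemma prec_split W W1 W2 a i b j : W = W1 ++ W2 -> i <= count_mem a W1 ->
  count_mem b W1 < j -> prec W a i b j.
Proof.
move=> WE ia jb V1 V2 VE jV.
have [le|/ltnW le] := leqP (size V1) (size W1).
  suff : count_mem b V1 <= count_mem b W1 by lia.
  have -> : V1 = take (size V1) W1.
    have := congr1 (take (size V1)) (etrans (esym VE) WE).
    by rewrite take_size_cat // take_cat; case: ltngtP le => // -> _; rewrite subnn take0 cats0 take_size.
  by rewrite -{2}(cat_take_drop (size V1) W1) count_cat leq_addr.
apply: (leq_trans ia).
have -> : W1 = take (size W1) V1.
  have := congr1 (take (size W1)) (etrans (esym WE) VE).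
  by rewrite take_size_cat // take_cat; case: ltngtP le => // -> _; rewrite subnn take0 cats0 take_size.
by rewrite -{2}(cat_take_drop (size W1) V1) count_cat leq_addr.
Qed.

Ltac pcnt := rewrite ?count_cat /= ?count_cat /= ?count_cat /= ?count_cat /=;
  rewrite ?seg_counts ?letter_eqs /=; lia.

Section WnFacts.
Variable n : nat.
Local Notation W := (Wn n).

Definition pX := sA 1 n ++ [:: 0].
Definition pZ := sA 1 n ++ 0 :: sZ 1 (2 * n).
Definition pY := pZ ++ [:: 1].
Definition pB := pZ ++ 1 :: sB n.+1 n.
Definition pTX := pB ++ [:: 3; 0].
Definition pTY := pB ++ [:: 3; 0; 1].

Lemma WnX : W = pX ++ sZ 1 (2 * n) ++ 1 :: sB n.+1 n ++ [:: 3; 0; 1] ++ sC 1 (2 * n).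
Proof. by rewrite /Wn /pX; lcat. Qed.
Lemma WnZ : W = pZ ++ 1 :: sB n.+1 n ++ [:: 3; 0; 1] ++ sC 1 (2 * n).
Proof. by rewrite /Wn /pZ; lcat. Qed.
Lemma WnY : W = pY ++ sB n.+1 n ++ [:: 3; 0; 1] ++ sC 1 (2 * n).
Proof. by rewrite /Wn /pY /pZ; lcat. Qed.
Lemma WnTX : W = pTX ++ [:: 1] ++ sC 1 (2 * n).
Proof. by rewrite /Wn /pTX /pB /pZ; lcat. Qed.
Lemma WnTY : W = pTY ++ sC 1 (2 * n).
Proof. by rewrite /Wn /pTY /pB /pZ; lcat. Qed.

Lemma WnC j : 0 < j <= 2 * n -> W = (pTY ++ sC 1 j.-1) ++ [:: lxi j; lzi j] ++ sC j.+1 (2 * n - j).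
Proof.
move=> jn; rewrite WnTY -catA; congr cat.
rewrite {1}(_ : 2 * n = j.-1 + (1 + (2 * n - j))); last by lia.
rewrite 2!sC_cat (_ : 1 + j.-1 = j); last by lia.
by rewrite addn1.
Qed.

Lemma y2_x2 : prec W 0 2 1 2.
Proof. by apply: (prec_split WnTX); rewrite /pTX /pB /pZ; pcnt. Qed.
Lemma y1_x1 : prec W 0 1 1 1.
Proof. by apply: (prec_split WnX); rewrite /pX; pcnt. Qed.
Lemma z1_x1 i : prec W 0 1 (lzi i) 1.
Proof. by apply: (prec_split WnX); rewrite /pX; pcnt. Qed.
Lemma y1_z1 i : 0 < i <= 2 * n -> prec W (lzi i) 1 1 1.
Proof. by move=> ?; apply: (prec_split WnZ); rewrite /pZ; pcnt. Qed.
Lemma z2_y2n i : prec W 1 2 (lzi i) 2.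
Proof. by apply: (prec_split WnTY); rewrite /pTY /pB /pZ; pcnt. Qed.
Lemma x2_y2 i : prec W 1 2 (lxi i) 2.
Proof. by apply: (prec_split WnTY); rewrite /pTY /pB /pZ; pcnt. Qed.
Lemma z2_xi2 i j : 0 < j <= 2 * n -> j <= i -> prec W (lxi j) 2 (lzi i) 2.
Proof.
move=> jn ji; apply: (prec_split (W1 := (pTY ++ sC 1 j.-1) ++ [:: lxi j])
  (W2 := lzi j :: sC j.+1 (2 * n - j))).
- by rewrite (WnC jn); lcat.
- by rewrite /pTY /pB /pZ; pcnt.
- by rewrite /pTY /pB /pZ; pcnt.
Qed.
Lemma xi2_z2 i j : 0 < i -> i < j <= 2 * n -> prec W (lzi i) 2 (lxi j) 2.
Proof.
move=> i0 ij; have jn : 0 < j <= 2 * n by lia.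
by apply: (prec_split (WnC jn)); rewrite /pTY /pB /pZ; pcnt.
Qed.
Lemma z1_xi1 i j : 0 < j <= n -> prec W (lxi j) 1 (lzi i) 1.
Proof. by move=> ?; apply: (prec_split WnX); rewrite /pX; pcnt. Qed.
Lemma xi1_y1 j : n < j -> prec W 1 1 (lxi j) 1.
Proof. by move=> ?; apply: (prec_split WnY); rewrite /pY /pZ; pcnt. Qed.
Lemma z1_z1 i j : 0 < i -> i < j <= 2 * n -> prec W (lzi i) 1 (lzi j) 1.
Proof.
move=> i0 ij; apply: (prec_split (W1 := sA 1 n ++ 0 :: sZ 1 i)
  (W2 := sZ i.+1 (2 * n - i) ++ 1 :: sB n.+1 n ++ [:: 3; 0; 1] ++ sC 1 (2 * n))).
- rewrite /Wn {1}(_ : 2 * n = i + (2 * n - i)); last by lia.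
  by rewrite sZ_cat; lcat.
- by pcnt.
- by pcnt.
Qed.

Lemma Wn_halves : W = pB ++ 3 :: [:: 0; 1] ++ sC 1 (2 * n).
Proof. by rewrite /Wn /pB /pZ; lcat. Qed.

Inductive Wletter (a : nat) : Prop :=
  | Wx of a = 0 | Wy of a = 1 | Wt of a = 3
  | Wxi j of 0 < j <= 2 * n & a = lxi j
  | Wzi j of 0 < j <= 2 * n & a = lzi j
  | Wti j of 0 < j <= 2 * n & a = lti j.

Lemma Wn_letter a : a \in W -> Wletter a.
Proof.
have mF (F : nat -> word) s b : a \in flatten (map F (iota s b)) ->
    exists2 i, s <= i < s + b & a \in F i.
  by case/flatten_mapP=> i; rewrite mem_iota => ? ?; exists i.
rewrite /Wn !(mem_cat, inE) /sA sZ_flatten /sB /sC.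
case/or3P=> [/mF [i ii]|/eqP ->|]; first by rewrite !inE => /orP [] /eqP ->;
  [apply: (@Wxi _ i) | apply: (@Wti _ i)] => //; lia.
  exact: Wx.
case/or3P=> [/mF [i ii]|/eqP ->|]; first by rewrite inE => /eqP ->; apply: (@Wzi _ i) => //; lia.
  exact: Wy.
case/orP=> [/mF [i ii]|]; first by rewrite !inE => /orP [] /eqP ->;
  [apply: (@Wti _ i) | apply: (@Wxi _ i)] => //; lia.
rewrite -!orbA; case/or4P=> [/eqP ->|/eqP ->|/eqP ->|/mF [i ii]];
  [exact: Wt | exact: Wx | exact: Wy |].
by rewrite !inE => /orP [] /eqP ->; [apply: (@Wxi _ i) | apply: (@Wzi _ i)] => //; lia.
Qed.

Lemma Wn_count2 a : count_mem a W <= 2.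
Proof.
have [/Wn_letter|/count_memPn -> //] := boolP (a \in W).
by case=> [->|->|->|j _ ->|j _ ->|j _ ->]; rewrite /Wn; pcnt.
Qed.

Lemma Wn_squarefree : squarefree (fun=> 2) W.
Proof.
have u1 (s : word) : (forall a, a \in s -> count_mem a s <= 1) -> uniq s.
  move=> H; apply: count_mem_uniq => a; case: (boolP (a \in s)) => [as_|/count_memPn //].
  by have := H a as_; move: as_; rewrite -count_mem_gt0; lia.
have sub1 a : a \in pB -> a \in W by move=> ap; rewrite Wn_halves mem_cat ap.
have sub2 a : a \in [:: 0; 1] ++ sC 1 (2 * n) -> a \in W.
  by move=> ap; rewrite Wn_halves mem_cat [a \in 3 :: _]inE ap !orbT.
rewrite Wn_halves; apply: squarefree_halves => //.
- apply: u1 => a /sub1 /Wn_letter.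
  by case=> [->|->|->|j _ ->|j _ ->|j _ ->]; rewrite /pB /pZ; pcnt.
- apply: u1 => a /sub2 /Wn_letter.
  by case=> [->|->|->|j _ ->|j _ ->|j _ ->]; pcnt.
- by rewrite -count_mem_gt0 /pB /pZ; pcnt.
- by rewrite -count_mem_gt0; pcnt.
Qed.

Definition in_middle (a : nat) : Prop :=
  [\/ a = 0, a = 1 | exists2 i, 0 < i <= 2 * n & a = lzi i].

(** The number of the block in which [a] starts; block [r] is closed by t_r, and the last one, 2n+1,
    by t. Each x_j is alone in its block, of number j if j is at most n and j+1 otherwise, since t_j
    then precedes x_j. Block n+1 holds x, y and all z_i. *)
Inductive in_block (a r : nat) : Prop :=
  | BlockL j of a = lxi j & 0 < j <= n & r = j
  | BlockM of in_middle a & r = n.+1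
  | BlockR j of a = lxi j & n < j <= 2 * n & r = j.+1.

Lemma before_ti a r r' : in_block a r' -> r' <= r <= 2 * n -> prec W a 1 (lti r) 1.
Proof.
move=> ar /andP [rr rn].
have [rl|rl] := leqP r n.
  have r0 : 0 < r by case: ar => [j _ jn|_|j _ jn] r'E; lia.
  apply: (prec_split (W1 := sA 1 r.-1 ++ [:: lxi r])
    (W2 := lti r :: sA r.+1 (n - r) ++ 0 :: sZ 1 (2 * n) ++ 1 :: sB n.+1 n ++
           [:: 3; 0; 1] ++ sC 1 (2 * n))).
  - rewrite /Wn {1}(_ : n = r.-1 + (1 + (n - r))); last by lia.
    rewrite 2!sA_cat (_ : 1 + r.-1 = r); last by lia.
    by rewrite addn1; lcat.
  - by case: ar => [j -> jn|_|j _ jn] r'E; [pcnt | lia | lia].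
  - by pcnt.
apply: (prec_split (W1 := pY ++ sB n.+1 (r - n.+1))
  (W2 := sB r (2 * n - r).+1 ++ [:: 3; 0; 1] ++ sC 1 (2 * n))).
- rewrite WnY (_ : sB n.+1 n = sB n.+1 ((r - n.+1) + (2 * n - r).+1)); last by congr sB; lia.
  rewrite sB_cat (_ : n.+1 + (r - n.+1) = r); last by lia.
  by lcat.
- rewrite /pY /pZ; case: ar => [j -> jn|[->|->|[i ii ->]]|j -> jn] r'E; by pcnt.
- by rewrite /pY /pZ; pcnt.
Qed.

Lemma ti_before b r r' : in_block b r' -> 0 < r < r' -> prec W (lti r) 1 b 1.
Proof.
move=> br rr.
have [rl|rl] := leqP r n.
  apply: (prec_split (W1 := sA 1 r)
    (W2 := sA r.+1 (n - r) ++ 0 :: sZ 1 (2 * n) ++ 1 :: sB n.+1 n ++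
           [:: 3; 0; 1] ++ sC 1 (2 * n))).
  - rewrite /Wn {1}(_ : n = r + (n - r)); last by lia.
    by rewrite sA_cat; lcat.
  - by pcnt.
  - by case: br => [j -> jn|[->|->|[i ii ->]]|j -> jn] r'E; pcnt.
have [j bE jn r'E] : exists2 j, b = lxi j & n < j <= 2 * n /\ r' = j.+1.
  by case: br => [j _ jn|_|j -> jn] r'E; [lia | lia | exists j].
apply: (prec_split (W1 := pY ++ sB n.+1 (r - n.+1) ++ [:: lti r])
  (W2 := lxi r :: sB r.+1 (2 * n - r) ++ [:: 3; 0; 1] ++ sC 1 (2 * n))).
- rewrite WnY (_ : sB n.+1 n = sB n.+1 ((r - n.+1) + (1 + (2 * n - r)))); last by congr sB; lia.
  rewrite 2!sB_cat (_ : n.+1 + (r - n.+1) = r); last by lia.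
  by rewrite addn1; lcat.
- by rewrite /pY /pZ; pcnt.
- by rewrite bE /pY /pZ; pcnt.
Qed.

Lemma xi_block j : 0 < j <= 2 * n -> exists r, in_block (lxi j) r.
Proof.
move=> jn; have [jl|jl] := leqP j n.
  by exists j; apply: (@BlockL _ _ j) => //; lia.
by exists j.+1; apply: (@BlockR _ _ j) => //; lia.
Qed.

Lemma in_block_uniq a b r : in_block a r -> in_block b r -> (exists j, a = lxi j) -> a = b.
Proof.
move=> ar br [j aE]; subst a.
case: ar => [i e ii rE|[e|e|[i _ e]] rE|i e ii rE]; move/eqP: e; rewrite ?letter_eqs // => /eqP e; subst i;
case: br => [i' -> ii' rE'|_ rE'|i' -> ii' rE']; try lia; by congr lxi; lia.
Qed.

Lemma blocks_separated a b r r' : in_block a r -> in_block b r' -> r < r' ->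
  exists2 t, count_mem t W = 1 & prec W a 1 t 1 /\ prec W t 1 b 1.
Proof.
move=> ar br rr.
have r0 : 0 < r by case: ar => [j _ jn|_|j _ jn] rE; lia.
have rn : r <= 2 * n by case: br => [j _ jn|_|j _ jn] rE; lia.
exists (lti r); first by rewrite /Wn; pcnt.
by split; [apply: before_ti ar _; rewrite leqnn | apply: ti_before br _; rewrite r0].
Qed.

End WnFacts.

(** * Exchangeable factors in substituted words that truncate to w_n *)

Lemma count_subst2 f v d c : 2 <= count_mem d v -> c \in f d -> 2 <= count_mem c (subst f v).
Proof.
move=> /count2_split [v1 [v2 [v3 ->]]]; rewrite -count_mem_gt0 => cd.
by move: cd; rewrite subst_cat subst_cons subst_cat subst_cons; cnt; lia.
Qed.

Section FreshPair.
Variables (n : nat) (Pp X Zz Y Qq V1 V2 Tt : word).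
Local Notation W := (Wn n).
Let w0 := Pp ++ X ++ Zz ++ Y ++ Qq.
Let w := w0 ++ V1 ++ V2 ++ Tt.
Hypothesis kw : keep (fun=> 2) w = W.
Hypothesis VXY : forall c, (c \in V1 ++ V2) = (c \in X ++ Y).
Hypothesis multi : forall c, c \in X ++ Zz ++ Y -> 2 <= count_mem c w.

Lemma Wcount c : count_mem c W = minn 2 (count_mem c w).
Proof. by rewrite -kw count_keep. Qed.

Lemma use_prec A B a i b j : w = A ++ B -> prec W a i b j -> j <= 2 ->
  j <= count_mem b A -> i <= count_mem a A.
Proof. by move=> wE pr j2; apply: (prec_keep kw wE pr). Qed.

Lemma XYw0 : {subset X ++ Y <= w0}.
Proof.
by move=> c; rewrite mem_cat => /orP [] cX; rewrite /w0 !mem_cat cX ?orbT.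
Qed.

Lemma fresh_letter c : c \in X ++ Y -> exists r, in_block n c r.
Proof.
move=> cXY; have c2 : 2 <= count_mem c w.
  by apply: multi; move: cXY; rewrite !mem_cat => /orP [] ->; rewrite ?orbT.
have cW : count_mem c W = 2 by rewrite Wcount; lia.
have : c \in W by rewrite -count_mem_gt0 cW.
case/Wn_letter=> [e|e|e|j jn e|j jn e|j jn e].
- by exists n.+1; apply: BlockM => //; apply: Or31.
- by exists n.+1; apply: BlockM => //; apply: Or32.
- by move: cW; rewrite e /Wn; pcnt.
- by rewrite e; apply: xi_block.
- by exists n.+1; apply: BlockM => //; apply: Or33; exists j.
- by move: cW; rewrite e /Wn; pcnt.
Qed.

Lemma fresh_no_sep c d t : c \in X ++ Y -> d \in X ++ Y -> count_mem c w0 = 1 ->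
  count_mem t W = 1 -> prec W c 1 t 1 -> prec W t 1 d 1 -> False.
Proof.
move=> + + c1 tW pc pd; rewrite -!count_mem_gt0 !count_cat => cX dX.
have cP : count_mem c Pp = 0 by move: c1 cX; rewrite /w0; cnt; lia.
have tP : count_mem t Pp = 0.
  apply/eqP; rewrite -leqn0 leqNgt; apply/negP => tP.
  have : 1 <= count_mem c Pp by apply: (use_prec _ pc) tP => //; rewrite /w /w0 -!catA.
  by rewrite cP.
have tA : 1 <= count_mem t (Pp ++ X ++ Zz ++ Y).
  apply: (use_prec (B := Qq ++ V1 ++ V2 ++ Tt) _ pd) => //; first by rewrite /w /w0; lcat.
  by move: dX; cnt; lia.
have : t \in X ++ Zz ++ Y by rewrite -count_mem_gt0; move: tA; rewrite count_cat tP.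
by move/multi; move: tW; rewrite Wcount; lia.
Qed.

Lemma fresh_block c d r r' : c \in X ++ Y -> d \in X ++ Y ->
  count_mem c w0 = 1 -> count_mem d w0 = 1 -> in_block n c r -> in_block n d r' -> r = r'.
Proof.
move=> cX dX c1 d1 cr dr; case: (ltngtP r r') => // rr.
  have [t tW [pc pd]] := blocks_separated cr dr rr.
  by case: (fresh_no_sep cX dX c1 tW pc pd).
have [t tW [pc pd]] := blocks_separated dr cr rr.
by case: (fresh_no_sep dX cX d1 tW pc pd).
Qed.

(** [V1] and [V2] are X and Y in either order. All letters from X to Y are repeated, so [a] and [b]
    start in one block. As an x_j is alone in its block, both are among x, y, z_i; but if one is a
    z_i, either some second x_j falls into [V1 ++ V2] or the order of the recurrences is
    violated. *)
Lemma fresh_pair a b : a \in V1 -> b \in V2 -> a \notin V2 -> b \notin V1 ->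
  count_mem a w0 = 1 -> count_mem b w0 = 1 -> a = 0 /\ b = 1.
Proof.
move=> aV bV aV2 bV1 ca cb.
have aXY : a \in X ++ Y by rewrite -VXY mem_cat aV.
have bXY : b \in X ++ Y by rewrite -VXY mem_cat bV orbT.
have nab : a <> b by move=> e; rewrite e bV in aV2.
have [ra ar] := fresh_letter aXY; have [rb br] := fresh_letter bXY.
have rE := fresh_block aXY bXY ca cb ar br; subst rb.
have aV' := aV; have bV' := bV; rewrite -count_mem_gt0 in aV'; rewrite -count_mem_gt0 in bV'.
have a2 : 2 <= count_mem a (w0 ++ V1) by rewrite count_cat ca; lia.
have b1 : count_mem b (w0 ++ V1) = 1 by rewrite count_cat cb (count_memPn bV1).
have b2 : 2 <= count_mem b (w0 ++ V1 ++ V2) by rewrite count_cat cb count_cat; lia.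
have wE1 : w = (w0 ++ V1) ++ V2 ++ Tt by rewrite /w -catA.
have wE2 : w = (w0 ++ V1 ++ V2) ++ Tt by rewrite /w -!catA.
have wE0 : w = w0 ++ V1 ++ V2 ++ Tt by [].
(* An x_j recurring inside [V1 ++ V2] would start in the block of [a], where it tolerates no other
   letter. *)
have mid_x j : 0 < j <= 2 * n -> count_mem (lxi j) w0 < 2 ->
    2 <= count_mem (lxi j) (w0 ++ V1 ++ V2) -> a <> lxi j -> False.
  move=> jn lt ge naj.
  have jV : lxi j \in V1 ++ V2.
    by rewrite -count_mem_gt0; move: ge; rewrite count_cat; lia.
  have jXY : lxi j \in X ++ Y by rewrite -VXY.
  have j1 : count_mem (lxi j) w0 = 1.
    by have := XYw0 jXY; rewrite -count_mem_gt0; lia.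
  have [rj jr] := fresh_letter jXY.
  have e := fresh_block aXY jXY ca j1 ar jr; subst rj.
  by apply: naj; symmetry; apply: (in_block_uniq jr ar); exists j.
have ma : in_middle n a.
  case: (ar) => // j e _ _; case: nab; apply: (in_block_uniq ar br); by exists j.
have mb : in_middle n b.
  case: (br) => // j e _ _; case: nab; symmetry; apply: (in_block_uniq br ar); by exists j.
have P1 := @use_prec _ _ _ _ _ _ wE1; have P2 := @use_prec _ _ _ _ _ _ wE2.
have P0 := @use_prec _ _ _ _ _ _ wE0.
have x12 : 2 <= count_mem 1 (w0 ++ V1) -> 2 <= count_mem 0 (w0 ++ V1).
  by apply: P1 => //; apply: y2_x2.
case: ma => [a0|a1|[i ii ai]]; case: mb => [b0|b1'|[k kk bk]]; subst a b => //.
(* The second x_1 stands between the second y and all second z_k. *)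
- case: (@mid_x 1) => //; first by lia.
    rewrite ltnNge; apply/negP => /(P0 _ _ _ _ (@x2_y2 n 1) isT).
    by move/(P0 _ _ _ _ (@y2_x2 n) isT); rewrite ca.
  by apply: (P2 _ _ _ _ (@z2_xi2 n k 1 _ _)) b2; lia.
- by have := x12 a2; rewrite b1.
- case: (@mid_x 1) => //; first by lia.
    rewrite ltnNge; apply/negP => /(P0 _ _ _ _ (@x2_y2 n 1) isT).
    by rewrite ca.
  by apply: (P2 _ _ _ _ (@z2_xi2 n k 1 _ _)) b2; lia.
- by have := x12 (P1 _ _ _ _ (@z2_y2n n i) isT a2); rewrite b1.
- by have := P1 _ _ _ _ (@z2_y2n n i) isT a2; rewrite b1.
case: (ltngtP i k) => ik.
- have i0 : 0 < i by lia.
  have ikn : i < k <= 2 * n by lia.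
  case: (@mid_x k) => //.
  + rewrite ltnNge; apply/negP => /(P0 _ _ _ _ (xi2_z2 i0 ikn) isT).
    by rewrite ca.
  + by apply: (P2 _ _ _ _ (@z2_xi2 n k k _ _)) b2; lia.
  + by move/eqP; rewrite letter_eqs.
- have k0 : 0 < k by lia.
  have kin : k < i <= 2 * n by lia.
  have := P1 _ _ _ _ (@z2_xi2 n i i ii (leqnn i)) isT a2.
  by move/(P1 _ _ _ _ (xi2_z2 k0 kin) isT); rewrite b1.
- by case: nab; rewrite ik.
Qed.

End FreshPair.

Lemma split_subst f c Z : c \in subst f Z ->
  exists d Z1 Z2, [/\ Z = Z1 ++ d :: Z2, c \in f d & c \notin subst f Z1].
Proof.
elim: Z => //= a Z IH; rewrite subst_cons mem_cat.
have [ca _|ca /= /IH [d [Z1 [Z2 [-> cd nc]]]]] := boolP (c \in f a).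
  by exists a, [::], Z.
by exists d, (a :: Z1), Z2; split=> //; rewrite subst_cons mem_cat negb_or ca.
Qed.

Section NoXY.
Variables (n : nat) (P : word) (x : nat) (Z : word) (y : nat) (Q T : word).
Variables (f : nat -> word) (p' Rr : word).
Hypothesis Zsize : size Z < 2 * n.
Hypothesis HZ : forall z, z \in Z -> 2 <= count_mem z (P ++ x :: Z ++ y :: Q ++ x :: y :: T).
Hypothesis HT : {subset T <= P ++ x :: Z ++ y :: Q}.
Local Notation W := (Wn n).
Let Pp := p' ++ subst f P.
Let X := f x.
Let Zz := subst f Z.
Let Y := f y.
Let Qq := subst f Q.
Let Tt := subst f T.
Let w0 := Pp ++ X ++ Zz ++ Y ++ Qq.
Let w := w0 ++ X ++ Y ++ Tt ++ Rr.
Hypothesis kw : keep (fun=> 2) w = W.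
Hypotheses (x0 : 0 \in X) (y1 : 1 \in Y).
Hypotheses (c0 : count_mem 0 w0 = 1) (c1 : count_mem 1 w0 = 1).

Lemma up A B a i b j : w = A ++ B -> prec W a i b j -> j <= 2 ->
  j <= count_mem b A -> i <= count_mem a A.
Proof. by move=> wE pr j2; apply: (prec_keep kw wE pr). Qed.

(** A z_i starting in X, or in Y before y, would recur in the later X or Y, ahead of the second
    y. *)
Lemma zi_facts i : 0 < i <= 2 * n ->
  [/\ count_mem (lzi i) Pp = 0, count_mem (lzi i) X = 0, lzi i \in Zz &
      count_mem (lzi i) w0 < 2].
Proof.
move=> ii; set z := lzi i.
have x0' := x0; have y1' := y1; rewrite -count_mem_gt0 in x0'; rewrite -count_mem_gt0 in y1'.
have zP : count_mem z Pp = 0.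
  apply/eqP; rewrite -leqn0 leqNgt; apply/negP => zP.
  have : 1 <= count_mem 0 Pp.
    by apply: (up _ (@z1_x1 n i)) zP => //; rewrite /w /w0 -!catA.
  by move: c0 x0'; rewrite /w0; cnt; lia.
have zw0 : count_mem z w0 < 2.
  rewrite ltnNge; apply/negP => /(up (erefl w) (@z2_y2n n i) isT).
  by rewrite c1.
have zX : count_mem z X = 0.
  apply/eqP; rewrite -leqn0 leqNgt; apply/negP => zX.
  have : 2 <= count_mem z (w0 ++ X).
    by move: zX; rewrite /w0; cnt; lia.
  have wE : w = (w0 ++ X) ++ (Y ++ Tt ++ Rr) by rewrite /w -catA.
  move/(up wE (@z2_y2n n i) isT); rewrite count_cat c1.
  by move: c1 y1'; rewrite /w0; cnt; lia.
split=> //.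
have [Y1 [Y2 [YE yY1]]] := first_split y1.
have yY1' : count_mem 1 Y1 = 0 by apply/count_memPn.
have zY1 : z \notin Y1.
  apply/negP; rewrite -count_mem_gt0 => zY1.
  have : 2 <= count_mem z (w0 ++ X ++ Y1).
    by move: zY1; rewrite /w0 YE; cnt; lia.
  have wE : w = (w0 ++ X ++ Y1) ++ (1 :: Y2 ++ Tt ++ Rr).
    have e : X ++ Y ++ Tt ++ Rr = (X ++ Y1) ++ 1 :: Y2 ++ Tt ++ Rr by rewrite YE; lcat.
    by rewrite /w e catA.
  move/(up wE (@z2_y2n n i) isT); rewrite count_cat c1; move: c1 y1' yY1'; rewrite /w0; cnt; lia.
have : 1 <= count_mem z (Pp ++ X ++ Zz ++ Y1 ++ [:: 1]).
  apply: (up (B := Y2 ++ Qq ++ X ++ Y ++ Tt ++ Rr) _ (y1_z1 ii) isT).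
    by rewrite /w /w0 {1}YE; lcat.
  by cnt; lia.
have nPX V : count_mem z V = 0 -> z \in V = false by move/count_memPn/negbTE.
rewrite count_mem_gt0 mem_cat (nPX _ zP) mem_cat (nPX _ zX) mem_cat.
by rewrite mem_cat (negbTE zY1) mem_seq1 /z letter_eqs /= orbF.
Qed.

(** By the pigeonhole principle a single letter d of [Z] carries two letters z_i, z_j with i < j.
    Both recur in the same later copy of [f d], so the second x_j, lying between them, forces an x_j
    between z_i and z_j inside [f d]. In the first copy of [f d] this x_j comes too early: for j > n
    it precedes y, and for j at most n it is a second occurrence preceding the second z_i. *)
Lemma no_xy : False.
Proof.
have /choice [dd Hd] : forall i, exists d, 0 < i <= 2 * n ->
    exists Z1 Z2, [/\ Z = Z1 ++ d :: Z2, lzi i \in f d & lzi i \notin subst f Z1].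
  move=> i; case: (boolP (0 < i <= 2 * n)) => [ii|]; last by exists 0.
  have [_ _ zZ _] := zi_facts ii.
  by have [d [Z1 [Z2 H]]] := split_subst zZ; exists d => _; exists Z1, Z2.
have [i [j [i0 ij dij]]] : exists i j, [/\ 0 < i, i < j <= 2 * n & dd i = dd j].
  apply: contrapT => H.
  have : size (map dd (iota 1 (2 * n))) <= size Z.
    apply: uniq_leq_size.
      rewrite map_inj_in_uniq ?iota_uniq // => i j; rewrite !mem_iota => ii jj e.
      case: (ltngtP i j) => // ij; case: H.
        by exists i, j; split=> //; lia.
      by exists j, i; split=> //; lia.
    move=> d /mapP [i]; rewrite mem_iota => ii ->.
    have [|Z1 [Z2 [-> _ _]]] := Hd i; first by lia.
    by rewrite mem_cat mem_head orbT.
  by rewrite size_map size_iota; lia.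
have ii : 0 < i <= 2 * n by move: i0 ij; clear; lia.
have jj : 0 < j <= 2 * n by move: ij; clear; lia.
have [Z1 [Z2 [ZE zid zi1]]] := Hd i ii.
have [Z1' [Z2' [ZE' zjd zj1]]] := Hd j jj.
rewrite -dij in ZE' zjd; set d := dd i in ZE zid ZE' zjd.
have nin c V : c \in f d -> c \notin subst f V -> d \notin V.
  by move=> cd; apply: contra => dV; apply/mem_subst; exists d.
have d1 := nin _ _ zid zi1; have d1' := nin _ _ zjd zj1.
have [eZ1 _] := split_unique (etrans (esym ZE) ZE') d1 d1'; subst Z1'.
have [ziP ziX _ ziw] := zi_facts ii; have [zjP zjX _ zjw] := zi_facts jj.
have ZzE : Zz = subst f Z1 ++ f d ++ subst f Z2 by rewrite /Zz ZE subst_cat subst_cons.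
pose D (z : nat) := [/\ count_mem z Pp = 0, count_mem z X = 0, z \in f d,
                       z \notin subst f Z1 & count_mem z w0 < 2].
have Di : D (lzi i) by split.
have Dj : D (lzi j) by split.
have Dfacts z : D z -> [/\ count_mem z (f d) = 1, count_mem z (subst f Z1) = 0,
    count_mem z (subst f Z2) = 0 & count_mem z Y = 0 /\ count_mem z Qq = 0].
  case=> zP zX; rewrite -count_mem_gt0 => zd /count_memPn z1 zw.
  by move: zP zX zd z1 zw; rewrite /w0 ZzE; cnt; clear => *; split; [lia | lia | lia | split; lia].
have [fi1 fi2 fi3 [fi4 fi5]] := Dfacts _ Di.
have dP : d \notin P.
  by apply/negP => dP; have /count_memPn := ziP; rewrite /Pp mem_cat negb_or => /andP [_];
     move/(nin _ _ zid); rewrite dP.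
have dx : d != x.
  by apply/eqP => e; have /count_memPn := ziX; rewrite /X -e zid.
have dy : d != y.
  by apply/eqP => e; have /count_memPn := fi4; rewrite /Y -e zid.
have d2 : d \notin Z2 by apply: (nin _ _ zid); apply/count_memPn.
have dQ : d \notin Q by apply: (nin _ _ zid); apply/count_memPn.
have dT : d \in T.
  have := HZ (z := d); rewrite ZE mem_cat mem_head orbT => /(_ isT).
  rewrite -count_mem_gt0; cnt; rewrite eqxx (eq_sym x) (eq_sym y) (negbTE dx) (negbTE dy).
  by rewrite (count_memPn dP) (count_memPn d1) (count_memPn d2) (count_memPn dQ); clear; lia.
have [T1 [T2 [TE dT1]]] := first_split dT.
(* A letter of [T] before its first d occurs in P, x, Z, y or Q, where d alone produces z_i and
   z_j. *)
have gap z : D z -> count_mem z (subst f T1) = 0.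
  move=> Dz; have [_ _ z2 [zY zQ]] := Dfacts _ Dz; have [zP zX zd z1 _] := Dz.
  apply/count_memPn/negP => /mem_subst [e eT1 ze].
  have : e \in P ++ x :: Z ++ y :: Q by apply: HT; rewrite TE mem_cat eT1.
  have nsub V : count_mem z (subst f V) = 0 -> e \notin V.
    by move=> /count_memPn; apply: contra => eV; apply/mem_subst; exists e.
  have eP : e \notin P by apply: nsub; move/eqP: zP; rewrite /Pp count_cat addn_eq0 => /andP [_ /eqP].
  have ex : e != x by apply/eqP => E; have /count_memPn := zX; rewrite /X -E ze.
  have ey : e != y by apply/eqP => E; have /count_memPn := zY; rewrite /Y -E ze.
  have e1 : e \notin Z1 by apply: nsub; apply/count_memPn.
  have ed : e != d by apply/eqP => E; rewrite E in eT1; rewrite eT1 in dT1.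
  rewrite ZE !(mem_cat, inE) (negbTE eP) (negbTE ex) (negbTE ey) (negbTE e1) (negbTE ed).
  by rewrite (negbTE (nsub _ z2)) (negbTE (nsub _ zQ)).
pose pre := Pp ++ X ++ subst f Z1.
pose S := pre ++ f d ++ subst f Z2 ++ Y ++ Qq ++ X ++ Y ++ subst f T1.
have wS : w = S ++ f d ++ subst f T2 ++ Rr.
  by rewrite /w /w0 ZzE /Tt TE subst_cat subst_cons /S /pre; lcat.
have pre0 z : D z -> count_mem z pre = 0.
  move=> Dz; have [f1 f2 f3 [f4 f5]] := Dfacts _ Dz; have [zP zX _ _ _] := Dz.
  by rewrite /pre count_cat zP count_cat zX f2.
have S1 z : D z -> count_mem z S = 1.
  move=> Dz; have [f1 f2 f3 [f4 f5]] := Dfacts _ Dz; have [zP zX _ _ _] := Dz.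
  rewrite /S count_cat (pre0 _ Dz) count_cat f1 count_cat f3 count_cat f4.
  by rewrite count_cat f5 count_cat zX count_cat f4 (gap _ Dz).
have [g1 [g2 [fdE zig1]]] := first_split zid.
have wp : w = pre ++ f d ++ (subst f Z2 ++ Y ++ Qq ++ X ++ Y ++ Tt ++ Rr).
  by rewrite /w /w0 ZzE /pre; lcat.
have nij : (lzi i == lzi j) = false by rewrite letter_eqs; move: ij; clear; lia.
have zjg1 : lzi j \notin g1.
  apply/negP; rewrite -count_mem_gt0 => zj.
  have : 1 <= count_mem (lzi i) (pre ++ g1).
    apply: (up (B := lzi i :: g2 ++ (subst f Z2 ++ Y ++ Qq ++ X ++ Y ++ Tt ++ Rr)) _
      (z1_z1 i0 ij) isT); first by rewrite wp fdE; lcat.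
    by rewrite count_cat; apply: leq_trans zj (leq_addl _ _).
  by rewrite count_cat (pre0 _ Di) (count_memPn zig1).
have zjg2 : lzi j \in g2.
  by move: zjd; rewrite fdE mem_cat inE (negbTE zjg1) eq_sym nij.
have [g3 [g4 [g2E zjg3]]] := first_split zjg2.
have zig3 : count_mem (lzi i) g3 = 0.
  by move: fi1; rewrite fdE g2E; cnt; rewrite eqxx; clear; lia.
have gz1 := count_memPn zig1; have gz2 := count_memPn zjg1; have gz3 := count_memPn zjg3.
have nzx k : ((lzi k == lxi j) = false) by rewrite letter_eqs.
(* This is read off from the copy of [f d] in [Tt], which contains the second z_i and z_j. *)
have x3 : 1 <= count_mem (lxi j) g3.
  have H2 : 2 <= count_mem (lxi j) (S ++ g1 ++ lzi i :: g3 ++ [:: lzi j]).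
    apply: (up (B := g4 ++ subst f T2 ++ Rr) _ (z2_xi2 jj (leqnn j)) isT).
      by rewrite wS fdE g2E; lcat.
    by rewrite count_cat (S1 _ Dj); cnt; rewrite eqxx; clear; lia.
  have H1 : count_mem (lxi j) (S ++ g1) < 2.
    rewrite ltnNge; apply/negP => H.
    have wE : w = (S ++ g1) ++ (lzi i :: g2 ++ subst f T2 ++ Rr).
      by rewrite wS fdE -!catA.
    by have := up wE (xi2_z2 i0 ij) isT H; rewrite count_cat (S1 _ Di) gz1.
  by move: H1 H2; cnt; rewrite !nzx; clear; lia.
have wA3 : w = (pre ++ g1 ++ lzi i :: g3) ++
    lzi j :: g4 ++ (subst f Z2 ++ Y ++ Qq ++ X ++ Y ++ Tt ++ Rr).
  by rewrite wp fdE g2E; lcat.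
have zi3 : count_mem (lzi i) (pre ++ g1 ++ lzi i :: g3) = 1.
  by rewrite count_cat (pre0 _ Di) count_cat /= gz1 eqxx zig3.
have zj3 : count_mem (lzi j) (pre ++ g1 ++ lzi i :: g3) = 0.
  by rewrite count_cat (pre0 _ Dj) count_cat /= gz2 gz3 nij.
have [jn|jn] := leqP j n.
  have jn' : 0 < j <= n by move: jj jn; clear; lia.
  have x1 : 1 <= count_mem (lxi j) (pre ++ g1 ++ [:: lzi i]).
    apply: (up (B := g2 ++ (subst f Z2 ++ Y ++ Qq ++ X ++ Y ++ Tt ++ Rr)) _
      (@z1_xi1 n i j jn') isT).
      by rewrite wp fdE; lcat.
    by cnt; rewrite eqxx; clear; lia.
  have : 2 <= count_mem (lxi j) (pre ++ g1 ++ lzi i :: g3).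
    by move: x1 x3; cnt; rewrite !nzx; clear; lia.
  by move/(up wA3 (xi2_z2 i0 ij) isT); rewrite zi3.
have : 1 <= count_mem (lxi j) (pre ++ g1 ++ lzi i :: g3).
  by move: x3; cnt; rewrite !nzx; clear; lia.
move/(up wA3 (xi1_y1 jn) isT) => yy.
by have := up wA3 (y1_z1 jj) isT yy; rewrite zj3.
Qed.

End NoXY.

(** Without [fsg] no letter starts in [T]; and [Z], as a part of [u], is too short to give each z_i
    a letter of its own. *)
Lemma Wn_runs E u n : basic E -> ~ holds E fsg -> size u < 2 * n ->
  run_swaps E (syn (target (fun=> 2) [::] (Wn n))) u.
Proof.
move=> bE nsg su P x Z y Q T R xy pe cx cy Z2 H.
have {H} [HZ HT] : run_free E u P x Z y Q T R.
  by case: H => // g2; case: nsg; apply: fg3_fsg => //; apply: fg2_fg3.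
have HTin : {subset T <= P ++ x :: Z ++ y :: Q}.
  move=> c /first_split [T1 [T2 [TE cT1]]].
  have [|/(HT _ _ _ TE) []//] := boolP (c \in P ++ x :: Z ++ y :: Q ++ x :: y :: T1).
  rewrite !(mem_cat, inE) (negbTE cT1) !orbF.
  by do ![case/orP]; move=> ->; rewrite ?orbT.
have sZ : size Z < 2 * n.
  apply: leq_trans su; rewrite ltnS -(perm_size pe) !size_cat /= !size_cat /=; lia.
move=> f p' q'.
pose Pp := p' ++ subst f P; pose X := f x; pose Zz := subst f Z; pose Y := f y.
pose Qq := subst f Q; pose Tt := subst f T; pose Rr := subst f R ++ q'.
pose w0 := Pp ++ X ++ Zz ++ Y ++ Qq.
have -> : p' ++ subst f (P ++ x :: Z ++ y :: Q ++ x :: y :: T ++ R) ++ q' =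
          w0 ++ X ++ Y ++ Tt ++ Rr.
  rewrite !(subst_cat, subst_cons) /w0 /Pp /X /Zz /Y /Qq /Tt /Rr; by lcat.
have -> : p' ++ subst f (P ++ x :: Z ++ y :: Q ++ y :: x :: T ++ R) ++ q' =
          w0 ++ Y ++ X ++ Tt ++ Rr.
  rewrite !(subst_cat, subst_cons) /w0 /Pp /X /Zz /Y /Qq /Tt /Rr; by lcat.
have cE c : count_mem c (w0 ++ X ++ Y ++ Tt ++ Rr) =
            count_mem c (w0 ++ Y ++ X ++ Tt ++ Rr).
  by rewrite !count_cat; clear; lia.
have multi c : c \in X ++ Zz ++ Y -> 2 <= count_mem c (w0 ++ X ++ Y ++ Tt ++ Rr).
  rewrite !mem_cat => /or3P [cX|cZ|cY].
  - by move: cX; rewrite -count_mem_gt0 /w0 !count_cat; clear; lia.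
  - have /mem_subst [d dZ cd] := cZ.
    have := count_subst2 (HZ d dZ) cd.
    rewrite !(subst_cat, subst_cons) /w0 /Pp /X /Zz /Y /Qq /Tt /Rr !count_cat; clear; lia.
  - by move: cY; rewrite -count_mem_gt0 /w0 !count_cat; clear; lia.
have kE : (keep (fun=> 2) (w0 ++ X ++ Y ++ Tt ++ Rr) = Wn n \/
           keep (fun=> 2) (w0 ++ Y ++ X ++ Tt ++ Rr) = Wn n) ->
   keep (fun=> 2) (w0 ++ X ++ Y ++ Tt ++ Rr) = keep (fun=> 2) (w0 ++ Y ++ X ++ Tt ++ Rr).
  move=> H; apply: keep_swap => //.
  - by move=> c cX; rewrite /w0 !mem_cat cX !orbT.
  - by move=> c cX; rewrite /w0 !mem_cat cX !orbT.
  move=> a b aX bY ca _ cb _.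
  have aY : a \notin Y.
    by move: aX ca; rewrite -!count_mem_gt0 /w0 !count_cat; clear; lia.
  have bX : b \notin X.
    by move: bY cb; rewrite -!count_mem_gt0 /w0 !count_cat; clear; lia.
  case: H => kw.
    have [a0 b1] : a = 0 /\ b = 1.
      exact: (@fresh_pair n Pp X Zz Y Qq X Y (Tt ++ Rr) kw (fun c => erefl) multi a b).
    subst a b; exact: (@no_xy n P x Z y Q T f p' Rr sZ HZ HTin kw aX bY ca cb).
  have VXY c : (c \in Y ++ X) = (c \in X ++ Y) by rewrite !mem_cat orbC.
  have multi' c : c \in X ++ Zz ++ Y -> 2 <= count_mem c (w0 ++ Y ++ X ++ Tt ++ Rr).
    by move/multi; rewrite cE.
  have [b0 a1] : b = 0 /\ a = 1.
    exact: (@fresh_pair n Pp X Zz Y Qq Y X (Tt ++ Rr) kw VXY multi' b a).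
  subst a b.
  have : 1 <= count_mem 0 (Pp ++ X).
    apply: (prec_keep kw (B := Zz ++ Y ++ Qq ++ Y ++ X ++ Tt ++ Rr) _ (@y1_x1 n)) => //.
      by rewrite /w0 -!catA.
    by move: aX; rewrite -count_mem_gt0 !count_cat; clear; lia.
  by move: bY cb; rewrite -count_mem_gt0 /w0 !count_cat; clear; lia.
split=> -[kW _]; split=> //.
- by rewrite -kE; [|left].
- by rewrite kE; [|right].
Qed.

Lemma Wn_basic n : basic (syn (target (fun=> 2) [::] (Wn n))).
Proof.
split; first exact: syn_theory.
  exact: target_id1.
by apply: target_id2 => //; apply: Wn_squarefree.
Qed.

Lemma Wn_not_w n : ~ syn (target (fun=> 2) [::] (Wn n)) (w_word (1%g : 'S_(2 * n)) 1%g)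
  (w'_word (1%g : 'S_(2 * n)) 1%g).
Proof.
move=> /(_ (fun a => [:: a]) [::] [::]); rewrite !subst_id !cats0 /= => -[H _].
have pe : perm_eq (w_word (1%g : 'S_(2 * n)) 1%g) (w'_word (1%g : 'S_(2 * n)) 1%g).
  by rewrite /w_word /w'_word !perm_cat2l /= perm_cons (perm_catCA [:: lx] [:: ly]).
have W2 x : count_mem x (w_word (1%g : 'S_(2 * n)) 1%g) <= 2 by rewrite w_word1 Wn_count2.
have [] : target (fun=> 2) [::] (Wn n) (w'_word (1%g : 'S_(2 * n)) 1%g).
  by apply: H; split=> //; rewrite keep_id // w_word1.
rewrite keep_id => [|x _]; last by move/seq.permP: pe => <-.
rewrite -w_word1 /w_word /w'_word => /eqP.
by rewrite !eqseq_cat // !eqxx.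
Qed.

(** * The variety and its subvarieties *)

Lemma Gtheory_ids E : Gtheory E -> forall e, G_identities e -> E e.1 e.2.
Proof.
move=> gE e [[->|->]|[n [p [q [n1 ->]]]]].
- exact: (basic1 gE).
- exact: (basic2 gE).
- exact: (Gtheory_w gE).
Qed.

Lemma ids_Gtheory E : theory E -> (forall e, G_identities e -> E e.1 e.2) -> Gtheory E.
Proof.
move=> tE H; split; first split=> //.
- by apply: (H id1); left; left.
- by apply: (H id2); left; right.
- by move=> n p q n1; apply: (H (w_word p q, w'_word p q)); right; exists n, p, q.
Qed.

Lemma eqs_sub V W u v : subclass V W -> eqs W u v -> eqs V u v.
Proof. by move=> VW uv M /VW; apply: uv. Qed.

Lemma sub_Gtheory V : subclass V G_variety -> Gtheory (eqs V).
Proof.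
move=> VG; apply: ids_Gtheory => [|e Ge]; first exact: eqs_theory.
by apply: (eqs_sub VG); apply: eqs_var.
Qed.

Lemma EG_Gtheory : Gtheory (eqs G_variety).
Proof. exact: sub_Gtheory. Qed.

Lemma G_is_variety : is_variety G_variety.
Proof. by exists G_identities. Qed.

Lemma EG_fsg : ~ holds (eqs G_variety) fsg.
Proof.
move=> H; apply: W0_fsg.
exact: (eqs_var_min (syn_theory _) (Gtheory_ids W0_Gtheory) H).
Qed.

Lemma EG_flags e : e \in flags -> ~ holds (eqs G_variety) e.
Proof. by move=> ef H; apply: EG_fsg; apply: (flags_fsg EG_Gtheory ef H). Qed.

Lemma size_keep k w : size (keep k w) <= size w.
Proof.
elim: w k => //= a w IH k; case: (k a) => [|m] /=; last exact: IH.
exact: leq_trans (IH _) (leqnSn _).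
Qed.

Theorem G_not_finitely_based : ~ finitely_based G_variety.
Proof.
move=> [Sigma [/finite_seqP [s SE] GS]].
(* With this choice 2n exceeds the length of every left-hand side of the basis. *)
pose m := \max_(e <- s) size e.1; pose n := m.+1.
pose E' := syn (target (fun=> 2) [::] (Wn n)).
have bE' : basic E' := Wn_basic n.
have nf e : e \in flags -> ~ holds (eqs G_variety) e := @EG_flags e.
have tE : eqs G_variety =2 eqs (var Sigma).
  by move=> u v; apply/propext; split; apply: eqs_sub => M /GS.
have gE := EG_Gtheory.
have SE' e : Sigma e -> E' e.1 e.2.
  move=> Se; have uv : eqs G_variety e.1 e.2 by rewrite tE; apply: eqs_var.
  have es : e \in s by move: Se; rewrite SE.
  have sz : size (red e.1) < 2 * n.
    apply: (@leq_ltn_trans m); last by rewrite /n; clear; lia.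
    apply: leq_trans (size_keep _ _) _.
    exact: (@leq_bigmax_seq _ s xpredT (fun e : identity => size e.1) e es isT).
  apply: (thT2 bE' (E_red bE' (basic1 bE') e.1) (E_red bE' (basic1 bE') e.2)).
  have uv' : eqs G_variety (red e.1) (red e.2).
    by apply: (thT2 gE _ _ uv); apply: (congS gE); apply: (E_red gE (basic1 gE)).
  have L : linked (eqs G_variety) (red e.1) (red e.2).
    split=> //; [exact: two_red | exact: two_red |].
    rewrite /perm_eq; apply/allP => x _ /=; apply/eqP.
    by have [_] := count_class gE x (nf fe0 isT) uv' (two_red _) (two_red _); apply; apply: nf.
  apply: (linked_complete gE (Gtheory_fw gE) (nf fe2 isT) (nf fe3 isT) (nf fe4 isT) bE' _ L).
    (* No flag holds in G, so only the exchanges of [run_swaps] have content. *)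
    by move=> a; rewrite !inE; do ![case/orP]; move=> /eqP -> H; case: (nf _ _ H).
  exact: (Wn_runs gE EG_fsg sz).
apply: (@Wn_not_w n).
apply: (eqs_var_min bE' SE'); rewrite -tE.
exact: (Gtheory_w gE).
Qed.

(** * The free object of rank six *)

Section FinitelyGenerated.
Variables (V : monoid_class) (varV : is_variety V) (gE : Gtheory (eqs V)).

(** Erasing the other letters presents the free object of rank six as a quotient of all words. *)
Definition cut6 (a : nat) : word := if a < 6 then [:: a] else [::].
Definition cong6 (a b : word) : Prop := eqs V (subst cut6 a) (subst cut6 b).

Lemma cong6_congruence : congruence cong6.
Proof.
split.
- by move=> u; apply: (congR gE).
- by move=> u v; apply: (congS gE).
- by move=> v u w; apply: (congT gE).
- by move=> a b c d ab cd; rewrite /cong6 !subst_cat; apply: (congC gE).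
Qed.

Let M : monoidType := quo cong6_congruence.

Lemma cut6_id w : all (fun a => a < 6) w -> subst cut6 w = w.
Proof.
move=> /allP H; rewrite -[RHS]subst_id; apply: eq_subst => a /H.
by rewrite /cut6 => ->.
Qed.

Lemma cut6_lt w : all (fun a => a < 6) (subst cut6 w).
Proof.
by apply/allP => a /mem_subst [b _]; rewrite /cut6; case: ifP => // b6; rewrite inE => /eqP ->.
Qed.

Lemma size_two6 w : two w -> all (fun a => a < 6) w -> size w <= 12.
Proof.
move=> tw /allP H; rewrite -[w]map_fst_ann size_map.
have -> : 12 = size [seq (i, b) | i <- iota 0 6, b <- [:: false; true]] by [].
apply: uniq_leq_size; first exact: uniq_ann.
move=> [a b] ab; apply/allpairsP; exists (a, b); split=> //=; last by case: (b).
have aw : a \in w by rewrite -(map_fst_ann w); apply/mapP; exists (a, b).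
by rewrite -[[:: _; _; _; _; _; _]]/(iota 0 6) mem_iota H.
Qed.

Lemma M_finite : finite_set [set: M].
Proof.
pose g (b : 12.-bseq 'I_6) : M := quo_pi cong6_congruence (map val b).
apply: (@sub_finite_set _ _ (range g)); last exact: finite_image.
move=> m _; rewrite -[m]quo_piK; set w := sval m.
pose r := red (subst cut6 w).
have r6 : all (fun a => a < 6) r.
  by apply/allP => a /mem_keep; apply: (allP (cut6_lt w)).
have s12 : size (pmap insub r : seq 'I_6) <= 12.
  by rewrite size_pmap_sub (leq_trans (count_size _ _)) // size_two6 //; apply: two_red.
exists (Bseq s12) => //; rewrite /g /=.
have -> : map val (pmap insub r : seq 'I_6) = r.
  rewrite pmap_filter; last by move=> a; rewrite /oapp; case: insubP.
  by apply/all_filterP; apply/allP => a /(allP r6) a6; rewrite insubT.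
apply/quo_pi_eq; rewrite /cong6 cut6_id //; apply: (congS gE).
exact: (E_red gE (basic1 gE)).
Qed.

(** A flag of [M], evaluated at the generators, is a flag of [V] because it uses letters below 6
    only; [determinacy] does the rest. *)
Lemma M_satisfies u v : satisfies M (u, v) <-> eqs V u v.
Proof.
have sub a b : eqs V a b -> satisfies M (a, b).
  move=> ab; apply/quo_satisfies => f; rewrite /cong6 !subst_comp.
  exact: (theoryF gE).
have tM : theory (fun a b => satisfies M (a, b)).
  split; first split.
  - by move=> a phi.
  - by move=> a b ab phi; rewrite /= (ab phi).
  - by move=> b a c ab bc phi; rewrite /= (ab phi) (bc phi).
  - by move=> a b c d ab cd phi; rewrite /= !eval_cat (ab phi) (cd phi).
  - by move=> f a b ab phi; rewrite /= !eval_subst (ab _).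
have gM : Gtheory (fun a b => satisfies M (a, b)).
  by apply: ids_Gtheory => // e Ge; apply: sub; apply: Gtheory_ids.
split=> [uv|]; last exact: sub.
apply: (determinacy gM gE _ uv) => e ef; rewrite /holds => /quo_satisfies /(_ (fun a => [:: a])).
have : all (fun e : identity => all (fun a => a < 6) e.1 && all (fun a => a < 6) e.2) flags by [].
by move=> /allP /(_ e ef) /andP [e1 e2]; rewrite /cong6 !subst_id !cut6_id.
Qed.

Lemma variety_finitely_generated : finitely_generated V.
Proof.
exists M; split; first exact: M_finite.
move=> N; split=> [VN W [S WS] WM|H].
  apply/WS => e Se; move/WS: WM => /(_ e Se).
  rewrite [e]surjective_pairing => /M_satisfies; exact.
apply: H => //; apply/(variety_eqsP varV) => u v uv; exact/M_satisfies.
Qed.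

End FinitelyGenerated.

Definition Sig (S : {set 'I_(size flags)}) : set identity :=
  ([set id1; id2] `|` [set nth fe0 flags j | j in [set j : 'I_(size flags) | j \in S]])%classic.

Lemma Sig_finite S : finite_set (Sig S).
Proof.
rewrite /Sig finite_setU; split; first by rewrite finite_setU; split; apply: finite_set1.
exact: finite_image.
Qed.

(** The tail of w_n contains all z_i and starts no new letter, so it is trivially repeatable and
    [run_fsg] applies. *)
Lemma fsg_Gtheory E : basic E -> holds E fsg -> Gtheory E.
Proof.
move=> bE sg; split=> // n p q n1.
have := @run_fsg E bE (wA n) lx (wB n) ly (wC n ++ [:: lt]) (wD p q) [::] sg.
rewrite /w_word /w'_word -/(wA n) -/(wB n) -/(wC n) -/(wD p q); lcat; apply.
  move=> z zB; have := wB_sub p q zB; move: zB; rewrite -!count_mem_gt0; cnt; lia.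
move=> T1 c T2 TE nc; have : c \in wD p q by rewrite TE mem_cat mem_head orbT.
move/wD_sub; rewrite !mem_cat => H; case/negP: nc.
by rewrite !(mem_cat, inE); case/or3P: H => ->; rewrite ?orbT.
Qed.

(** [determinacy] asks that the flags of [V] follow from the basis and that the basis imply all w_n
    = w_n'; the latter comes from [fsg], one of these flags. *)
Lemma flag_basis V : is_variety V -> subclass V G_variety -> holds (eqs V) fsg ->
  same_class V (var (Sig [set j : 'I_(size flags) | `[< holds (eqs V) (nth fe0 flags j) >]])).
Proof.
move=> vV VG sg; set S := [set j | _].
have gE := sub_Gtheory VG.
have flagS e : e \in flags -> holds (eqs V) e -> Sig S e.
  move=> ef H; right; have lt : index e flags < size flags by rewrite index_mem.
  exists (Ordinal lt) => /=; last by rewrite nth_index.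
  by rewrite inE; apply/asboolP; rewrite nth_index.
have VS : subclass V (var (Sig S)).
  move=> M VM e [[->|->]|[j /= jS <-]].
  - exact: (basic1 gE).
  - exact: (basic2 gE).
  - by move: jS; rewrite inE => /asboolP H; rewrite [nth _ _ _]surjective_pairing; apply: H.
move=> M; split; first exact: VS.
have bE2 : basic (eqs (var (Sig S))).
  split; first exact: eqs_theory.
  - by apply: (eqs_var (e := id1)); left; left.
  - by apply: (eqs_var (e := id2)); left; right.
have gE2 : Gtheory (eqs (var (Sig S))).
  by apply: fsg_Gtheory => //; apply: (eqs_var (e := fsg)); apply: flagS.
move=> SM; apply/(variety_eqsP vV) => u v uv.
apply: (determinacy gE gE2 _ uv) => // e ef H.
by apply: eqs_var; apply: flagS.
Qed.

(** Without [fsg] there is no flag at all, and [determinacy] would put the theory of [V] inside that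
    of G. *)
Lemma proper_fsg V : is_variety V -> proper_subclass V G_variety -> holds (eqs V) fsg.
Proof.
move=> vV [VG nVG]; apply: contrapT => nsg; apply: nVG => M; split; first exact: VG.
have gE := sub_Gtheory VG.
move=> GM; apply/(variety_eqsP vV) => u v uv.
apply: (determinacy gE EG_Gtheory _ uv) => // e ef H.
by case: nsg; apply: (flags_fsg gE ef H).
Qed.

Lemma proper_Cross V : is_variety V -> proper_subclass V G_variety -> Cross V.
Proof.
move=> vV pV; have sg := proper_fsg vV pV; have VG := pV.1; split.
- by eexists; split; last exact: flag_basis; apply: Sig_finite.
- exact: variety_finitely_generated (sub_Gtheory VG).
exists #|{set 'I_(size flags)}|, (fun i => var (Sig (enum_val i))) => W vW WV.
exists (enum_rank [set j : 'I_(size flags) | `[< holds (eqs W) (nth fe0 flags j) >]]); rewrite enum_rankK.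
apply: flag_basis => //; first by move=> M /WV /VG.
exact: eqs_sub WV sg.
Qed.

Theorem proposition3p6 :
  ~ finitely_based G_variety /\
  finitely_generated G_variety /\
  almost_Cross G_variety.
Proof.
split; first exact: G_not_finitely_based.
split; first exact: (variety_finitely_generated G_is_variety EG_Gtheory).
split; first exact: G_is_variety.
  by case=> fb _ _; apply: G_not_finitely_based.
exact: proper_Cross.
Qed.
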